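(* Let $\mathcal{A},\mathcal{B}$ be relational structures with finite disjoint signatures and the same countable (not necessarily infinite) domain $A$, both $\omega$-categorical, such that every relation in $\mathrm{Orb}(\mathcal{B})$ is existential positive definable in $\mathcal{A}$, and $\mathrm{CSP}(\mathcal{A})$ is in $\mathsf{P}$. Then $\mathrm{CSP}(\mathcal{A},\mathcal{B})$ is in $\mathsf{FPT}$ parameterized by the number of alien constraints.
   Context: An automorphism of a structure is a permutation $\alpha$ of its domain such that $\alpha$ and $\alpha^{-1}$ preserve all relations; $\mathrm{Aut}(\mathcal{B})$ is the automorphism group. The orbit of $(a_1,\dots,a_n)$ is $\{(\alpha(a_1),\dots,\alpha(a_n)):\alpha\in\mathrm{Aut}(\mathcal{B})\}$; $\mathrm{Orb}(\mathcal{B})$ is the set of orbits of $n$-tuples for all $n\ge1$. A countable structure is $\omega$-categorical iff its automorphism group has finitely many orbits of $n$-tuples for each $n$. A relation is existential positive definable in $\mathcal{A}$ if it is defined by a formula built from relations of $\mathcal{A}$ and equality using $\wedge$, $\vee$ and $\exists$ (equivalently, it is a finite union of relations pp-definable over $\mathcal{A}$). $\mathrm{CSP}(\mathcal{A},\mathcal{B})$: given $k$ and an instance $(V,C_1\cup C_2)$ of $\mathrm{CSP}(\mathcal{A}\cup\mathcal{B})$ with $C_1$ over $\mathcal{A}$, $C_2$ (alien constraints) over $\mathcal{B}$, $|C_2|\le k$, decide satisfiability; parameter $k$. $\mathsf{FPT}$: time $f(k)n^{O(1)}$. *)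

(* Defs.v *)
From mathcomp Require Import all_boot.
Set Implicit Arguments. Unset Strict Implicit. Unset Printing Implicit Defensive.

(* Relation symbols are 0 .. nrel-1; symbol i has arity ar i and is     *)
(* interpreted by rel i, a predicate on tuples (seq T) of length ar i.  *)
(* Values of ar/rel at indices >= nrel are irrelevant junk.             *)
Record structure (T : Type) := Struct {
  nrel : nat;
  ar : nat -> nat;
  rel : nat -> seq T -> Prop }.

Definition sunion T (A B : structure T) : structure T :=
  Struct (nrel A + nrel B)
    (fun i => if i < nrel A then ar A i else ar B (i - nrel A))
    (fun i => if i < nrel A then rel A i else rel B (i - nrel A)).

Definition is_aut T (S : structure T) (f : T -> T) : Prop :=
  exists g : T -> T, cancel f g /\ cancel g f /\
    forall i, i < nrel S -> forall t : seq T, size t = ar S i ->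
      (rel S i t <-> rel S i (map f t)).

Definition aut_orbit T (S : structure T) (t : seq T) : seq T -> Prop :=
  fun s => exists f, is_aut S f /\ s = map f t.

Definition omega_categorical T (S : structure T) : Prop :=
  forall n, exists reps : seq (seq T),
    forall t : seq T, size t = n ->
      exists2 i, i < size reps & aut_orbit S (nth [::] reps i) t.

Inductive epf :=
  | EAtom (i : nat) (xs : seq nat)
  | EEq (x y : nat)
  | EAnd (p q : epf)
  | EOr (p q : epf)
  | EEx (x : nat) (p : epf).

Fixpoint holds T (S : structure T) (v : nat -> T) (p : epf) : Prop :=
  match p with
  | EAtom i xs => i < nrel S /\ size xs = ar S i /\ rel S i (map v xs)
  | EEq x y => v x = v y
  | EAnd p q => holds S v p /\ holds S v q
  | EOr p q => holds S v p \/ holds S v q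
  | EEx x p => exists a : T, holds S (fun y => if y == x then a else v y) p
  end.

Fixpoint fv (p : epf) : seq nat :=
  match p with
  | EAtom _ xs => xs
  | EEq x y => [:: x; y]
  | EAnd p q => fv p ++ fv q
  | EOr p q => fv p ++ fv q
  | EEx x p => filter (fun y => y != x) (fv p)
  end.

Definition ep_definable T (S : structure T) (n : nat) (R : seq T -> Prop) :=
  exists p : epf, all (fun x => x < n) (fv p) /\
    forall t : seq T, size t = n ->
      (R t <-> exists v : nat -> T, t = map v (iota 0 n) /\ holds S v p).

(* Variables are 0..nv-1; a constraint is (symbol, tuple of variables). *)
Record instance := Inst { nv : nat; constrs : seq (nat * seq nat) }.

Definition wf_inst T (S : structure T) (I : instance) : bool :=
  all (fun c => [&& c.1 < nrel S, size c.2 == ar S c.1 & all (fun x => x < nv I) c.2])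
      (constrs I).

Definition sat_inst T (S : structure T) (I : instance) : Prop :=
  exists s : seq T, size s = nv I /\
    forall c, c \in constrs I -> rel S c.1 (pmap (onth s) c.2).

Definition enc_nat (n : nat) : seq bool := nseq n true ++ [:: false].
Definition enc_nats (s : seq nat) : seq bool := flatten (map enc_nat s).
Definition enc_inst (I : instance) : seq bool :=
  enc_nats (nv I :: size (constrs I)
              :: flatten (map (fun c => c.1 :: size c.2 :: c.2) (constrs I))).

Definition CSP T (S : structure T) : seq bool -> Prop :=
  fun w => exists I, w = enc_inst I /\ wf_inst S I /\ sat_inst S I.

Definition CSP_alien T (A B : structure T) : nat -> seq bool -> Prop :=
  fun k w => exists I, w = enc_inst I /\ wf_inst (sunion A B) I /\
    count (fun c => nrel A <= c.1) (constrs I) <= k /\ sat_inst (sunion A B) I.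

Inductive move := MoveL | MoveR | Stay.

Record TM := MkTM {
  state : finType;
  sym : finType;
  blank : sym;
  inj : bool -> sym;
  q0 : state;
  halting : state -> bool;
  accepting : state -> bool;
  delta : state -> sym -> state * sym * move }.

(* configuration: state, left part (reversed), current symbol, right part *)
Definition config (M : TM) := (state M * seq (sym M) * sym M * seq (sym M))%type.

Definition step (M : TM) (c : config M) : config M :=
  let: (q, l, a, r) := c in
  if halting q then c else
  let: (q', b, m) := delta q a in
  match m with
  | MoveL => match l with [::] => (q', [::], b, r) | x :: l' => (q', l', x, b :: r) end
  | MoveR => match r with [::] => (q', b :: l, @blank M, [::]) | x :: r' => (q', b :: l, x, r') end
  | Stay => (q', l, b, r)
  end.

Definition init (M : TM) (w : seq bool) : config M :=
  match map (@inj M) w with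
  | [::] => (@q0 M, [::], @blank M, [::])
  | a :: r => (@q0 M, [::], a, r)
  end.

Definition cstate (M : TM) (c : config M) : state M := c.1.1.1.

Definition decides_within (M : TM) (w : seq bool) (t : nat) (P : Prop) : Prop :=
  let q := cstate (iter t (@step M) (@init M w)) in
  halting q /\ (accepting q <-> P).

Definition in_P (L : seq bool -> Prop) : Prop :=
  exists (M : TM) (c : nat), forall w, decides_within M w ((size w).+1 ^ c) (L w).

Definition in_FPT (L : nat -> seq bool -> Prop) : Prop :=
  exists (M : TM) (f : nat -> nat) (c : nat), forall k w,
    decides_within M (enc_nat k ++ w) (f k * (size w).+1 ^ c) (L k w).

(* Main.v *)
(* Every relation of B is a finite union of orbits, because B is
   omega-categorical, and each orbit is existential positive over A. Hence every
   relation of B is a finite disjunction of primitive positive formulas over A,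
   with at most D + 1 disjuncts, say. An instance with at most k alien
   constraints is satisfiable iff, for one of the at most (D + 1)^k ways to
   choose a disjunct for each alien constraint, the instance in which the alien
   constraints are replaced by the chosen formulas is satisfiable. The
   existential quantifiers of the formulas become fresh variables, and their
   equations are eliminated by identifying variables, so that each choice yields
   an instance of CSP(A) of polynomial size, to which the machine for CSP(A) is
   applied.

   The resulting algorithm is a while program on finitely many stacks. It is
   translated to a flowchart and then to a machine with one tape, on which
   each stack is a track with its top in the leftmost cell: a push or a pop
   is one sweep over the tape, so that the running time is at most squared, up to
   a constant and the length of the input. *)
From HB Require Import structures.
From mathcomp Require Import all_boot zify.
From Stdlib Require Import Classical.
Require Import Defs.
Set Implicit Arguments. Unset Strict Implicit. Unset Printing Implicit Defensive.

(** * Turing machines seen through their tape contents *)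

(** One machine has to serve every [k], and its finite control cannot know [k]. The choices are
    therefore the [k]-digit numbers in base [D + 1], kept on a stack and counted through like an
    odometer. A digit too large for its relation falls back to the first disjunct, so that one base
    suits all relations. Elimination fails only when the digits run out or an alien relation is
    empty, whatever the digits are; hence a single failure refutes the instance, and the check for
    at most [k] alien constraints comes for free. Equations have to be removed because equality need
    not be a relation of A; an eliminated variable stays in the instance, unconstrained. The program
    takes [(D + 1)^k] times a polynomial in [|w| + k]. The quadratic slowdown only doubles the
    exponent [k], and [|w| + k + 1 <= (|w| + 1)(k + 1)] splits the polynomial into a factor in [k]
    and one in the length of [w]. *)

Section Stack.
Variable G : finType.

Definition store := seq (seq G).
Definition get (s : store) i := nth [::] s i.
Definition upd (s : store) i v : store := set_nth [::] s i v.

Lemma get_upd s i v j : get (upd s i v) j = if j == i then v else get s j.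
Proof. by rewrite /get nth_set_nth /=; case: eqP. Qed.

(* An edge to [None] leaves the flowchart. *)
Inductive instr (X : Type) :=
  | IPush of nat & G & option X
  | IPop of nat & (option G -> option X)
  | IPeek of nat & (option G -> option X)
  | IHalt of bool.

Definition next X (c : instr X) (s : store) : (option X * store) + bool :=
  match c with
  | IPush i a y => inl (y, upd s i (a :: get s i))
  | IPop i f => inl (f (ohead (get s i)), upd s i (behead (get s i)))
  | IPeek i f => inl (f (ohead (get s i)), s)
  | IHalt b => inr b
  end.

Inductive outcome := Go of store | Stop of bool.

(** The two ways of ending are kept apart so that flowcharts compose: [Stop] is a verdict for the
    whole computation, [Go] leaves along a dangling edge that an enclosing flowchart may redirect.
    Only edges count as steps. *)
Inductive fruns X (g : X -> instr X) : X -> store -> nat -> outcome -> Prop :=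
  | fruns_halt x s b : next (g x) s = inr b -> fruns g x s 0 (Stop b)
  | fruns_exit x s s' : next (g x) s = inl (None, s') -> fruns g x s 1 (Go s')
  | fruns_step x s y s' n o : next (g x) s = inl (Some y, s') ->
      fruns g y s' n o -> fruns g x s n.+1 o.

(** The stages of a sweep. [PPush] walks right carrying the entry displaced from the cell before,
    and [PRet] walks back to cell 0. [PSeek] walks right to the first free cell of the track, and
    [PPop] walks back carrying the entry just lifted, so that each cell receives the entry of its
    right neighbour. *)
Inductive phase := PExec | PPush of option G | PRet | PSeek | PPop of option G.

Definition phase_enc (p : phase) : option (option (option (option G + option G))) :=
  match p with
  | PExec => None | PRet => Some None | PSeek => Some (Some None)
  | PPush c => Some (Some (Some (inl c))) | PPop c => Some (Some (Some (inr c)))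
  end.
Definition phase_dec p :=
  match p with
  | None => PExec | Some None => PRet | Some (Some None) => PSeek
  | Some (Some (Some (inl c))) => PPush c | Some (Some (Some (inr c))) => PPop c
  end.
Lemma phase_encK : cancel phase_enc phase_dec. Proof. by case. Qed.
HB.instance Definition _ := Finite.copy phase (can_type phase_encK).

End Stack.
Arguments Stop {G} b.

Section TapeView.
Variable M : TM.

(** The tape is read as a total function of the position, with blanks beyond its end, so that the
    blank cells created by moving right do not alter the description. *)
Definition tape_view (c : config M) (q : state M) (p : nat) (f : nat -> sym M) :=
  let: (q', l, a, r) := c in
  [/\ q' = q, size l = p & forall j, nth (@blank M) (rev l ++ a :: r) j = f j].

Lemma tape_view_ext c q p f f' : tape_view c q p f -> f =1 f' -> tape_view c q p f'.
Proof. by case: c => [[[q' l] a] r] [? ? H] E; split=> // j; rewrite H E. Qed.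

(** The truncated predecessor is exact: in [step], a left move in the leftmost cell stays there. *)
Lemma step_view c q p f q' b m : tape_view c q p f -> halting q = false ->
  delta q (f p) = (q', b, m) ->
  tape_view (step c) q' (match m with MoveL => p.-1 | MoveR => p.+1 | Stay => p end)
    (fun j => if j == p then b else f j).
Proof.
case: c => [[[q0 l] a] r] [-> sl fE] hq dE.
have fp : f p = a by rewrite -fE nth_cat size_rev sl ltnn subnn.
rewrite fp in dE.
have upd_tape r' : (forall j, nth (@blank M) r' j = nth (@blank M) (b :: r) j) ->
    forall j, nth (@blank M) (rev l ++ r') j = if j == p then b else f j.
  move=> Hr' j; rewrite -fE !nth_cat size_rev sl.
  case: (ltngtP j p) => // jp; rewrite Hr'; last by rewrite jp subnn.
  by move: jp; rewrite -subn_gt0; case: (j - p).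
rewrite /step hq dE; case: m {dE} => /=.
- case: l sl fE upd_tape => [|x l] /= sl fE upd_tape.
    by rewrite -sl in upd_tape *; split=> // j; apply: (upd_tape (b :: r)).
  split=> //; first by rewrite -sl.
  move=> j; have := upd_tape (b :: r) (fun=> erefl) j.
  by rewrite rev_cons cat_rcons.
- case: r fE upd_tape => [|x r'] fE upd_tape; split=> /=; rewrite ?sl // => j.
    rewrite rev_cons cat_rcons; apply: upd_tape; by case=> [|[|k]] //=; rewrite !nth_nil.
  by rewrite rev_cons cat_rcons; apply: upd_tape.
- by split=> // j; apply: upd_tape.
Qed.

Definition reach n (c : config M) := iter n (@step M) c.

Lemma reachS n c : reach n.+1 c = reach n (step c).
Proof. exact: iterSr. Qed.

Lemma reachD n1 n2 c : reach (n1 + n2) c = reach n1 (reach n2 c).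
Proof. exact: iterD. Qed.

Lemma reach_halt n c : halting (cstate c) -> reach n c = c.
Proof.
move=> h; elim: n => //= n ->.
by move: h; case: c => [[[q l] a] r] /=; rewrite /cstate /= => ->.
Qed.

End TapeView.
Arguments reach : simpl never.

(** * Flowcharts on stacks as one-tape machines with one track per stack *)

Section Compile.
Variables (G : finType) (X : finType) (g : X -> instr G X) (x0 : X).
Variables (m : nat) (bit : bool -> G).

(* Track [t] of cell [j] holds the [j]-th entry, from the top, of stack [t];
   the Boolean marks cell 0. *)
Definition cell : finType := (bool * {ffun 'I_m.+1 -> option G})%type.

Definition ids_ok (c : instr G X) :=
  match c with IPush i _ _ => i < m.+1 | IPop i _ => i < m.+1
  | IPeek i _ => i < m.+1 | IHalt _ => true end.
Hypothesis gm : forall x, ids_ok (g x).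

Definition setc (a : cell) (i : nat) (v : option G) : cell :=
  (a.1, [ffun t : 'I_m.+1 => if t == i :> nat then v else a.2 t]).
Definition getc (a : cell) (i : nat) : option G := a.2 (inord i).

(* [None] is the start state; [Some (inl b)] halts with verdict [b]. *)
Definition cst : finType := option (bool + X * phase G)%type.

Definition goto (y : option X) : cst :=
  Some (match y with Some x => inr (x, PExec _) | None => inl false end).

(** The first step only marks cell 0, which the input symbols leave unmarked; afterwards the mark
    tells the leftward sweeps where to stop. *)
Definition cdelta (q : cst) (a : cell) : cst * cell * move :=
  match q with
  | None => (goto (Some x0), (true, a.2), Stay)
  | Some (inl b) => (q, a, Stay)
  | Some (inr (x, ph)) =>
    let stay ph := Some (inr (x, ph)) in
    match g x with
    | IHalt b => (Some (inl b), a, Stay)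
    | IPeek i f => (goto (f (getc a i)), a, Stay)
    | IPush i c y =>
      match ph with
      | PPush c => let c' := getc a i in
        if c' is Some _ then (stay (PPush c'), setc a i c, MoveR)
        else (stay (PRet _), setc a i c, Stay)
      | PRet => if a.1 then (goto y, a, Stay) else (q, a, MoveL)
      | _ => (stay (PPush (Some c)), a, Stay)
      end
    | IPop i f =>
      match ph with
      | PSeek => if getc a i is Some _ then (q, a, MoveR) else (stay (PPop None), a, Stay)
      | PPop c => let c' := getc a i in
        if a.1 then (goto (f c'), setc a i c, Stay) else (stay (PPop c'), setc a i c, MoveL)
      | _ => (stay (PSeek _), a, Stay)
      end
    end
  end.

Definition cM : TM := @MkTM cst cell (false, [ffun=> None])
  (fun b => (false, [ffun t : 'I_m.+1 => if t == 0 :> nat then Some (bit b) else None]))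
  None (fun q => if q is Some (inl _) then true else false)
  (fun q => if q is Some (inl b) then b else false) cdelta.

Definition cells (s : store G) (j : nat) : cell :=
  (j == 0, [ffun t : 'I_m.+1 => onth (get s t) j]).

Lemma getc_cells s j i : i < m.+1 -> getc (cells s j) i = onth (get s i) j.
Proof. by move=> im; rewrite /getc ffunE inordK. Qed.

Definition at_rest (c : config cM) y s := @tape_view cM c (goto y) 0 (cells s).

(* The sweeps act on one track, so the intermediate tapes are described by the
   contents [h] of that track. *)
Definition mixed (s : store G) (i : nat) (h : nat -> option G) (j : nat) : cell :=
  (j == 0, [ffun t : 'I_m.+1 => if t == i :> nat then h j else onth (get s t) j]).

Lemma mixedE s i h j : i < m.+1 -> getc (mixed s i h j) i = h j.
Proof. by move=> im; rewrite /getc ffunE inordK // eqxx. Qed.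

Lemma setc_mixed s i h j v : setc (mixed s i h j) i v =
  mixed s i (fun k => if k == j then v else h k) j.
Proof.
by congr pair; apply/ffunP => t; rewrite !ffunE; case: (t == i :> nat); rewrite ?eqxx.
Qed.

Lemma mixed_ext s i h h' j : h j = h' j -> mixed s i h j = mixed s i h' j.
Proof. by move=> E; congr pair; apply/ffunP => t; rewrite !ffunE E. Qed.

Lemma cells_mixed s i : cells s =1 mixed s i (fun j => onth (get s i) j).
Proof. by move=> j; congr pair; apply/ffunP => t; rewrite !ffunE; case: eqP => [<-|]. Qed.

Lemma mixed_cells s i v : mixed s i (fun j => onth v j) =1 cells (upd s i v).
Proof.
by move=> j; congr pair; apply/ffunP => t; rewrite !ffunE get_upd; case: eqP.
Qed.

(** Induction on [k], the number of old entries still to be shifted: to the left of cell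
    [size S - k] the track already holds the new stack, and the state carries the entry to be
    written there. *)
Lemma push_sweep x i a y s c k : g x = IPush i a y ->
  let S := get s i in k <= size S ->
  @tape_view cM c (Some (inr (x, PPush (onth (a :: S) (size S - k))))) (size S - k)
    (mixed s i (fun j => if j < size S - k then onth (a :: S) j else onth S j)) ->
  @tape_view cM (reach k.+1 c) (Some (inr (x, PRet _))) (size S)
    (cells (upd s i (a :: S))).
Proof.
move=> gx S; have im : i < m.+1 by move: (gm x); rewrite gx.
elim: k c => [|k IH] c.
  rewrite subn0 => _ V.
  have := step_view V (erefl false).
  rewrite /= gx mixedE // ltnn onth_default // => /(_ _ _ _ erefl) /tape_view_ext; apply.
  move=> j; rewrite -(mixed_cells s i) setc_mixed.
  have [->|nj] := eqVneq j (size S); first by apply: mixed_ext; rewrite eqxx.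
  apply: mixed_ext; case: ltnP => // Sj.
  by rewrite !onth_default //= ltn_neqAle eq_sym nj.
move=> kS V.
have kS' : (size S - k.+1).+1 = size S - k by rewrite subnSK.
have lt : size S - k.+1 < size S by rewrite ltn_subrL /= (leq_trans _ kS).
have := step_view V (erefl false).
rewrite /= gx mixedE // ltnn.
case E : (onth S (size S - k.+1)) => [b|]; last first.
  by move: (onthTE S (size S - k.+1)); rewrite E lt.
move=> /(_ _ _ _ erefl) V'.
rewrite reachS; apply: IH; first exact: ltnW.
rewrite -kS' /= E; apply: (tape_view_ext V') => j /=.
rewrite setc_mixed; case: eqP => [->|/eqP nj]; apply: mixed_ext => /=.
  by rewrite eqxx ltnSn.
by rewrite ltnS [in RHS]leq_eqVlt (negPf nj).
Qed.

Lemma ret_sweep x i a y s p c : g x = IPush i a y ->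
  @tape_view cM c (Some (inr (x, PRet _))) p (cells s) -> at_rest (reach p.+1 c) y s.
Proof.
move=> gx; elim: p c => [|p IH] c V;
  have := step_view V (erefl false);
  rewrite /= gx /= => /(_ _ _ _ erefl) V'.
  by apply: (tape_view_ext V') => j; case: eqP => [->|].
rewrite reachS; apply: IH; apply: (tape_view_ext V') => j /=.
by case: eqP => [->|].
Qed.

Lemma run_push x i a y s c : g x = IPush i a y -> at_rest c (Some x) s ->
  at_rest (reach ((size (get s i)).+1 + (size (get s i)).+1).+1 c) y
    (upd s i (a :: get s i)).
Proof.
move=> gx V; have := step_view V (erefl false).
rewrite /= gx => /(_ _ _ _ erefl) V'.
rewrite reachS reachD; apply: (ret_sweep gx).
apply: (push_sweep gx) => //; rewrite subnn.
apply: (tape_view_ext V') => j /=.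
by rewrite -cells_mixed; case: eqP => [->|].
Qed.

Lemma seek_sweep x i f s c k : g x = IPop i f ->
  let S := get s i in k <= size S ->
  @tape_view cM c (Some (inr (x, PSeek _))) (size S - k) (cells s) ->
  @tape_view cM (reach k.+1 c) (Some (inr (x, PPop None))) (size S) (cells s).
Proof.
move=> gx S; have im : i < m.+1 by move: (gm x); rewrite gx.
elim: k c => [|k IH] c kS V; have := step_view V (erefl false);
  rewrite /= gx getc_cells // -/S.
  rewrite subn0 onth_default // => /(_ _ _ _ erefl) /tape_view_ext; apply => j.
  by case: eqP => [->|].
have lt : size S - k.+1 < size S by rewrite ltn_subrL /= (leq_trans _ kS).
case E : (onth S (size S - k.+1)) => [b|]; last first.
  by move: (onthTE S (size S - k.+1)); rewrite E lt.
move=> /(_ _ _ _ erefl) V'; rewrite reachS; apply: IH; first exact: ltnW.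
rewrite -subnSK //; apply: (tape_view_ext V') => j.
by case: eqP => [->|].
Qed.

(** On the way back, the cells beyond [p] already hold entries shifted one place to the left, and
    the state carries entry [p + 1] for cell [p]. At the marked cell the entry lifted is the old
    top, on which the branch depends. *)
Lemma pop_sweep x i f s c p : g x = IPop i f ->
  let S := get s i in
  @tape_view cM c (Some (inr (x, PPop (onth S p.+1)))) p
    (mixed s i (fun j => if j <= p then onth S j else onth S j.+1)) ->
  at_rest (reach p.+1 c) (f (ohead S)) (upd s i (behead S)).
Proof.
move=> gx S; have im : i < m.+1 by move: (gm x); rewrite gx.
have onthS j : onth (behead S) j = onth S j.+1 by case: (S) => [|? []] //=; rewrite onth0n.
elim: p c => [|p IH] c V; have := step_view V (erefl false);
  rewrite /= gx mixedE // leqnn.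
  have -> : onth S 0 = ohead S by case: (S).
  move=> /(_ _ _ _ erefl) V'.
  apply: (tape_view_ext V') => j; rewrite -(mixed_cells s i) setc_mixed.
  by case: j => [|j]; apply: mixed_ext; rewrite onthS.
move=> /(_ _ _ _ erefl) V'; rewrite reachS; apply: IH => /=.
apply: (tape_view_ext V') => j; rewrite setc_mixed.
case: eqP => [->|/eqP nj]; apply: mixed_ext => /=; first by rewrite eqxx ltnn.
by rewrite leq_eqVlt (negPf nj).
Qed.

Lemma run_pop x i f s c : g x = IPop i f -> at_rest c (Some x) s ->
  at_rest (reach ((size (get s i)).+1 + (size (get s i)).+1).+1 c) (f (ohead (get s i)))
    (upd s i (behead (get s i))).
Proof.
move=> gx V; have := step_view V (erefl false).
rewrite /= gx => /(_ _ _ _ erefl) V'.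
rewrite reachS reachD; apply: (pop_sweep gx).
rewrite onth_default //.
have V'' : @tape_view cM (reach (size (get s i)).+1 (step (M:=cM) c))
  (Some (inr (x, PPop None))) (size (get s i)) (cells s).
  apply: (seek_sweep gx) => //; rewrite subnn; apply: (tape_view_ext V') => j /=.
  by case: eqP => [->|].
apply: (tape_view_ext V'') => j; rewrite (cells_mixed s i); apply: mixed_ext.
by case: leqP => // jS; have jS2 := ltnW jS; rewrite !onth_default // leqW.
Qed.

(** A push or a pop costs one entering step and two sweeps of [size + 1] steps each, whence the
    bound. *)
Lemma run_instr x y s s' c : next (g x) s = inl (y, s') -> at_rest c (Some x) s ->
  exists2 n, n <= 2 * \max_(t < m.+1) size (get s t) + 3 & at_rest (reach n c) y s'.
Proof.
have bnd i : i < m.+1 -> ((size (get s i)).+1 + (size (get s i)).+1).+1 <=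
    2 * \max_(t < m.+1) size (get s t) + 3.
  move=> im; have /= := leq_bigmax (F := fun t : 'I_m.+1 => size (get s t)) (Ordinal im).
  by lia.
case E : (g x) => [i a y'|i f|i f|b] //= [<- <-] V; have := gm x; rewrite E /= => im.
- by exists ((size (get s i)).+1 + (size (get s i)).+1).+1; [apply: bnd | apply: run_push E V].
- by exists ((size (get s i)).+1 + (size (get s i)).+1).+1; [apply: bnd | apply: run_pop E V].
exists 1; first by rewrite addnC.
have := step_view V (erefl false); rewrite /= E => /(_ _ _ _ erefl) V'.
rewrite getc_cells // in V'.
have -> : ohead (get s i) = onth (get s i) 0 by case: get.
by apply: (tape_view_ext V') => j; case: eqP => [->|].
Qed.

Lemma run_max x y s s' : next (g x) s = inl (y, s') ->
  \max_(t < m.+1) size (get s' t) <= (\max_(t < m.+1) size (get s t)).+1.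
Proof.
move=> E; apply/bigmax_leqP => t _.
have B i (im : i < m.+1) : size (get s i) <= \max_(t < m.+1) size (get s t).
  exact: (leq_bigmax (Ordinal im)).
have := gm x; move: E; case: (g x) => [i a y'|i f|i f|b] //= [_ <-] im; rewrite ?get_upd;
  try case: eqP => _; rewrite /= ?size_behead ?ltnS ?B // leqW ?B //.
by rewrite (leq_trans (leq_pred _)) ?B.
Qed.

(** An instruction raises the tallest stack by at most one, so the maximal height plus the number of
    remaining steps never increases, and it bounds every sweep of the run. The extra unit in [n.+1]
    pays for the halting instruction, which [fruns] does not count. *)
Lemma run_fruns x s n b c : fruns g x s n (Stop b) -> at_rest c (Some x) s ->
  exists2 t, t <= n.+1 * (2 * (\max_(t < m.+1) size (get s t) + n) + 3)
    & cstate (reach t c) = Some (inl b).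
Proof.
move E : (Stop b) => o H; elim: H E c => {x s n o} [x s b0 H [e]|//|x s y s1 n o H _ IH E] c V.
  exists 1; first by rewrite mul1n addnC.
  rewrite -e in H.
  case E : (g x) H => [| | |b1] //= [E0]; rewrite E0 in E.
  have := step_view V (erefl false); rewrite /= E => /(_ _ _ _ erefl).
  by rewrite /cstate /reach /=; case: (step c) => [[[? ?] ?] ?] [-> _ _].
have [t1 Ht1 V1] := run_instr H V.
have [t2 Ht2 V2] := IH E _ V1.
exists (t2 + t1); last by rewrite reachD.
rewrite mulSn addnC leq_add //.
  by apply: leq_trans Ht1 _; rewrite leq_add2r leq_mul2l leq_addr.
apply: leq_trans Ht2 _; rewrite leq_mul2l leq_add2r leq_mul2l.
by rewrite addnS -addSn leq_add2r (run_max H) orbT.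
Qed.

Definition start w l : store G := map bit w :: nseq l [::].

Lemma run_cM w l n b : fruns g x0 (start w l) n (Stop b) ->
  exists2 t, t <= n.+1 * (2 * (size w + n) + 3) + 1
    & cstate (reach t (@init cM w)) = Some (inl b).
Proof.
move=> R.
(* The initial tape carries no mark on cell 0, so it is not yet of the form [cells]; the first step
   of the machine makes it so. *)
have V : @tape_view cM (@init cM w) None 0
   (fun j => (false, [ffun t : 'I_m.+1 => onth (get (start w l) t) j])).
  have E (j : nat) (u : seq bool) : nth (@blank cM) (map (@inj cM) u) j =
      (false, [ffun t : 'I_m.+1 => onth (get (start u l) t) j]).
    case: (ltnP j (size u)) => ju.
      rewrite (nth_map true) //=; congr pair; apply/ffunP => t; rewrite !ffunE /=.
      case: (nat_of_ord t) => [|t'] /=; last by rewrite /get /= nth_nseq if_same onth0n.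
      by rewrite onth_map onthE (nth_map true).
    rewrite nth_default ?size_map //=; congr pair; apply/ffunP => t; rewrite !ffunE /=.
    case: (nat_of_ord t) => [|t'] /=; last by rewrite /get /= nth_nseq if_same onth0n.
    by rewrite onth_default // size_map.
  rewrite /init; case: w R E => [|a w] R E; split=> // j; rewrite -E //=.
  by case: j => [|j] //=; rewrite nth_nil.
have := step_view V (erefl false).
rewrite /= => /(_ _ _ _ erefl) V'.
have [|t Ht V''] := @run_fruns x0 _ n b (@step cM (@init cM w)) R.
  apply: (tape_view_ext V') => j /=; case: eqP => [->|/eqP nj]; first by congr pair.
  by rewrite /cells (negPf nj).
exists (t + 1); last by rewrite reachD.
rewrite leq_add2r (leq_trans Ht) // leq_mul2l leq_add2r leq_mul2l leq_add2r /=.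
apply/bigmax_leqP => -[[|t'] ?] _; rewrite /get /= ?size_map //.
by rewrite nth_nseq if_same.
Qed.

End Compile.

(** * While programs on stacks *)

Section Prog.
Variable G : finType.

Inductive prog :=
  | Skip
  | Halt of bool
  | Push of nat & G
  | Pop of nat & (option G -> prog)
  | Seq of prog & prog
  | While of nat & (option G -> bool) & prog.

(* [T] is an upper bound on the number of steps. *)
Inductive runs : prog -> store G -> nat -> outcome G -> Prop :=
  | runs_skip s T : 0 < T -> runs Skip s T (Go s)
  | runs_halt b s T : runs (Halt b) s T (Stop b)
  | runs_push i a s T : 0 < T -> runs (Push i a) s T (Go (upd s i (a :: get s i)))
  | runs_pop i f s T o : runs (f (ohead (get s i))) (upd s i (behead (get s i))) T o ->
      runs (Pop i f) s T.+1 o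
  | runs_seq p q s s1 T1 T2 T o : runs p s T1 (Go s1) -> runs q s1 T2 o ->
      T1 + T2 <= T -> runs (Seq p q) s T o
  | runs_seq_stop p q s T b : runs p s T (Stop b) -> runs (Seq p q) s T (Stop b)
  | runs_while_end i f p s T : f (ohead (get s i)) = false -> 0 < T ->
      runs (While i f p) s T (Go s)
  | runs_while i (f : option G -> bool) p s s1 T1 T2 T o :
      f (ohead (get s i)) -> runs p s T1 (Go s1) ->
      runs (While i f p) s1 T2 o -> T1 + T2 < T -> runs (While i f p) s T o
  | runs_while_stop i (f : option G -> bool) p s T b : f (ohead (get s i)) -> runs p s T (Stop b) ->
      runs (While i f p) s T.+1 (Stop b).

(** [Pop] branches on the symbol read, so its nodes form a dependent sum over the symbols. The sum
    is finite because the stack alphabet is, which makes the nodes usable as machine states. *)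
Fixpoint node (p : prog) : finType :=
  match p with
  | Skip | Halt _ | Push _ _ => unit
  | Pop i f => option {x : option G & node (f x)}
  | Seq p q => (node p + node q)%type
  | While i f p => option (node p)
  end.

Fixpoint entry (p : prog) : node p :=
  match p with
  | Skip | Halt _ | Push _ _ => tt
  | Pop i f => None
  | Seq p q => inl (entry p)
  | While i f p => None
  end.

Definition relabel X Y (h : X -> Y) (e : option Y) (c : instr G X) : instr G Y :=
  let k o := if o is Some x then Some (h x) else e in
  match c with
  | IPush i a y => IPush i a (k y)
  | IPop i f => IPop i (fun x => k (f x))
  | IPeek i f => IPeek i (fun x => k (f x))
  | IHalt b => IHalt _ _ b
  end.

Fixpoint code (p : prog) : node p -> instr G (node p) :=
  match p return node p -> instr G (node p) with
  | Skip => fun _ => IPeek 0 (fun _ => None)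
  | Halt b => fun _ => IHalt _ _ b
  | Push i a => fun _ => IPush i a None
  | Pop i f => fun n => match n with
      | None => IPop i (fun x => Some (Some (existT _ x (entry (f x)))))
      | Some (existT x y) => relabel (fun z => Some (existT _ x z)) None (code y)
      end
  | Seq p q => fun n => match n with
      | inl x => relabel inl (Some (inr (entry q))) (code x)
      | inr y => relabel inr None (code y)
      end
  | While i f p => fun n => match n with
      | None => IPeek i (fun x => if f x then Some (Some (entry p)) else None)
      | Some x => relabel Some (Some None) (code x)
      end
  end.

Lemma next_relabel X Y (h : X -> Y) e c s : next (relabel h e c) s =
  match next c s with
  | inl (y, s') => inl (if y is Some x then Some (h x) else e, s')
  | inr b => inr b
  end.
Proof. by case: c. Qed.

(** Stated in continuation style: a run that leaves the component is prolonged by whatever run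
    starts at the redirected edge, and the step counts add up. This one form serves sequences,
    branches and loops. *)
Lemma fruns_relabel X Y (g : X -> instr G X) (g' : Y -> instr G Y) h e x s n o :
  (forall x, g' (h x) = relabel h e (g x)) -> fruns g x s n o ->
  match o with
  | Stop b => fruns g' (h x) s n (Stop b)
  | Go s' => if e is Some y then forall m o', fruns g' y s' m o' -> fruns g' (h x) s (n + m) o'
             else fruns g' (h x) s n (Go s')
  end.
Proof.
move=> H; elim=> {x s n o} [x s b E|x s s' E|x s y s' n o E _].
- by apply: fruns_halt; rewrite H next_relabel E.
- have := next_relabel h e (g x) s; rewrite E -H; case: e H => [y|] H E'.
    by move=> m o; apply: fruns_step.
  exact: fruns_exit.
- have := next_relabel h e (g x) s; rewrite E -H => E'.
  case: o => [s''|b]; last exact: fruns_step.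
  case: e H E' => [y'|] H E'; last exact: fruns_step.
  by move=> IH m o /IH; rewrite addSn; apply: fruns_step.
Qed.

Lemma code_correct p s T o : runs p s T o -> exists2 n, n <= T & fruns (@code p) (entry p) s n o.
Proof.
elim=> {p s T o}.
- by move=> s T T0; exists 1 => //; apply: fruns_exit.
- by move=> b s T; exists 0 => //; apply: fruns_halt.
- by move=> i a s T T0; exists 1 => //; apply: fruns_exit.
- move=> i f s T o _ [n nT R]; exists n.+1 => //; apply: fruns_step; first reflexivity.
  have H x := erefl (@code (Pop i f) (Some (existT _ (ohead (get s i)) x))).
  by case: o R => [s'|b] R; have := fruns_relabel H R.
- move=> p q s s1 T1 T2 T o _ [n1 nT1 R1] _ [n2 nT2 R2] TT.
  exists (n1 + n2); first by lia.
  have H x := erefl (@code (Seq p q) (inl x)).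
  apply: (fruns_relabel H R1).
  have H2 x := erefl (@code (Seq p q) (inr x)).
  by case: o R2 => [s'|b] R2; have := fruns_relabel H2 R2.
- move=> p q s T b _ [n nT R]; exists n => //.
  have H x := erefl (@code (Seq p q) (inl x)).
  exact: (fruns_relabel H R).
- move=> i f p s T E T0; exists 1 => //; apply: fruns_exit => /=; by rewrite E.
- move=> i f p s s1 T1 T2 T o E _ [n1 nT1 R1] _ [n2 nT2 R2] TT.
  exists (n1 + n2).+1; first by lia.
  apply: (@fruns_step _ _ _ _ _ (Some (entry p)) s) => /=; first by rewrite E.
  have H x := erefl (@code (While i f p) (Some x)).
  exact: (fruns_relabel H R1).
- move=> i f p s T b E _ [n nT R]; exists n.+1 => //.
  apply: (@fruns_step _ _ _ _ _ (Some (entry p)) s) => /=; first by rewrite E.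
  have H x := erefl (@code (While i f p) (Some x)).
  exact: (fruns_relabel H R).
Qed.

Fixpoint bnd (p : prog) : nat :=
  match p with
  | Skip | Halt _ => 0
  | Push i _ => i
  | Pop i f => maxn i (\max_(x : option G) bnd (f x))
  | Seq p q => maxn (bnd p) (bnd q)
  | While i f p => maxn i (bnd p)
  end.

Lemma ids_relabel (X Y : finType) (h : X -> Y) e c m : ids_ok m (relabel h e c) = ids_ok m c.
Proof. by case: c. Qed.

Lemma ids_code p m : bnd p <= m -> forall x, ids_ok m (@code p x).
Proof.
elim: p => [|b|i a|i f IH|p IHp q IHq|i f p IH] //=; rewrite ?geq_max.
- case/andP=> im fm [[y z]|] //=; rewrite ids_relabel; apply: IH.
  by apply: leq_trans fm; apply: (leq_bigmax y).
- by case/andP=> pm qm [x|y]; rewrite ids_relabel; [apply: IHp | apply: IHq].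
- by case/andP=> im pm [x|] //=; rewrite ids_relabel; apply: IH.
Qed.

Lemma runs_TM (bit : bool -> G) (p : prog) : exists M : TM, forall w l T b,
  runs p (start bit w l) T (Stop b) ->
  forall t, T.+1 * (2 * (size w + T) + 3) + 1 <= t ->
  let q := cstate (iter t (@step M) (@init M w)) in halting q /\ accepting q = b.
Proof.
have ok := @ids_code p (bnd p) (leqnn _).
exists (cM (@code p) (entry p) (bnd p) bit) => w l T b /code_correct[n nT R] t Ht.
have [t0 Ht0 E] := run_cM ok R.
rewrite /= -(subnK (_ : t0 <= t)); last first.
  apply: leq_trans Ht0 (leq_trans _ Ht); rewrite leq_add2r leq_mul //.
  by rewrite leq_add2r leq_mul2l leq_add2l.
have := reachD (t - t0) t0 (@init (cM (@code p) (entry p) (bnd p) bit) w).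
rewrite [in X in _ = X]reach_halt ?E // => EE.
by rewrite -[iter _ _ _]/(reach _ _) EE E.
Qed.

End Prog.

(** * Elementary stack programs *)

Section Macros.
Variable G : finType.
Implicit Types (s : store G) (p q : prog G).

Lemma updC s i j a b : i != j -> upd (upd s i a) j b = upd (upd s j b) i a.
Proof. by rewrite /upd set_set_nth => /negPf ->. Qed.

Lemma updK s i a b : upd (upd s i a) i b = upd s i b.
Proof. by rewrite /upd set_set_nth eqxx. Qed.

Lemma upd_get s i : i < size s -> upd s i (get s i) = s.
Proof.
move=> l; apply: (@eq_from_nth _ [::]); rewrite size_set_nth; first exact/maxn_idPr.
by move=> j _; rewrite nth_set_nth /=; case: eqP => // ->.
Qed.

Lemma get_upd_same s i a : get (upd s i a) i = a.
Proof. by rewrite get_upd eqxx. Qed.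

Lemma get_upd_other s i j a : j != i -> get (upd s i a) j = get s j.
Proof. by rewrite get_upd => /negPf ->. Qed.

Lemma size_upd s i a : i < size s -> size (upd s i a) = size s.
Proof. by move=> l; rewrite size_set_nth; apply/maxn_idPr. Qed.

Lemma runs_le p s T T' o : runs p s T o -> T <= T' -> runs p s T' o.
Proof.
move=> H; elim: H T' => {p s T o}.
- by move=> s T T0 T' /(leq_trans T0); apply: runs_skip.
- by move=> b s T T' _; apply: runs_halt.
- by move=> i a s T T0 T' /(leq_trans T0); apply: runs_push.
- by move=> i f s T o _ IH [//|T'] l; apply/runs_pop/IH.
- by move=> p q s s1 T1 T2 T o H1 _ H2 _ l T' l'; apply: (runs_seq H1 H2); lia.
- by move=> p q s T b _ IH T' l; apply/runs_seq_stop/IH.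
- by move=> i f p s T E T0 T' l; apply: runs_while_end => //; lia.
- by move=> i f p s s1 T1 T2 T o E H1 _ H2 _ l T' l'; apply: (runs_while E H1 H2); lia.
- by move=> i f p s T b E _ IH [//|T'] l; apply: (runs_while_stop E); apply: IH.
Qed.

Lemma runs_eq p s T o o' : runs p s T o -> o = o' -> runs p s T o'.
Proof. by move=> H <-. Qed.

Lemma runs_seqD p q s s1 T1 T2 o : runs p s T1 (Go s1) -> runs q s1 T2 o ->
  runs (Seq p q) s (T1 + T2) o.
Proof. by move=> H1 H2; apply: (runs_seq H1 H2). Qed.

Lemma runs_whileD i (f : option G -> bool) p s s1 T1 T2 o : f (ohead (get s i)) ->
  runs p s T1 (Go s1) -> runs (While i f p) s1 T2 o -> runs (While i f p) s (T1 + T2).+1 o.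
Proof. by move=> E H1 H2; apply: (runs_while E H1 H2). Qed.

Lemma runs_push1 i a s : runs (Push i a) s 1 (Go (upd s i (a :: get s i))).
Proof. exact: runs_push. Qed.

Lemma runs_skip1 s : runs (Skip G) s 1 (Go s).
Proof. exact: runs_skip. Qed.

Definition seqs (l : seq (prog G)) : prog G := foldr (@Seq G) (Skip G) l.
Definition pushes j (l : seq G) := seqs (map (Push j) l).

Lemma runs_pushes j l s : j < size s ->
  runs (pushes j l) s (size l).+1 (Go (upd s j (rev l ++ get s j))).
Proof.
elim: l s => [|a l IH] s js /=; first by rewrite upd_get //; apply: runs_skip.
have := IH (upd s j (a :: get s j)); rewrite size_upd // => /(_ js).
rewrite get_upd_same updK rev_cons cat_rcons => H.
exact: (runs_seqD (runs_push1 _ _ _) H).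
Qed.

Definition nonempty (x : option G) := isSome x.

Definition map_move i (g : G -> seq G) j : prog G :=
  While i nonempty (Pop i (fun x => if x is Some a then pushes j (g a) else Skip G)).

Lemma runs_map_move i g j K s : i != j -> i < size s -> j < size s ->
  (forall a, size (g a) <= K) ->
  runs (map_move i g j) s ((K + 4) * (size (get s i)) + 1)
    (Go (upd (upd s i [::]) j (rev (flatten (map g (get s i))) ++ get s j))).
Proof.
move=> ij is_ js gK; move E : (get s i) => l; elim: l s is_ js E => [|a l IH] s is_ js E /=.
  rewrite (updC _ _ _ ij) upd_get // -E upd_get //; apply: runs_while_end; rewrite ?E //; lia.
set s1 := upd (upd s i l) j (rev (g a) ++ get s j).
have s1s : size s1 = size s by rewrite !size_upd ?size_upd.
have gi : get s1 i = l by rewrite /s1 updC // get_upd_same.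
have := IH s1; rewrite s1s gi => /(_ is_ js erefl) H.
have Hb : runs (Pop i (fun x => if x is Some a then pushes j (g a) else Skip G)) s
    (K + 2) (Go s1).
  rewrite addn2; apply: runs_pop; rewrite E /=.
  have := @runs_pushes j (g a) (upd s i l); rewrite size_upd // get_upd_other 1?eq_sym //.
  by move=> /(_ js) Hp; apply: (runs_le Hp); rewrite ltnS.
have E2 : upd (upd s1 i [::]) j (rev (flatten (map g l)) ++ get s1 j) =
    upd (upd s i [::]) j (rev (flatten (map g (a :: l))) ++ get s j).
  rewrite /s1 get_upd_same rev_cat -catA.
  by rewrite -(updC _ _ _ ij) !updK.
rewrite E2 in H; apply: runs_le (runs_whileD _ Hb H) _; first by rewrite E.
by rewrite mulnS; lia.
Qed.

Definition transfer i j := map_move i (fun a => [:: a]) j.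

Lemma runs_transfer i j s : i != j -> i < size s -> j < size s ->
  runs (transfer i j) s (5 * (size (get s i)) + 1)
    (Go (upd (upd s i [::]) j (rev (get s i) ++ get s j))).
Proof.
move=> ij is_ js; have := @runs_map_move i (fun a => [:: a]) j 1 s ij is_ js (fun=> leqnn _).
by rewrite flatten_seq1.
Qed.

Definition clear i := While i nonempty (Pop i (fun=> Skip G)).

Lemma runs_clear i s : i < size s ->
  runs (clear i) s (3 * size (get s i) + 1) (Go (upd s i [::])).
Proof.
move=> is_; move E : (get s i) => l; elim: l s is_ E => [|a l IH] s is_ E /=.
  by rewrite -E upd_get //; apply: runs_while_end; rewrite ?E //; lia.
have := IH (upd s i l); rewrite size_upd // get_upd_same updK => /(_ is_ erefl) H.
have Hb : runs (Pop i (fun=> Skip G)) s 2 (Go (upd s i l)).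
  by apply: runs_pop; rewrite E /=; apply: runs_skip.
apply: runs_le (runs_whileD _ Hb H) _; first by rewrite E.
by rewrite mulnS; lia.
Qed.

Definition dup i j k := While i nonempty
  (Pop i (fun x => if x is Some a then Seq (Push j a) (Push k a) else Skip G)).

Lemma runs_dup i j k s : [&& i != j, i != k & j != k] ->
  [&& i < size s, j < size s & k < size s] ->
  runs (dup i j k) s (5 * size (get s i) + 1)
    (Go (upd (upd (upd s i [::]) j (rev (get s i) ++ get s j)) k (rev (get s i) ++ get s k))).
Proof.
case/and3P=> ij ik jk; move E : (get s i) => l; elim: l s E => [|a l IH] s E.
  case/and3P=> is_ js ks; rewrite /= -[X in upd s i X]E upd_get // upd_get // upd_get //.
  by apply: runs_while_end; rewrite ?E //; lia.
move=> /and3P[is_ js ks].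
set s1 := upd (upd (upd s i l) j (a :: get s j)) k (a :: get s k).
have s1s : size s1 = size s by rewrite !size_upd ?size_upd.
have gi : get s1 i = l by rewrite /s1 get_upd_other // get_upd_other // get_upd_same.
have := IH s1; rewrite s1s gi => /(_ erefl); rewrite is_ js ks => /(_ isT) H.
have Hb : runs (Pop i (fun x => if x is Some a then Seq (Push j a) (Push k a) else Skip G))
    s 3 (Go s1).
  apply: runs_pop; rewrite E /=; apply: runs_le (runs_seqD (runs_push1 _ _ _) _) (leqnn 2).
  have := runs_push1 k a (upd (upd s i l) j (a :: get (upd s i l) j)).
  by rewrite !get_upd_other // eq_sym.
have E2 : upd (upd (upd s1 i [::]) j (rev l ++ get s1 j)) k (rev l ++ get s1 k) =
    upd (upd (upd s i [::]) j (rev (a :: l) ++ get s j)) k (rev (a :: l) ++ get s k).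
  rewrite /s1 get_upd_same get_upd_other // get_upd_same !rev_cons !cat_rcons.
  by rewrite -(updC _ _ _ ik) -(updC _ _ _ ij) -(updC _ _ _ jk) !updK.
rewrite E2 in H; apply: runs_le (runs_whileD _ Hb H) _; first by rewrite E.
by rewrite /= mulnS; lia.
Qed.

(* [t] is a scratch stack, empty before and after. *)
Definition copy t i j := Seq (transfer i t) (dup t i j).

Lemma runs_copy t i j s : [&& t != i, t != j & i != j] ->
  [&& t < size s, i < size s & j < size s] -> get s t = [::] ->
  runs (copy t i j) s (10 * size (get s i) + 2) (Go (upd s j (get s i ++ get s j))).
Proof.
case/and3P=> ti tj ij /and3P[ts is_ js] t0.
have H1 : runs (transfer i t) s (5 * size (get s i) + 1)
    (Go (upd (upd s i [::]) t (rev (get s i)))).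
  by have := @runs_transfer i t s; rewrite t0 cats0 eq_sym; apply.
have := @runs_dup t i j (upd (upd s i [::]) t (rev (get s i))).
rewrite ti tj ij !size_upd ?size_upd // ts is_ js => /(_ isT isT).
rewrite get_upd_same revK size_rev get_upd_other 1?eq_sym // get_upd_same cats0.
rewrite !get_upd_other 1?eq_sym // 1?eq_sym // => H2.
have E : upd (upd (upd (upd (upd s i [::]) t (rev (get s i))) t [::]) i (get s i)) j
    (get s i ++ get s j) = upd s j (get s i ++ get s j).
  by rewrite updK (updC _ _ _ ti) updK upd_get // -t0 upd_get.
rewrite E in H2; apply: runs_le (runs_seqD H1 H2) _; lia.
Qed.

End Macros.

(** * Existential positive definitions as finite disjunctions *)

Notation constr := (nat * seq nat)%type.

Section Onth.
Variable T : Type.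
Implicit Types s t u : seq T.

(** [sat_inst] evaluates a constraint by [pmap (onth s)], which silently drops variables out of
    range. The bound on the variables, supplied by well-formedness, turns it into plain indexing
    here and below. *)
Lemma size_pmap_onth s xs : all (fun x => x < size s) xs -> size (pmap (onth s) xs) = size xs.
Proof.
elim: xs => //= x xs IH /andP[xs_s /IH <-].
by have := onthTE s x; rewrite xs_s; case: (onth s x).
Qed.

Lemma onth_pmap_onth s xs i : all (fun x => x < size s) xs -> i < size xs ->
  onth (pmap (onth s) xs) i = onth s (nth 0 xs i).
Proof.
elim: xs i => //= x xs IH i /andP[xs_s A].
have := onthTE s x; rewrite xs_s; case E: (onth s x) => [a|] // _.
by case: i => [|i] /=; [rewrite E | rewrite ltnS => /(IH _ A)].
Qed.

Lemma pmap_pmap_onth s xs ys : all (fun x => x < size s) xs ->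
  all (fun i => i < size xs) ys ->
  pmap (onth (pmap (onth s) xs)) ys = pmap (onth s) (map (nth 0 xs) ys).
Proof.
by move=> A; elim: ys => //= y ys IH /andP[yl /IH ->]; rewrite onth_pmap_onth.
Qed.

Lemma pmap_onth_catl s u xs : all (fun x => x < size s) xs ->
  pmap (onth (s ++ u)) xs = pmap (onth s) xs.
Proof. by elim: xs => //= x xs IH /andP[xl /IH ->]; rewrite onth_cat xl. Qed.

Lemma pmap_onth_iota s : pmap (onth s) (iota 0 (size s)) = s.
Proof.
apply: eq_from_onth => i; case: (ltnP i (size s)) => il.
  by rewrite onth_pmap_onth ?size_iota ?nth_iota //; apply/allP => x; rewrite mem_iota.
rewrite !onth_default // size_pmap_onth ?size_iota //.
by apply/allP => x; rewrite mem_iota.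
Qed.

Lemma pmap_onth_map x0 s xs : all (fun x => x < size s) xs ->
  pmap (onth s) xs = map (nth x0 s) xs.
Proof.
elim: xs => //= x xs IH /andP[xl /IH ->].
have := onthTE s x; rewrite xl; case E: (onth s x) => [a|] // _.
by rewrite (onth_nth x0 _ _ _ E).
Qed.

Lemma pmap_onth_mkseq (v : nat -> T) n xs : all (fun x => x < n) xs ->
  pmap (onth (mkseq v n)) xs = map v xs.
Proof.
elim: xs => //= x xs IH /andP[xl /IH ->].
by rewrite /mkseq onth_map onthE (nth_map 0) ?size_iota // nth_iota.
Qed.

End Onth.

Definition csat T (S : structure T) (s : seq T) (c : constr) := rel S c.1 (pmap (onth s) c.2).
Definition esat T (s : seq T) (e : nat * nat) := onth s e.1 = onth s e.2.
Definition cwf T (S : structure T) n (c : constr) :=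
  [&& c.1 < nrel S, size c.2 == ar S c.1 & all (fun x => x < n) c.2].
Definition ewf n (e : nat * nat) := (e.1 < n) && (e.2 < n).
Definition sys_sat T (S : structure T) s (es : seq (nat * nat)) (cs : seq constr) :=
  (forall e, e \in es -> esat s e) /\ (forall c, c \in cs -> csat S s c).

(* A primitive positive formula over the variables [0 .. n + ne - 1], the last
   [ne] of which are existentially quantified. *)
Record disj := Disj { ne : nat; eqs : seq (nat * nat); ats : seq constr }.

Definition tuple_of_disj d := (ne d, eqs d, ats d).
Definition disj_of_tuple t := Disj t.1.1 t.1.2 t.2.
Lemma tuple_of_disjK : cancel tuple_of_disj disj_of_tuple. Proof. by case. Qed.
HB.instance Definition _ := Equality.copy disj (can_type tuple_of_disjK).

Definition dwf T (A : structure T) n (d : disj) :=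
  all (ewf (n + ne d)) (eqs d) && all (cwf A (n + ne d)) (ats d).
Definition dholds T (A : structure T) (d : disj) (t : seq T) :=
  exists u, size u = ne d /\ sys_sat A (t ++ u) (eqs d) (ats d).
Definition defines T (A : structure T) n (ds : seq disj) (R : seq T -> Prop) :=
  all (dwf A n) ds /\
  (forall t, size t = n -> (R t <-> exists d, d \in ds /\ dholds A d t)).

(** * Disjunctive prenex form of existential positive formulas *)

Section DNF.
Variables (T : Type) (A : structure T).

Fixpoint dnf (r : nat -> nat) (fr : nat) (p : epf) :
    seq (nat * (seq (nat * nat) * seq constr)) :=
  match p with
  | EAtom i xs => if (i < nrel A) && (size xs == ar A i)
      then [:: (fr, ([::], [:: (i, map r xs)]))] else [::]
  | EEq x y => [:: (fr, ([:: (r x, r y)], [::]))]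
  | EAnd p q => [seq (d2.1, (d1.2.1 ++ d2.2.1, d1.2.2 ++ d2.2.2))
                | d1 <- dnf r fr p, d2 <- dnf r d1.1 q]
  | EOr p q => dnf r fr p ++ dnf r fr q
  | EEx x p => dnf (fun y => if y == x then fr else r y) fr.+1 p
  end.

Definition dsatv (v : nat -> T) (d : nat * (seq (nat * nat) * seq constr)) :=
  (forall e, e \in d.2.1 -> v e.1 = v e.2) /\
  (forall c, c \in d.2.2 -> rel A c.1 (map v c.2)).

Lemma holds_ext p v v' : (forall y, y \in fv p -> v y = v' y) -> holds A v p -> holds A v' p.
Proof.
elim: p v v' => [i xs|x y|p IHp q IHq|p IHp q IHq|x p IH] v v' /= E.
- by case=> ? [? H]; do 2 split=> //; have <- : map v xs = map v' xs by apply/eq_in_map.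
- by rewrite !E ?inE ?eqxx ?orbT.
- by case=> /(IHp _ v') H1 /(IHq _ v') H2; split; [apply: H1 | apply: H2] => y Hy;
    apply: E; rewrite mem_cat Hy ?orbT.
- by case=> [/(IHp _ v') H|/(IHq _ v') H]; [left | right]; apply: H => y Hy;
    apply: E; rewrite mem_cat Hy ?orbT.
- case=> a H; exists a; apply: IH H => y Hy; case: eqP => // /eqP nyx.
  by apply: E; rewrite mem_filter nyx.
Qed.

Lemma dnf_wf p r fr d : (forall y, y \in fv p -> r y < fr) -> d \in dnf r fr p ->
  [/\ fr <= d.1, all (ewf d.1) d.2.1 & all (cwf A d.1) d.2.2].
Proof.
have ewfW m n e : m <= n -> ewf m e -> ewf n e.
  by move=> mn /andP[? ?]; rewrite /ewf !(leq_trans _ mn).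
have cwfW m n c : m <= n -> cwf A m c -> cwf A n c.
  rewrite /cwf => mn /and3P[-> -> /allP H]; apply/allP => x /H; move/leq_trans; exact.
elim: p r fr d => [i xs|x y|p IHp q IHq|p IHp q IHq|x p IH] r fr d /= E.
- case: ifP => // /andP[il /eqP sx]; rewrite inE => /eqP -> /=; split=> //.
  rewrite andbT /cwf /= il size_map sx eqxx all_map; apply/allP => y /= /E; exact.
- by rewrite inE => /eqP -> /=; rewrite /ewf /= !E ?inE ?eqxx ?orbT.
- case/allpairsPdep => d1 [d2 [/IHp H1 /IHq H2 ->]] /=.
  have [|l1 e1 c1] := H1; first by move=> y Hy; apply: E; rewrite mem_cat Hy.
  have [|l2 e2 c2] := H2.
    by move=> y Hy; apply: leq_trans l1; apply: E; rewrite mem_cat Hy orbT.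
  rewrite !all_cat e2 c2 !andbT (leq_trans l1 l2); split=> //.
    by apply: sub_all e1 => e; apply: ewfW.
  by apply: sub_all c1 => e; apply: cwfW.
- by rewrite mem_cat => /orP[/IHp|/IHq]; apply=> y Hy; apply: E; rewrite mem_cat Hy ?orbT.
- move=> /IH [|l e c]; last by split=> //; apply: ltnW.
  by move=> y Hy; case: eqP => // /eqP nyx; rewrite ltnS ltnW // E // mem_filter nyx.
Qed.

Lemma dnf_sound p r fr d v : d \in dnf r fr p -> dsatv v d -> holds A (v \o r) p.
Proof.
elim: p r fr d => [i xs|x y|p IHp q IHq|p IHp q IHq|x p IH] r fr d /=.
- case: ifP => // /andP[il /eqP sx]; rewrite inE => /eqP -> [_ /=] H.
  by do 2 split=> //; have := H _ (mem_head _ _); rewrite /= -map_comp.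
- by rewrite inE => /eqP -> [H _]; have := H _ (mem_head _ _).
- case/allpairsPdep => d1 [d2 [H1 H2 ->]] [/= He Hc].
  split; [apply: IHp H1 _ | apply: IHq H2 _]; split=> [e|c] H;
    [apply: He | apply: Hc | apply: He | apply: Hc]; rewrite mem_cat H ?orbT //.
- by rewrite mem_cat => /orP[/IHp H|/IHq H] /H; [left | right].
- move=> /IH H /H {}H; exists (v fr); apply: holds_ext H => y _ /=.
  by case: eqP.
Qed.

(** Only variables from [fr] on get new values, namely the witnesses of the quantifiers. This clause
    lets the witnesses of the first conjunct survive the treatment of the second. *)
Lemma dnf_complete p r fr v : (forall y, y \in fv p -> r y < fr) -> holds A (v \o r) p ->
  exists2 d, d \in dnf r fr p & exists2 v', (forall y, y < fr -> v' y = v y) & dsatv v' d.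
Proof.
elim: p r fr v => [i xs|x y|p IHp q IHq|p IHp q IHq|x p IH] r fr v /= E.
- move=> [il [/eqP sx H]]; rewrite il sx /=; eexists; first exact: mem_head.
  by exists v => //; split=> // c; rewrite inE => /eqP -> /=; rewrite -map_comp.
- move=> H; eexists; first exact: mem_head.
  by exists v => //; split=> // c; rewrite inE => /eqP ->.
- move=> [Hp Hq].
  have Ep y : y \in fv p -> r y < fr by move=> Hy; apply: E; rewrite mem_cat Hy.
  have Eq y : y \in fv q -> r y < fr by move=> Hy; apply: E; rewrite mem_cat Hy orbT.
  have [d1 D1 [v1 V1 [S1 S1']]] := IHp _ _ _ Ep Hp.
  have [l1 /allP e1 /allP c1] := dnf_wf Ep D1.
  have Eq1 y : y \in fv q -> r y < d1.1 by move=> /Eq /leq_trans; apply.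
  have [|d2 D2 [v2 V2 [S2 S2']]] := IHq r d1.1 v1 Eq1.
    by apply: holds_ext Hq => y /Eq Hy /=; rewrite V1.
  exists (d2.1, (d1.2.1 ++ d2.2.1, d1.2.2 ++ d2.2.2)).
    by apply/allpairsPdep; exists d1, d2.
  exists v2; first by move=> y Hy; rewrite V2 ?V1 // (leq_trans Hy l1).
  split=> [e|c] /=; rewrite mem_cat => /orP[H|]; [|exact: S2| |exact: S2'].
    by have /andP[? ?] := e1 _ H; rewrite !V2 // S1.
  have /and3P[_ _ /allP Hc] := c1 _ H.
  have := S1' _ H; have -> // : map v1 c.2 = map v2 c.2.
  by apply/eq_in_map => y /Hc Hy; rewrite V2.
- case=> H; [have [y|d D [v' V S]] := IHp r fr v _ H | have [y|d D [v' V S]] := IHq r fr v _ H];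
    try (by move=> Hy; apply: E; rewrite mem_cat Hy ?orbT);
    by exists d; [rewrite mem_cat D ?orbT | exists v'].
- case=> a H; have [y Hy||d D [v' V S]] := IH (fun y => if y == x then fr else r y) fr.+1
    (fun y => if y == fr then a else v y).
  + by case: eqP => // /eqP nyx; rewrite ltnS ltnW // E // mem_filter nyx.
  + apply: holds_ext H => y Hy /=; case: (eqVneq y x) => [_|nyx]; first by rewrite eqxx.
    by rewrite ifN // neq_ltn E // mem_filter nyx.
  exists d => //; exists v' => // y Hy; rewrite V ?ltnS ?(ltnW Hy) //.
  by rewrite ifN // neq_ltn Hy.
Qed.

Lemma ep_defines n R : 0 < n -> ep_definable A n R -> exists ds, defines A n ds R.
Proof.
move=> n0 [p [/allP pv H]].
have E y : y \in fv p -> id y < n by apply: pv.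
exists [seq Disj (d.1 - n) d.2.1 d.2.2 | d <- dnf id n p]; split.
  apply/allP => _ /mapP[d D ->].
  have [l e c] := dnf_wf E D.
  by rewrite /dwf /= subnKC // e c.
move=> t st; rewrite H //; split.
  case=> v [tE Hp]; have [d D [v' V [Se Sc]]] := dnf_complete E Hp.
  have [l /allP e /allP c] := dnf_wf E D.
  exists (Disj (d.1 - n) d.2.1 d.2.2); split.
    by apply/mapP; exists d.
  have tE' : t ++ mkseq (fun i => v' (n + i)) (d.1 - n) = mkseq v' d.1.
    rewrite -{2}(subnKC l) /mkseq iotaD map_cat add0n tE; congr cat.
    by apply/eq_in_map => y; rewrite mem_iota => /andP[_ Hy]; rewrite V.
    by have := iotaDl n 0 (d.1 - n); rewrite addn0 => ->; rewrite -map_comp.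
  exists (mkseq (fun i => v' (n + i)) (d.1 - n)); rewrite size_mkseq; split=> //=.
  rewrite tE'; split=> [x Hx|x Hx].
    have /andP[x1 x2] := e _ Hx; rewrite /esat /mkseq !onth_map !onthE.
    by rewrite !(nth_map 0) ?size_iota // !nth_iota //= !add0n Se.
  by have /and3P[_ _ Hc] := c _ Hx; rewrite /csat pmap_onth_mkseq //; apply: Sc.
case=> _ [/mapP[d D ->] [u [su [/= Se Sc]]]].
have [l /allP e /allP c] := dnf_wf E D.
have stu : size (t ++ u) = d.1 by rewrite size_cat st su /= subnKC.
(* A total valuation needs a default value, and the first entry of [t] provides it; for length 0 the
   domain might be empty. *)
case: t st Se Sc stu => [|x0 t] st Se Sc stu; first by move: n0; rewrite -st.
exists (nth x0 ((x0 :: t) ++ u)); split.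
  apply: (@eq_from_nth _ x0); first by rewrite size_map size_iota -st.
  move=> i il; have il' := il; rewrite st in il'.
  by rewrite (nth_map 0) ?size_iota // nth_iota // nth_cat il.
apply: (@dnf_sound p id n d) => //; split=> [x Hx|x Hx].
  have := Se _ Hx; have /andP[x1 x2] := e _ Hx.
  by rewrite /esat => /(congr1 (odflt x0)); rewrite !odflt_onth.
have := Sc _ Hx; have /and3P[_ _ Hc] := c _ Hx.
by rewrite /csat (pmap_onth_map x0) // stu.
Qed.

End DNF.

(** Automorphisms preserve the relation, so it is the union of the orbits of those representatives
    of its arity that lie in it. Which ones do is settled classically: only the existence of the
    finite disjunction matters, as it is built into the machine. *)
Lemma rel_defines (T : countType) (A B : structure T) i : i < nrel B ->
  omega_categorical B ->
  (forall t : seq T, 0 < size t -> ep_definable A (size t) (aut_orbit B t)) ->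
  exists ds, defines A (ar B i) ds (rel B i).
Proof.
move=> iB catB H; case: (posnP (ar B i)) => [a0|apos].
  (* Definability is given for orbits of nonempty tuples, so a nullary relation is written directly
     as truth (one empty disjunct) or falsity (no disjunct). *)
  have nilP (t : seq T) : size t = ar B i -> t = [::] by rewrite a0 => /size0nil.
  case: (classic (rel B i [::])) => Ri; [exists [:: Disj 0 [::] [::]] | exists [::]].
    split=> // t /nilP ->; split=> // _.
    by exists (Disj 0 [::] [::]); split; [exact: mem_head | exists [::]; split].
  by split=> // t /nilP -> //; split=> // -[d []].
have [reps repsP] := catB (ar B i).
suff [ds [dsw dsP]] : exists ds, defines A (ar B i) ds
    (fun t => exists2 r, r \in reps & [/\ size r = ar B i, rel B i r & aut_orbit B r t]).
  exists ds; split=> // t st; rewrite -dsP //; split=> [Rt|[r _ [sr Rr [f [[g [_ [_ fP]]] ->]]]]].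
    have [j jl O] := repsP t st; exists (nth [::] reps j); first exact: mem_nth.
    have sr : size (nth [::] reps j) = ar B i by case: O => f [_ tE]; rewrite -st tE size_map.
    by split=> //; case: O => f [[g [_ [_ fP]]] tE]; apply/(fP _ iB _ sr); rewrite -tE.
  exact/(fP _ iB _ sr).
elim: reps {repsP} => [|r reps [ds [dsw dsP]]].
  by exists [::]; split=> // t _; split=> [[]|[d []]].
case: (classic (size r = ar B i /\ rel B i r)) => [[sr Rr]|nr]; last first.
  exists ds; split=> // t st; rewrite -dsP //; split=> -[r' r'in rP]; exists r' => //.
    move: r'in; rewrite inE => /orP[/eqP e|//]; case: nr.
    by rewrite -e; case: rP.
  by rewrite inE r'in orbT.
have [|ds1 [ds1w ds1P]] := @ep_defines T A (ar B i) (aut_orbit B r) apos.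
  by rewrite -sr; apply: H; rewrite sr.
exists (ds1 ++ ds); split=> [|t st]; first by rewrite all_cat ds1w.
split.
  case=> r'; rewrite inE => /orP[/eqP -> [_ _ /(ds1P _ st) [d [dd dh]]]|r'in rP].
    by exists d; split=> //; rewrite mem_cat dd.
  have /(dsP _ st) [d [dd dh]] : exists2 r, r \in reps &
    [/\ size r = ar B i, rel B i r & aut_orbit B r t] by exists r'.
  by exists d; split=> //; rewrite mem_cat dd orbT.
case=> d [] /[!mem_cat] /orP[dd|dd] dh.
  exists r; first exact: mem_head.
  by split=> //; apply/ds1P => //; exists d.
have /(dsP _ st) [r' r'in rP] : exists d, d \in ds /\ dholds A d t by exists d.
by exists r' => //; rewrite inE r'in orbT.
Qed.

(** * Eliminating alien constraints and equations *)

Section Elim.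
Variables (T : Type) (A B : structure T) (Dj : nat -> seq disj).
Hypothesis DjP : forall i, i < nrel B -> defines A (ar B i) (Dj i) (rel B i).

Notation AB := (sunion A B).
Definition alien (c : constr) := nrel A <= c.1.

(** A digit beyond the list stands for the first disjunct, so that every digit in [0 .. D] is
    meaningful for every nonempty list; [elim] treats the empty list before it gets here. *)
Definition pick_disj i d := nth (head (Disj 0 [::] [::]) (Dj i)) (Dj i) d.
(** [env] lists the instance variables that stand for the variables of the formula: the arguments of
    the constraint, then the fresh ones. *)
Definition inst_var env x : nat := nth 0 env x.
Definition inst_eqs env d : seq (nat * nat) :=
  [seq (inst_var env e.1, inst_var env e.2) | e <- eqs d].
Definition inst_ats env d : seq constr := [seq (a.1, map (inst_var env) a.2) | a <- ats d].

(* The choices [ch] select one disjunct for each alien constraint. The result is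
   [None] if there are too few choices or if an alien relation is empty. *)
Fixpoint elim nv (cs : seq constr) (ch : seq nat) :
    option (nat * (seq (nat * nat) * seq constr)) :=
  match cs with
  | [::] => Some (nv, ([::], [::]))
  | c :: cs' =>
    if c.1 < nrel A then omap (fun r => (r.1, (r.2.1, c :: r.2.2))) (elim nv cs' ch)
    else match ch with
    | [::] => None
    | d :: ch' =>
      if Dj (c.1 - nrel A) is [::] then None else
      let D := pick_disj (c.1 - nrel A) d in
      let env := c.2 ++ iota nv (ne D) in
      omap (fun r => (r.1, (inst_eqs env D ++ r.2.1, inst_ats env D ++ r.2.2)))
        (elim (nv + ne D) cs' ch')
    end
  end.

Lemma pick_disj_mem i d : Dj i <> [::] -> pick_disj i d \in Dj i.
Proof.
rewrite /pick_disj; case: (Dj i) => // a l _; case: (ltnP d (size (a :: l))) => dl.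
  exact: mem_nth.
by rewrite nth_default //= mem_head.
Qed.

Lemma csat_AB_A s c : c.1 < nrel A -> csat AB s c <-> csat A s c.
Proof. by rewrite /csat /= => ->. Qed.

Lemma csat_AB_B s c : nrel A <= c.1 ->
  csat AB s c <-> rel B (c.1 - nrel A) (pmap (onth s) c.2).
Proof. by move=> H; rewrite /csat /= ltnNge H. Qed.

Lemma cwfW (S : structure T) m n c : m <= n -> cwf S m c -> cwf S n c.
Proof.
rewrite /cwf => mn /and3P[-> -> /allP H]; apply/allP => x /H.
move/leq_trans; exact.
Qed.

Lemma ewfW m n e : m <= n -> ewf m e -> ewf n e.
Proof. by move=> mn /andP[? ?]; rewrite /ewf !(leq_trans _ mn). Qed.

Lemma cwf_alien n c : cwf AB n c -> nrel A <= c.1 ->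
  [/\ c.1 - nrel A < nrel B, size c.2 = ar B (c.1 - nrel A) & all (fun x => x < n) c.2].
Proof.
rewrite /cwf /= => /and3P[c1 c2 ->] H; rewrite ltnNge H /= in c2.
by split=> //; [lia | exact/eqP].
Qed.

Lemma env_wf nv c k n : all (fun x => x < nv) c -> nv + k <= n ->
  all (fun x => x < n) (c ++ iota nv k).
Proof.
move=> /allP H l; apply/allP => x; rewrite mem_cat mem_iota => /orP[/H|]; lia.
Qed.

Lemma inst_var_lt env x n : all (fun y => y < n) env -> x < size env -> inst_var env x < n.
Proof. by move=> /allP H l; apply: H; apply: mem_nth. Qed.

Lemma inst_sat s env d : all (fun x => x < size s) env ->
  all (ewf (size env)) (eqs d) -> all (cwf A (size env)) (ats d) ->
  sys_sat A s (inst_eqs env d) (inst_ats env d) <->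
  sys_sat A (pmap (onth s) env) (eqs d) (ats d).
Proof.
move=> El /allP ew /allP cw; split=> -[H1 H2]; split=> x.
- move=> xd; have /andP[x1 x2] := ew _ xd.
  have := H1 _ (map_f (fun e => (inst_var env e.1, inst_var env e.2)) xd).
  by rewrite /esat /= !onth_pmap_onth.
- move=> xd; have /and3P[_ _ x2] := cw _ xd.
  have := H2 _ (map_f (fun a => (a.1, map (inst_var env) a.2)) xd).
  by rewrite /csat /= pmap_pmap_onth.
- case/mapP => y yd ->; have /andP[x1 x2] := ew _ yd.
  by have := H1 _ yd; rewrite /esat /= !onth_pmap_onth.
- case/mapP => y yd ->; have /and3P[_ _ x2] := cw _ yd.
  by have := H2 _ yd; rewrite /csat /= pmap_pmap_onth.
Qed.

Lemma elim_wf nv cs ch nv' es cs' : all (cwf AB nv) cs ->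
  elim nv cs ch = Some (nv', (es, cs')) ->
  [/\ nv <= nv', all (ewf nv') es & all (cwf A nv') cs'].
Proof.
elim: cs nv ch nv' es cs' => [|c cs IH] nv ch nv' es cs' /=.
  by move=> _ [<- <- <-].
case/andP=> cw csw; case: ltnP => cA.
  case E : (elim _ _ _) => [[n [e k]]|] //= [<- <- <-].
  have [l ew kw] := IH _ _ _ _ _ csw E; split=> //; apply/andP; split=> //.
  by apply: (cwfW l); move: cw; rewrite /cwf /= cA; case/and3P => _ -> ->.
case: ch => // d ch; case DE : (Dj _) => [//|d0 ds].
set D := pick_disj _ _.
case E : (elim _ _ _) => [[n [e k]]|] //= [<- <- <-].
have [|l ew kw] := IH _ _ _ _ _ _ E.
  by apply: sub_all csw => x; apply: cwfW; apply: leq_addr.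
have [cB sc cl] := cwf_alien cw cA.
have /andP[eD aD] : dwf A (ar B (c.1 - nrel A)) D.
  by have [/allP -> //] := DjP cB; apply: pick_disj_mem; rewrite DE.
rewrite -sc in eD aD.
have envw := env_wf cl l.
have se : size (c.2 ++ iota nv (ne D)) = size c.2 + ne D by rewrite size_cat size_iota.
split; first by lia.
  rewrite all_cat ew andbT; apply/allP => _ /mapP[x /(allP eD) /andP[x1 x2] ->].
  by rewrite /ewf !inst_var_lt ?se.
rewrite all_cat kw andbT; apply/allP => _ /mapP[x /(allP aD) /and3P[x1 x2 x3] ->].
rewrite /cwf /= x1 size_map x2 /= all_map; apply/allP => y /(allP x3) Hy.
by apply: inst_var_lt; rewrite ?se.
Qed.

Lemma iota_onth (s u : seq T) : pmap (onth (s ++ u)) (iota (size s) (size u)) = u.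
Proof.
rewrite -[RHS]pmap_onth_iota -[X in iota X _]addn0 iotaDl.
by elim: (iota _ _) => //= x l ->; rewrite onth_cat ltnNge leq_addr /= addKn.
Qed.

Lemma elim_sound nv cs ch nv' es cs' s : all (cwf AB nv) cs ->
  elim nv cs ch = Some (nv', (es, cs')) -> size s = nv' -> sys_sat A s es cs' ->
  forall c, c \in cs -> csat AB s c.
Proof.
elim: cs nv ch nv' es cs' => [|c cs IH] nv ch nv' es cs' //=.
case/andP=> cw csw; case: ltnP => cA.
  case E : (elim _ _ _) => [[n [e k]]|] //= [<- <- <-] ss [S1 S2] c'.
  rewrite inE => /orP[/eqP ->|]; first by apply/csat_AB_A => //; apply/S2/mem_head.
  apply: (IH _ _ _ _ _ csw E) => //; split=> // x xk; apply: S2.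
  by rewrite inE xk orbT.
case: ch => // d ch; case DE : (Dj _) => [//|d0 ds].
set D := pick_disj _ _.
case E : (elim _ _ _) => [[n [e k]]|] //= [<- <- <-] ss [S1 S2] c'.
have csw' : all (cwf AB (nv + ne D)) cs.
  by apply: sub_all csw => x; apply: cwfW; apply: leq_addr.
have [l ew kw] := elim_wf csw' E.
rewrite inE => /orP[/eqP ->|]; last first.
  by apply: (IH _ _ _ _ _ csw' E) => //; split=> x xk; [apply: S1 | apply: S2];
    rewrite mem_cat xk orbT.
have [cB sc cl] := cwf_alien cw cA.
have [/allP dw dd] := DjP cB.
have DD : D \in Dj (c.1 - nrel A) by apply: pick_disj_mem; rewrite DE.
have /andP[eD aD] := dw _ DD.
have envw := env_wf cl l.
have se : size (c.2 ++ iota nv (ne D)) = size c.2 + ne D by rewrite size_cat size_iota.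
have cls : all (fun x => x < size s) c.2.
  by rewrite ss; apply: sub_all cl => x /leq_trans; apply; lia.
apply/csat_AB_B => //; apply/dd; first by rewrite size_pmap_onth.
exists D; split=> //; exists (pmap (onth s) (iota nv (ne D))); split.
  rewrite size_pmap_onth ?size_iota //; apply/allP => x; rewrite mem_iota ss; lia.
rewrite -pmap_cat; apply/inst_sat; rewrite ?se ?sc ?ss //.
by split=> x xk; [apply: S1 | apply: S2]; rewrite mem_cat xk.
Qed.

(** A solution singles out, for each alien constraint, a disjunct that it satisfies, and is
    prolonged by the witnesses. The list has length exactly [k], padded with zeros, because lists of
    that length are the ones enumerated. *)
Lemma elim_complete Dm nv cs k s : (forall i, i < nrel B -> size (Dj i) <= Dm) ->
  all (cwf AB nv) cs -> size s = nv -> (forall c, c \in cs -> csat AB s c) ->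
  count alien cs <= k ->
  exists ch nv' es cs' u, [/\ size ch = k, all (fun d => d <= Dm) ch,
    elim nv cs ch = Some (nv', (es, cs')), size (s ++ u) = nv' & sys_sat A (s ++ u) es cs'].
Proof.
move=> DmP; elim: cs nv k s => [|c cs IH] nv k s /=.
  move=> _ ss _ _; exists (nseq k 0), nv, [::], [::], [::]; rewrite size_nseq cats0.
  by split=> //; apply/allP => x /nseqP[->].
case/andP=> cw csw ss S0.
have Sc := S0 _ (mem_head _ _).
have Scs c' : c' \in cs -> csat AB s c' by move=> H; apply: S0; rewrite inE H orbT.
rewrite /alien; case: ltnP => cA /=.
  move=> /(IH _ _ _ csw ss Scs) [ch [nv' [es [cs' [u [sch chm E su [S1 S2]]]]]]].
  exists ch, nv', es, (c :: cs'), u; rewrite E; split=> //; split=> // c'.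
  rewrite inE => /orP[/eqP ->|]; last exact: S2.
  rewrite /csat pmap_onth_catl; first exact/csat_AB_A.
  by rewrite ss; case/and3P: cw.
have [cB sc cl] := cwf_alien cw cA.
case: k => [//|k]; rewrite add1n ltnS => ck.
move/csat_AB_B: Sc => /(_ cA); have [/allP dw dd] := DjP cB.
have cls : all (fun x => x < size s) c.2 by rewrite ss.
case/dd; first by rewrite size_pmap_onth.
move=> D [DD [u0 [su0 SD]]].
have [| | |ch [nv' [es [cs' [u [sch chm E su [S1 S2]]]]]]] := IH (nv + ne D) k (s ++ u0) _ _ _ ck.
- by apply: sub_all csw => x; apply: cwfW; apply: leq_addr.
- by rewrite size_cat ss su0.
- move=> c' c'cs; rewrite /csat pmap_onth_catl; first exact: Scs.
  by rewrite ss; case/and3P: (allP csw _ c'cs).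
set i := c.1 - nrel A in DD dw cB *.
have iD : index D (Dj i) < size (Dj i) by rewrite index_mem.
have pD : pick_disj i (index D (Dj i)) = D by rewrite /pick_disj nth_index.
exists (index D (Dj i) :: ch), nv', (inst_eqs (c.2 ++ iota nv (ne D)) D ++ es),
  (inst_ats (c.2 ++ iota nv (ne D)) D ++ cs'), (u0 ++ u).
have DN : Dj i <> [::] by move=> DN; rewrite DN in DD.
split=> /=; rewrite ?sch //.
- by rewrite chm andbT; apply: ltnW; apply: leq_trans iD (DmP _ cB).
- by case DE : (Dj i) DN => [//|d0 ds] _; rewrite -DE pD E.
- by rewrite catA.
have /andP[eD aD] := dw _ DD.
have se : size (c.2 ++ iota nv (ne D)) = size c.2 + ne D by rewrite size_cat size_iota.
have [I1 I2] : sys_sat A (s ++ u0 ++ u) (inst_eqs (c.2 ++ iota nv (ne D)) D)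
    (inst_ats (c.2 ++ iota nv (ne D)) D).
  apply/inst_sat; rewrite ?se ?sc //.
    by apply: (env_wf cl); rewrite !size_cat ss su0 addnA leq_addr.
  rewrite catA pmap_onth_catl; last by apply: (env_wf cl); rewrite size_cat ss su0.
  by rewrite pmap_cat pmap_onth_catl // -ss -su0 iota_onth.
rewrite catA in I1 I2 *.
by split=> x; rewrite mem_cat => /orP[]; auto.
Qed.

Lemma elim_count nv cs ch r : elim nv cs ch = Some r -> count alien cs <= size ch.
Proof.
elim: cs nv ch r => //= c cs IH nv ch r; rewrite {1}/alien; case: ltnP => cA /=.
  by case E : (elim _ _ _) => [r'|] //= _; apply: IH E.
case: ch => // d ch; case: (Dj _) => // ? ?.
by case E : (elim _ _ _) => [r'|] //= _; rewrite add1n ltnS; apply: IH E.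
Qed.

(** Neither cause of failure mentions the values of the digits; hence one failing choice rules out
    all choices of the same length. *)
Lemma elim_none nv cs ch : elim nv cs ch = None -> size ch < count alien cs \/
  exists c, [/\ c \in cs, alien c & Dj (c.1 - nrel A) = [::]].
Proof.
elim: cs nv ch => [|c cs IH] nv ch //=.
have IH' nv' ch' : elim nv' cs ch' = None -> size ch' < count alien cs \/
    exists c0, [/\ c0 \in c :: cs, alien c0 & Dj (c0.1 - nrel A) = [::]].
  case/IH => [|[c0 [c0cs cA D0]]]; first by left.
  by right; exists c0; rewrite inE c0cs orbT.
rewrite {1}/alien; case: ltnP => cA /=.
  by case E : (elim _ _ _) => [//|] _; apply: IH' E.
case: ch => [|d ch]; first by left.
case DE : (Dj _) => [|d0 ds]; first by right; exists c; rewrite mem_head.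
case E : (elim _ _ _) => [//|] _; case: (IH' _ _ E) => [l|]; last by right.
by left; rewrite add1n ltnS.
Qed.

Lemma elim_none_unsat nv cs ch s : all (cwf AB nv) cs -> elim nv cs ch = None ->
  count alien cs <= size ch -> size s = nv -> ~ (forall c, c \in cs -> csat AB s c).
Proof.
move=> csw /elim_none[|[c [ccs cA D0]]]; first by lia.
move=> _ ss S0; have [cB sc cl] := cwf_alien (allP csw _ ccs) cA.
have /(csat_AB_B s cA) := S0 _ ccs.
have [_ dd] := DjP cB; case/dd; first by rewrite size_pmap_onth // ss.
by rewrite D0 => d [].
Qed.

End Elim.

(** * Solving equations by identification of variables *)

Definition sub_var (a b x : nat) := if x == a then b else x.
Definition sub_eq a b (e : nat * nat) := (sub_var a b e.1, sub_var a b e.2).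
Definition sub_constr a b (c : constr) : constr := (c.1, map (sub_var a b) c.2).

(* [n] is fuel: it should be the number of equations. *)
Fixpoint solve n (es : seq (nat * nat)) (cs : seq constr) : seq constr :=
  match n, es with
  | n.+1, e :: es' =>
    solve n (map (sub_eq e.1 e.2) es') (map (sub_constr e.1 e.2) cs)
  | _, _ => cs
  end.

Lemma sub_var_lt n a b x : b < n -> x < n -> sub_var a b x < n.
Proof. by rewrite /sub_var; case: eqP. Qed.

Section Solve.
Variables (T : Type) (A : structure T).

Lemma solve_wf n nv es cs : all (ewf nv) es -> all (cwf A nv) cs ->
  all (cwf A nv) (solve n es cs).
Proof.
elim: n es cs => [|n IH] [|e es] cs //= /andP[/andP[e1 e2] /allP esw] /allP csw.
apply: IH; apply/allP => _ /mapP[x xs ->].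
  by have /andP[x1 x2] := esw _ xs; rewrite /ewf !sub_var_lt.
have /and3P[x1 x2 /allP x3] := csw _ xs; rewrite /cwf /= x1 size_map x2 /= all_map.
by apply/allP => y /x3 Hy; apply: sub_var_lt.
Qed.

Lemma pmap_onth_sub (s s' : seq T) a b xs :
  (forall x, x \in xs -> onth s (sub_var a b x) = onth s' x) ->
  pmap (onth s) (map (sub_var a b) xs) = pmap (onth s') xs.
Proof.
elim: xs => //= x xs IH H; rewrite H ?mem_head // IH // => y Hy.
by apply: H; rewrite inE Hy orbT.
Qed.

(** A solution of the system also solves the reduced one as it stands. Conversely, the value of
    [e.1] is overwritten by that of [e.2], which the reduced constraints cannot see. The number of
    variables is kept throughout. *)
Lemma solve_sat nv es cs n : n = size es -> all (ewf nv) es -> all (cwf A nv) cs ->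
  (exists2 s, size s = nv & sys_sat A s es cs) <->
  (exists2 s, size s = nv & forall c, c \in solve n es cs -> csat A s c).
Proof.
elim: n es cs => [|n IH] [|e es] cs //=.
  by move=> *; split=> -[s ss H]; exists s => //; case: H.
move=> [sn] esw csw; have /andP[/andP[e1 e2] esw'] := esw.
have esw2 : all (ewf nv) (map (sub_eq e.1 e.2) es).
  by apply/allP => _ /mapP[x /(allP esw') /andP[x1 x2] ->]; rewrite /ewf !sub_var_lt.
have csw2 : all (cwf A nv) (map (sub_constr e.1 e.2) cs).
  apply/allP => _ /mapP[x /(allP csw) /and3P[x1 x2 /allP x3] ->].
  by rewrite /cwf /= x1 size_map x2 all_map; apply/allP => y /x3 Hy; apply: sub_var_lt.
rewrite -IH ?size_map //.
split=> -[s ss [S1 S2]].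
  have E x : onth s (sub_var e.1 e.2 x) = onth s x.
    by rewrite /sub_var; case: eqP => // ->; rewrite (S1 _ (mem_head _ _)).
  exists s => //; split=> _ /mapP[x xs ->].
    by rewrite /esat /= !E; apply: S1; rewrite inE xs orbT.
  by rewrite /csat /= (pmap_onth_sub (s' := s)); [exact: (S2 _ xs) | move=> y _; exact: E].
(* [nth] and [set_nth] need a default element; as [e.1 < nv], the assignment is not empty and
   supplies one. *)
have x0 : T by case: s ss {S1 S2} => [sn0|x ? _]; [move: e1; rewrite -sn0 | exact: x].
pose s' := set_nth x0 s e.1 (nth x0 s e.2).
have ss' : size s' = nv by rewrite size_set_nth ss; apply/maxn_idPr.
have E x : x < nv -> onth s (sub_var e.1 e.2 x) = onth s' x.
  move=> xn; rewrite !onthE !(nth_map x0) ?ss ?ss' ?sub_var_lt //.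
  by rewrite nth_set_nth /= /sub_var; case: eqP.
exists s' => //; split=> x.
  rewrite inE => /orP[/eqP ->|xes].
    rewrite /esat -!E // /sub_var eqxx; by case: eqP.
  have /andP[x1 x2] := allP esw' _ xes.
  by have := S1 _ (map_f (sub_eq e.1 e.2) xes); rewrite /esat /= !E.
move=> xcs; have /and3P[_ _ /allP xw] := allP csw _ xcs.
have := S2 _ (map_f (sub_constr e.1 e.2) xcs).
by rewrite /csat /= (pmap_onth_sub (s' := s')) // => y /xw /E.
Qed.

Lemma size_solve n es cs : size (solve n es cs) = size cs.
Proof. by elim: n es cs => [|n IH] [|e es] cs //=; rewrite IH size_map. Qed.

End Solve.

(** * Tokens and parsing *)

Arguments enc_nat : simpl never.

Section Decode.
Implicit Types (w r : seq bool).

Fixpoint pnum w : option (nat * seq bool) :=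
  match w with
  | [::] => None
  | false :: r => Some (0, r)
  | true :: r => omap (fun p => (p.1.+1, p.2)) (pnum r)
  end.

Lemma pnumP w : match pnum w with
  | Some (x, r) => w = nseq x true ++ false :: r
  | None => w = nseq (size w) true
  end.
Proof. by elim: w => //= -[] w //; case: (pnum w) => [[x r]|] //= {1}->. Qed.

Lemma pnum_enc x r : pnum (enc_nat x ++ r) = Some (x, r).
Proof. by elim: x => //= x; rewrite /enc_nat /= => ->. Qed.

Lemma pnum_some w x r : pnum w = Some (x, r) -> w = enc_nat x ++ r.
Proof. by have := pnumP w; case: pnum => // -[y r'] -> [-> ->]; rewrite /enc_nat -catA. Qed.

Definition pvar nv w := if pnum w is Some (x, r) then if x < nv then Some (x, r) else None
  else None.

Fixpoint pvars nv n w : option (seq nat * seq bool) :=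
  if n is n'.+1 then
    if pvar nv w is Some (x, r) then omap (fun p => (x :: p.1, p.2)) (pvars nv n' r) else None
  else Some ([::], w).

Variables (NR : nat) (arity : nat -> nat).

Definition pcon nv w : option (constr * seq bool) :=
  if pnum w is Some (i, r) then
    if i < NR then
      if pnum r is Some (a, r') then
        if a == arity i then omap (fun p => ((i, p.1), p.2)) (pvars nv (arity i) r') else None
      else None
    else None
  else None.

Fixpoint pcons nv m w : option (seq constr * seq bool) :=
  if m is m'.+1 then
    if pcon nv w is Some (c, r) then omap (fun p => (c :: p.1, p.2)) (pcons nv m' r) else None
  else Some ([::], w).

Definition parse w : option instance :=
  if pnum w is Some (nv, r) then
    if pnum r is Some (m, r') then
      if pcons nv m r' is Some (cs, [::]) then Some (Inst nv cs) else None
    else None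
  else None.

Definition con_ok nv (c : constr) :=
  [&& c.1 < NR, size c.2 == arity c.1 & all (fun x => x < nv) c.2].
Definition enc_con (c : constr) := enc_nats (c.1 :: size c.2 :: c.2).

Lemma pvars_some nv n w xs r : pvars nv n w = Some (xs, r) ->
  [/\ w = enc_nats xs ++ r, size xs = n & all (fun x => x < nv) xs].
Proof.
elim: n w xs r => [|n IH] w xs r /=; first by case=> <- <-.
rewrite /pvar; case E : (pnum w) => [[x w']|] //; case: ltnP => // xnv.
case E' : (pvars nv n w') => [[xs' r']|] //= [<- <-].
have [E1 <- A] := IH _ _ _ E'; rewrite (pnum_some E) E1 /enc_nats /= catA xnv.
by split.
Qed.

Lemma pvars_enc nv n xs r : size xs = n -> all (fun x => x < nv) xs ->
  pvars nv n (enc_nats xs ++ r) = Some (xs, r).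
Proof.
elim: n xs => [|n IH] [|x xs] //= [sxs] /andP[xn A].
by rewrite /pvar /enc_nats /= -(catA (enc_nat x)) pnum_enc xn IH.
Qed.

Lemma pcon_some nv w c r : pcon nv w = Some (c, r) -> w = enc_con c ++ r /\ con_ok nv c.
Proof.
rewrite /pcon; case E : (pnum w) => [[i w1]|] //; case: ltnP => // iR.
case E1 : (pnum w1) => [[a w2]|] //; case: eqP => // ea.
case E2 : (pvars _ _ _) => [[xs r']|] //= [<- <-]; have [E3 sx A] := pvars_some E2.
rewrite (pnum_some E) (pnum_some E1) E3 /enc_con /enc_nats /= ea sx -!catA.
by rewrite /con_ok /= iR sx eqxx.
Qed.

Lemma pcon_enc nv c r : con_ok nv c -> pcon nv (enc_con c ++ r) = Some (c, r).
Proof.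
case/and3P=> cR /eqP sc A; rewrite /pcon /enc_con /enc_nats /=.
rewrite -(catA (enc_nat c.1)) -(catA (enc_nat (size c.2))) pnum_enc /= cR pnum_enc /=.
by rewrite -sc eqxx pvars_enc //; case: c {cR sc A}.
Qed.

Lemma enc_inst_con I : enc_inst I =
  enc_nat (nv I) ++ enc_nat (size (constrs I)) ++ flatten (map enc_con (constrs I)).
Proof.
rewrite /enc_inst /enc_nats /=; do 2 congr (_ ++ _).
by elim: (constrs I) => //= c cs IH; rewrite map_cat flatten_cat IH /enc_con /enc_nats /= -!catA.
Qed.

Lemma pcons_some nv m w cs r : pcons nv m w = Some (cs, r) ->
  [/\ w = flatten (map enc_con cs) ++ r, size cs = m & all (con_ok nv) cs].
Proof.
elim: m w cs r => [|m IH] w cs r /=; first by case=> <- <-.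
case E : (pcon nv w) => [[c w']|] //; case E1 : (pcons _ _ _) => [[cs' r']|] //= [<- <-].
have [-> c_ok] := pcon_some E; have [-> <- A] := IH _ _ _ E1.
by rewrite /= catA c_ok.
Qed.

Lemma pcons_enc nv cs r : all (con_ok nv) cs ->
  pcons nv (size cs) (flatten (map enc_con cs) ++ r) = Some (cs, r).
Proof. by elim: cs => //= c cs IH /andP[cok /IH E]; rewrite -catA pcon_enc // E. Qed.

Lemma parse_some w I : parse w = Some I -> w = enc_inst I /\ all (con_ok (nv I)) (constrs I).
Proof.
rewrite /parse; case E : (pnum w) => [[n w1]|] //; case E1 : (pnum w1) => [[m w2]|] //.
case E2 : (pcons _ _ _) => [[cs [|//]]|] // [<-] /=; have [E3 sm A] := pcons_some E2.
by rewrite enc_inst_con (pnum_some E) (pnum_some E1) E3 /= sm cats0.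
Qed.

(** It makes the encoding injective on well-formed instances, so that membership in a language of
    encodings can be tested on the instance at hand. *)
Lemma parse_enc I : all (con_ok (nv I)) (constrs I) -> parse (enc_inst I) = Some I.
Proof.
move=> A; rewrite enc_inst_con /parse !pnum_enc /=.
by have := pcons_enc [::] A; rewrite cats0 => ->; case: I {A}.
Qed.

Lemma size_pvar nv w x r : pvar nv w = Some (x, r) -> size r <= size w.
Proof.
rewrite /pvar; case E : (pnum w) => [[y r']|] //; case: ifP => // _ [_ <-].
by rewrite (pnum_some E) size_cat leq_addl.
Qed.

Lemma size_pcon nv w c r : pcon nv w = Some (c, r) -> size r <= size w.
Proof. by case/pcon_some=> -> _; rewrite size_cat leq_addl. Qed.

End Decode.

(* The stacks hold bits, digits selecting disjuncts, relation symbols, and the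
   states and tape symbols of the machine for CSP(A). They are numbered as follows:
   0 scratch; 1 output and 3 input of the current pass; 2 number of constraints;
   4 number of variables; 5 remaining choices; 6 equations; 7-11 substitution of
   a variable; 12-14 left tape, right tape and state of the machine for CSP(A);
   15 current choices; 16-17 the given instance; from 18 on, the variables of the
   alien constraint that is being replaced. *)
Section Tokens.
Variables (D NR : nat) (M : TM).

Inductive tok := TB of bool | TD of 'I_D.+1 | TS of 'I_NR.+1 | TQ of state M | TA of sym M.

Definition tok_enc (t : tok) : bool + 'I_D.+1 + 'I_NR.+1 + state M + sym M :=
  match t with
  | TB b => inl (inl (inl (inl b))) | TD d => inl (inl (inl (inr d)))
  | TS i => inl (inl (inr i)) | TQ q => inl (inr q) | TA a => inr a
  end.
Definition tok_dec t :=
  match t with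
  | inl (inl (inl (inl b))) => TB b | inl (inl (inl (inr d))) => TD d
  | inl (inl (inr i)) => TS i | inl (inr q) => TQ q | inr a => TA a
  end.
Lemma tok_encK : cancel tok_enc tok_dec. Proof. by case. Qed.
HB.instance Definition _ := Finite.copy tok (can_type tok_encK).

End Tokens.
Arguments TB {D NR M} b.
Arguments TD {D NR M} d.
Arguments TS {D NR M} i.
Arguments TQ {D NR M} q.
Arguments TA {D NR M} a.

Definition digits D NR M (ch : seq nat) : seq (tok D NR M) := map (fun d => TD (inord d)) ch.
Arguments digits {D NR M} ch.

(** * Reading and checking the input on stacks *)

Section Parse.
Variables (D NR : nat) (M : TM) (arity : nat -> nat).
Notation G := (tok D NR M).
Notation prog := (prog G).
Implicit Types (w r : seq bool).

Notation tb := (map (@TB D NR M)).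
Definition un x : seq G := nseq x (TB true).
Definition is_true_bit (x : option G) := if x is Some (TB true) then true else false.

Definition rdnum i j : prog :=
  Seq (While i is_true_bit (Pop i (fun=> Push j (TB true))))
      (Pop i (fun x => if x is Some (TB false) then Skip _ else Halt _ false)).

Lemma runs_unary i j x (l : seq G) s : i != j -> i < size s -> j < size s ->
  get s i = un x ++ l -> is_true_bit (ohead l) = false ->
  runs (While i is_true_bit (Pop i (fun=> Push j (TB true)))) s (4 * x + 1)
    (Go (upd (upd s i l) j (un x ++ get s j))).
Proof.
move=> ij is_ js gi hl; elim: x s is_ js gi => [|x IH] s is_ js /= gi.
  by rewrite -gi upd_get // upd_get //; apply: runs_while_end; rewrite ?gi ?addn1.
set s1 := upd (upd s i (un x ++ l)) j (TB true :: get s j).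
have s1s : size s1 = size s by rewrite !size_upd ?size_upd.
have := IH s1; rewrite s1s {1}/s1 get_upd_other // get_upd_same => /(_ is_ js erefl) H.
have Hb : runs (Pop i (fun=> Push j (TB true))) s 2 (Go s1).
  apply: runs_pop; rewrite gi /=; have := runs_push1 j (TB true) (upd s i (un x ++ l)).
  by rewrite get_upd_other // eq_sym.
have E2 : upd (upd s1 i l) j (un x ++ get s1 j) = upd (upd s i l) j (un x.+1 ++ get s j).
  rewrite /s1 get_upd_same -(updC _ _ _ ij) !updK; congr upd.
  by rewrite -[TB true :: _]cat1s catA -[un x ++ [:: _]]/(un x ++ nseq 1 _) -nseqD addn1.
rewrite E2 in H; apply: runs_le (runs_whileD _ Hb H) _; first by rewrite gi.
by rewrite mulnS; lia.
Qed.

Lemma runs_rdnum i j x (l : seq G) s : i != j -> i < size s -> j < size s ->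
  get s i = un x ++ TB false :: l ->
  runs (rdnum i j) s (4 * x + 3) (Go (upd (upd s i l) j (un x ++ get s j))).
Proof.
move=> ij is_ js gi; have := runs_unary ij is_ js gi erefl => H.
apply: runs_le; first apply: (runs_seqD H (T2 := 2)); last by lia.
apply: runs_pop; rewrite get_upd_other // get_upd_same /=.
by rewrite -(updC _ _ _ ij) updK; apply: runs_skip1.
Qed.

Lemma runs_rdnum_fail i j x s : i != j -> i < size s -> j < size s ->
  get s i = un x -> runs (rdnum i j) s (4 * x + 3) (Stop false).
Proof.
move=> ij is_ js gi; have := @runs_unary i j x [::] s ij is_ js; rewrite cats0.
move=> /(_ gi erefl) H; apply: runs_le; first apply: (runs_seqD H (T2 := 2)); last by lia.
by apply: runs_pop; rewrite get_upd_other // get_upd_same /=; apply: runs_halt.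
Qed.

Lemma tb_nseq x : tb (nseq x true) = un x. Proof. exact: map_nseq. Qed.

Lemma runs_pnum i j w s : i != j -> i < size s -> j < size s -> get s i = tb w ->
  runs (rdnum i j) s (4 * size w + 3)
    (if pnum w is Some (x, r) then Go (upd (upd s i (tb r)) j (un x ++ get s j))
     else Stop false).
Proof.
move=> ij is_ js gi; have := pnumP w; case: pnum => [[x r]|] E.
  apply: (runs_le (@runs_rdnum i j x (tb r) s ij is_ js _)).
    by rewrite gi E map_cat tb_nseq.
  by rewrite E size_cat size_nseq; lia.
by apply: runs_rdnum_fail; rewrite // gi {1}E tb_nseq.
Qed.

(** Relation symbols and arities are bounded by constants, so they are counted in the finite
    control, as the argument of the continuation [k], and not on a stack; numbers from [f] on are
    rejected. *)
Fixpoint rdsym f j (k : nat -> prog) : prog :=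
  if f is f'.+1 then
    Pop 3 (fun x => match x with
      | Some (TB true) => rdsym f' j.+1 k
      | Some (TB false) => k j
      | _ => Halt _ false
      end)
  else Halt _ false.

(** Internal form of a constraint: one token for the symbol, then the variables in unary. The arity
    is dropped, being determined by the symbol, and the token marks where a constraint begins. *)
Definition econ (c : constr) : seq G := TS (inord c.1) :: tb (enc_nats c.2).
Definition ebody (cs : seq constr) : seq G := flatten (map econ cs).

Arguments ebody : simpl never.
Lemma ebody_cons c cs : ebody (c :: cs) = econ c ++ ebody cs. Proof. by []. Qed.

Section Core.
Variable rest : store G.
Notation st t1 ou cn w nw := [:: t1, ou, cn, w, nw & rest].

Lemma runs_rdsym f j k w t1 ou cn nw T o :
  (forall x r, pnum w = Some (x, r) -> x < f ->
     runs (k (j + x)) (st t1 ou cn (tb r) nw) T o) ->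
  ((if pnum w is Some (x, _) then is_true (f <= x) else True) -> o = Stop false) ->
  runs (rdsym f j k) (st t1 ou cn (tb w) nw) (f + T) o.
Proof.
elim: f j w => [|f IH] j w /=.
  by case: pnum => [[x r]|] _ -> //; apply: runs_halt.
move=> Hok Hno; rewrite addSn; apply: runs_pop => /=.
case: w Hok Hno => [|[] w] Hok Hno.
- by rewrite Hno //; apply: runs_halt.
- rewrite /upd /get /=; apply: IH => [x r E xf|].
    by rewrite addSnnS; apply: Hok; rewrite /= ?E.
  by move: Hno; rewrite /=; case: pnum => [[x r]|].
- rewrite /upd /get /=; have := Hok 0 w erefl (ltn0Sn _); rewrite addn0 => H.
  by apply: (runs_le H); lia.
Qed.

(** Each unit of the number on stack 3 removes a unit from the bound on stack 4 and leaves one on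
    the scratch stack, from which the bound is rebuilt afterwards. *)
Definition vloop : prog := While 3 is_true_bit (Pop 3 (fun=> Pop 4 (fun x =>
  if x is Some _ then Seq (Push 1 (TB true)) (Push 0 (TB true)) else Halt _ false))).

Lemma un_rcons x l : un x ++ TB true :: l = un x.+1 ++ l.
Proof. by rewrite -cat_rcons -[rcons _ _]cats1 -[[:: TB true]]/(nseq 1 _) -nseqD addn1. Qed.

Lemma runs_vloop x l a b ou cn : is_true_bit (ohead l) = false ->
  runs vloop (st (un a) ou cn (un x ++ l) (un b)) (7 * x + 1)
    (if x <= b then Go (st (un (x + a)) (un x ++ ou) cn l (un (b - x))) else Stop false).
Proof.
move=> hl; elim: x a b ou => [|x IH] a b ou /=.
  by rewrite subn0; apply: runs_while_end.
case: b => [|b].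
  apply: runs_le; first apply: (@runs_while_stop _ _ _ _ _ 2) => //.
    by apply: runs_pop; apply: runs_pop; apply: runs_halt.
  lia.
have := IH a.+1 b (TB true :: ou); rewrite (addnS x) un_rcons subSS ltnS => H.
apply: runs_le; first apply: (runs_whileD _ _ H) => //.
  apply: runs_pop; apply: runs_pop; apply: (runs_seqD (runs_push1 _ _ _) (runs_push1 _ _ _)).
by rewrite mulnS; lia.
Qed.

(** [vloop] only ensures that the variable is at most [nv]; the extra [Pop 4] makes the comparison
    strict, and its unit is put back before the scratch stack is returned. *)
Definition rdvar : prog := Seq vloop (Pop 3 (fun x => if x is Some (TB false) then
    Pop 4 (fun y => if y is Some _
      then Seq (Push 4 (TB true)) (Seq (Push 1 (TB false)) (transfer _ 0 4)) else Halt _ false)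
  else Halt _ false)).

Lemma rev_tb_enc x : rev (tb (enc_nat x)) = TB false :: un x.
Proof. by rewrite /enc_nat map_cat tb_nseq rev_cat rev_nseq. Qed.

Lemma rev_un x : rev (un x) = un x. Proof. exact: rev_nseq. Qed.

Lemma runs_rdvar nv w ou cn : runs rdvar (st [::] ou cn (tb w) (un nv)) (12 * size w + 10)
  (if pvar nv w is Some (x, r) then
     Go (st [::] (rev (tb (enc_nat x)) ++ ou) cn (tb r) (un nv)) else Stop false).
Proof.
rewrite /pvar; have := pnumP w; case: pnum => [[x r]|] ->; last first.
  set n := size w; rewrite tb_nseq size_nseq -[un n]cats0.
  have H := @runs_vloop n [::] 0 nv ou cn erefl.
  case: ifP H => _ H; last by apply: runs_le; [apply: runs_seq_stop H | lia].
  apply: runs_le; first apply: (runs_seqD H (T2 := 2)); last by lia.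
  by apply: runs_pop; apply: runs_halt.
rewrite map_cat tb_nseq size_cat size_nseq /=.
have := @runs_vloop x (TB false :: tb r) 0 nv ou cn erefl; rewrite addn0.
case: ltngtP => xnv H.
- rewrite rev_tb_enc.
  apply: runs_le; first apply: (runs_seqD H (T2 := 5 * x + 6)); last by lia.
  apply: runs_le; first do 2 apply: runs_pop.
    rewrite /upd /get /= -(subnSK xnv) /=.
    apply: (runs_seqD (runs_push1 _ _ _)); apply: (runs_seqD (runs_push1 _ _ _)).
    apply: runs_eq; first by apply: runs_transfer.
    have E : un x.+1 ++ un (nv - x.+1) = un nv by rewrite -nseqD subnKC.
    by rewrite /upd /get [rev (un x)]rev_un /= un_rcons E.
  by rewrite /get /= size_nseq; lia.
- by apply: runs_le; [apply: runs_seq_stop H | lia].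
- apply: runs_le; first apply: (runs_seqD H (T2 := 3)); last by lia.
  by rewrite xnv subnn; do 2 apply: runs_pop; apply: runs_halt.
Qed.

Definition rdvars n : prog := seqs (nseq n rdvar).

Lemma runs_rdvars n nv w ou cn :
  runs (rdvars n) (st [::] ou cn (tb w) (un nv)) (n * (12 * size w + 10) + 1)
    (if pvars nv n w is Some (xs, r) then
       Go (st [::] (rev (tb (enc_nats xs)) ++ ou) cn (tb r) (un nv)) else Stop false).
Proof.
elim: n w ou => [|n IH] w ou /=; first exact: runs_skip.
have := runs_rdvar nv w ou cn; case E : (pvar nv w) => [[x r]|] H; last first.
  by apply: runs_le; [apply: runs_seq_stop H | lia].
apply: runs_le; first apply: (runs_seqD H (T2 := n * (12 * size r + 10) + 1)); last first.
  have : n * (12 * size r + 10) <= n * (12 * size w + 10).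
    by apply: leq_mul => //; have := size_pvar E; lia.
  by rewrite mulSn; lia.
have := IH r (rev (tb (enc_nat x)) ++ ou); case: pvars => [[xs r']|] //=.
by rewrite /enc_nats /= map_cat rev_cat catA.
Qed.

Variable AR : nat.
Hypothesis ARP : forall i, i < NR -> arity i <= AR.

(** The bound [(arity i).+1] admits the right arity and rejects larger ones at once; smaller ones
    are rejected in the continuation. As the control knows [i], the variables are read by a fixed
    number of copies of [rdvar]. *)
Definition rdcon : prog := rdsym NR 0 (fun i => rdsym (arity i).+1 0 (fun a =>
  if a == arity i then Seq (Push 1 (TS (inord i))) (rdvars (arity i)) else Halt _ false)).

Definition tcon n := NR + (AR + (AR * (12 * n + 10) + 3)).

Lemma runs_rdcon nv w ou cn :
  runs rdcon (st [::] ou cn (tb w) (un nv)) (tcon (size w))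
    (if pcon NR arity nv w is Some (c, r) then
       Go (st [::] (rev (econ c) ++ ou) cn (tb r) (un nv)) else Stop false).
Proof.
apply: runs_rdsym => [i r E iNR|]; rewrite /pcon; last first.
  by case: pnum => [[x r]|] //; rewrite leqNgt => /negPf ->.
rewrite E iNR add0n; have li := ARP iNR.
have lr : size r <= size w by rewrite (pnum_some E) size_cat leq_addl.
apply: (@runs_le _ _ _ ((arity i).+1 + (AR * (12 * size w + 10) + 2))); last by lia.
apply: runs_rdsym => [a r' E' la|]; last first.
  by case: pnum => [[x r']|] //; case: eqP => // ->; rewrite ltnn.
rewrite E' add0n; case: eqP => [ea|_]; last exact: runs_halt.
have lr' : size r' <= size w.
  by apply: leq_trans lr; rewrite (pnum_some E') size_cat leq_addl.
apply: runs_le; first apply: (runs_seqD (runs_push1 _ _ _)).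
  rewrite /upd /get /=; have := runs_rdvars (arity i) nv r' (TS (inord i) :: ou) cn.
  case: pvars => [[xs r'']|] //=; first by rewrite /econ /= rev_cons cat_rcons; apply.
  by apply.
have : arity i * (12 * size r' + 10) <= AR * (12 * size w + 10).
  by apply: leq_mul => //; lia.
lia.
Qed.

Definition conloop : prog := While 2 (@nonempty _) (Pop 2 (fun=> rdcon)).

Lemma tcon_le m n : m <= n -> tcon m <= tcon n.
Proof.
move=> l; rewrite /tcon !leq_add2l leq_add2r; apply: leq_mul => //; lia.
Qed.

Lemma runs_conloop m nv w ou :
  runs conloop (st [::] ou (un m) (tb w) (un nv)) (m * (tcon (size w) + 2) + 1)
    (if pcons NR arity nv m w is Some (cs, r) then
       Go (st [::] (rev (ebody cs) ++ ou) [::] (tb r) (un nv)) else Stop false).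
Proof.
elim: m w ou => [|m IH] w ou /=; first exact: runs_while_end.
have Hb : runs (Pop 2 (fun=> rdcon)) (st [::] ou (un m.+1) (tb w) (un nv)) (tcon (size w)).+1
    (if pcon NR arity nv w is Some (c, r) then
       Go (st [::] (rev (econ c) ++ ou) (un m) (tb r) (un nv)) else Stop false).
  by apply: runs_pop; apply: runs_rdcon.
case E : (pcon _ _ nv w) Hb => [[c r]|] Hb; last first.
  by apply: runs_le; [apply: runs_while_stop Hb | lia].
apply: runs_le; first apply: (runs_whileD _ Hb (T2 := m * (tcon (size r) + 2) + 1)) => //;
    last first.
  have := tcon_le (size_pcon E) => l.
  have : m * (tcon (size r) + 2) <= m * (tcon (size w) + 2).
    by apply: leq_mul => //; rewrite leq_add2r.
  by rewrite mulSn; lia.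
have := IH r (rev (econ c) ++ ou); case: pcons => [[cs r']|] //=.
by rewrite ebody_cons rev_cat catA.
Qed.

Definition parse_prog : prog := Seq (rdnum 3 4) (Seq (rdnum 3 2) (Seq conloop
  (Pop 3 (fun x => if x is Some _ then Halt _ false else Skip _)))).

Definition tparse n := n * (tcon n + 2) + 8 * n + 10.

Lemma runs_parse w ou :
  runs parse_prog (st [::] ou [::] (tb w) [::]) (tparse (size w))
    (if parse NR arity w is Some J then
       Go (st [::] (rev (ebody (constrs J)) ++ ou) [::] [::] (un (nv J))) else Stop false).
Proof.
rewrite /parse /tparse.
have := @runs_pnum 3 4 w (st [::] ou [::] (tb w) [::]) isT isT isT erefl.
case E : (pnum w) => [[nv r]|] H; last first.
  by apply: runs_le; [apply: runs_seq_stop H | lia].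
move: H; rewrite /upd /get /= cats0 => H.
have sr : size r <= size w by rewrite (pnum_some E) size_cat leq_addl.
have := @runs_pnum 3 2 r (st [::] ou [::] (tb r) (un nv)) isT isT isT erefl.
case E1 : (pnum r) => [[m r']|] H1; last first.
  by apply: runs_le; [apply: (runs_seqD H); apply: runs_seq_stop H1 | lia].
move: H1; rewrite /upd /get /= cats0 => H1.
have sr' : m + size r' <= size w.
  by apply: leq_trans sr; rewrite (pnum_some E1) /enc_nat !size_cat size_nseq; lia.
have := runs_conloop m nv r' ou.
have lt : m * (tcon (size r') + 2) <= size w * (tcon (size w) + 2).
  by apply: leq_mul; [lia | rewrite leq_add2r; apply: tcon_le; lia].
case E2 : (pcons _ _ _ _ _) => [[cs r2]|] H2; last first.
  apply: runs_le; first apply: (runs_seqD H); first apply: (runs_seqD H1).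
    by apply: runs_seq_stop H2.
  lia.
apply: runs_le; first apply: (runs_seqD H); first apply: (runs_seqD H1);
  first apply: (runs_seqD H2 (T2 := 2)); last by lia.
by apply: runs_pop; case: r2 {E2 H2} => [|b r2] /=; [apply: runs_skip | apply: runs_halt].
Qed.

End Core.
End Parse.
Arguments ebody {D NR M} cs : simpl never.
Arguments econ {D NR M} c : simpl never.
Arguments un {D NR M} x.

(** * The elimination program *)

Definition eflat (es : seq (nat * nat)) : seq nat := flatten [seq [:: e.1; e.2] | e <- es].

Lemma eflat_cat es es' : eflat (es ++ es') = eflat es ++ eflat es'.
Proof. by rewrite /eflat map_cat flatten_cat. Qed.

Lemma all_eflat n es : all (fun x => x < n) (eflat es) = all (ewf n) es.
Proof. by elim: es => //= e es <-; rewrite /ewf -andbA. Qed.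

Lemma enc_nats_cons x xs : enc_nats (x :: xs) = enc_nat x ++ enc_nats xs.
Proof. by []. Qed.

Lemma enc_nats_cat xs ys : enc_nats (xs ++ ys) = enc_nats xs ++ enc_nats ys.
Proof. by rewrite /enc_nats map_cat flatten_cat. Qed.

Arguments enc_nats : simpl never.

Lemma size_enc_nats V xs : all (fun x => x <= V) xs -> size (enc_nats xs) <= size xs * V.+1.
Proof.
elim: xs => //= x xs IH /andP[xV /IH l]; rewrite enc_nats_cons size_cat mulSn.
by apply: leq_add => //; rewrite /enc_nat size_cat size_nseq addn1.
Qed.

Section ElimProg.
Variables (T : Type) (A B : structure T) (Dj : nat -> seq disj) (D : nat) (M : TM) (EN : nat).
Notation AB := (sunion A B).
Notation NR := (nrel A + nrel B).
Notation G := (tok D NR M).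
Notation prog := (prog G).
Notation tb := (map (@TB D NR M)).

Definition uns (ys : seq nat) : store G := map un ys ++ nseq (EN - size ys) [::].

Lemma get_uns ys y : get (uns ys) y = un (nth 0 ys y).
Proof.
rewrite /get /uns nth_cat size_map; case: ltnP => yl; first by rewrite (nth_map 0).
by rewrite nth_nseq if_same nth_default.
Qed.

Lemma size_uns ys : size ys <= EN -> size (uns ys) = EN.
Proof. by move=> l; rewrite size_cat size_map size_nseq subnKC. Qed.

Lemma upd_uns ys v : size ys < EN -> upd (uns ys) (size ys) (un v) = uns (rcons ys v).
Proof.
move=> l; apply: (@eq_from_nth _ [::]).
  by rewrite size_upd !size_uns ?size_rcons // ltnW.
move=> y _; rewrite -/(get (upd _ _ _) y) -/(get (uns _) y) get_upd !get_uns nth_rcons.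
by case: ltngtP => // yl; rewrite nth_default // ltnW.
Qed.

Definition rdenv a n : prog := seqs [seq rdnum _ _ _ 3 (18 + y) | y <- iota a n].
Definition fresh a n : prog :=
  seqs [seq Seq (copy _ 0 4 (18 + y)) (Push 4 (TB true)) | y <- iota a n].
Definition copynum k y : prog := Seq (copy _ 0 (18 + y) k) (Push k (TB false)).
Definition copynums k ys : prog := seqs (map (copynum k) ys).
Definition emit_ats (l : seq constr) : prog :=
  seqs [seq Seq (Push 1 (TS (inord a.1))) (Seq (Push 2 (TB true)) (copynums 1 a.2)) | a <- l].
Fixpoint clears n : prog := if n is n.+1 then Seq (clears n) (clear _ (18 + n)) else Skip _.

(** For fixed [i] and [d] the stages are unrolled, since arities and disjuncts have constant size.
    The stacks from 18 on play the role of [env] in [elim]: the arguments are moved there, fresh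
    numbers are copied from the variable counter on stack 4, and equations and atoms are spelled out
    from them. *)
Definition elim_con i d : prog :=
  let E := pick_disj Dj (i - nrel A) d in
  Seq (rdenv 0 (ar AB i)) (Seq (fresh (ar AB i) (ne E)) (Seq (copynums 6 (eflat (eqs E)))
    (Seq (emit_ats (ats E)) (clears (ar AB i + ne E))))).

(** Constraints over A need no parsing: their symbol is counted on stack 2 and their bits pass
    through unchanged. Only an alien symbol consumes a digit and triggers a replacement. *)
Definition elim_step : prog := Pop 3 (fun x => match x with
  | Some (TB b) => Push 1 (TB b)
  | Some (TS i) =>
    if i < nrel A then Seq (Push 1 (TS i)) (Push 2 (TB true))
    else Pop 5 (fun y => match y with
      | Some (TD d) => if Dj (i - nrel A) is [::] then Halt _ false else elim_con i d
      | _ => Halt _ false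
      end)
  | _ => Skip _
  end).

Definition elim_loop : prog := While 3 (@nonempty _) elim_step.

Section Core.
Variables a7 a8 a9 a10 a11 a12 a13 a14 a15 a16 a17 : seq G.
Notation st ou cn w nw cw eq env := [:: [::], ou, cn, w, nw, cw, eq, a7, a8, a9, a10, a11,
  a12, a13, a14, a15, a16, a17 & env].

Lemma runs_rdenv xs ys ou cn l nw cw eq V :
  all (fun x => x <= V) xs -> size ys + size xs <= EN ->
  runs (rdenv (size ys) (size xs)) (st ou cn (tb (enc_nats xs) ++ l) nw cw eq (uns ys))
    (size xs * (4 * V + 3) + 1) (Go (st ou cn l nw cw eq (uns (ys ++ xs)))).
Proof.
elim: xs ys => [|x xs IH] ys /=; first by rewrite cats0 => *; apply: runs_skip.
case/andP=> xV xsV; rewrite addnS => l_.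
have H := @runs_rdnum D NR M 3 (18 + size ys) x (tb (enc_nats xs) ++ l)
  (st ou cn (tb (enc_nats (x :: xs)) ++ l) nw cw eq (uns ys)).
apply: runs_le; first apply: (runs_seqD (H _ _ _ _)) => //.
- by rewrite /= size_uns ?ltnS -?[18 + _]/(_.+4.+4.+4.+4.+2) ?ltnS; lia.
- by rewrite /get /= enc_nats_cons map_cat -tb_nseq /enc_nat map_cat -!catA.
- rewrite -[upd _ _ _]/(st ou cn (tb (enc_nats xs) ++ l) nw cw eq
    (upd (uns ys) (size ys) (un x ++ get (uns ys) (size ys)))).
  rewrite get_uns nth_default // cats0 upd_uns; last by lia.
  have := IH (rcons ys x) xsV; rewrite size_rcons cat_rcons addSn => /(_ l_); exact.
- by rewrite mulSn; lia.
Qed.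

Lemma runs_fresh n ys ou cn w v cw eq : size ys + n <= EN ->
  runs (fresh (size ys) n) (st ou cn w (un v) cw eq (uns ys))
    (n * (10 * (v + n) + 3) + 1)
    (Go (st ou cn w (un (v + n)) cw eq (uns (ys ++ iota v n)))).
Proof.
elim: n ys v => [|n IH] ys v /=; first by rewrite cats0 !addn0 => *; apply: runs_skip.
rewrite addnS => l_.
have H := @runs_copy G 0 4 (18 + size ys) (st ou cn w (un v) cw eq (uns ys)).
apply: runs_le; first apply: (runs_seqD (T1 := 10 * v + 3)
    (s1 := st ou cn w (un v.+1) cw eq (uns (rcons ys v)))).
- apply: runs_le; first apply: (runs_seqD (H _ _ _)) => //.
  + by rewrite /= size_uns -?[18 + _]/(_.+4.+4.+4.+4.+2) ?ltnS; lia.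
  + rewrite -[upd _ _ _]/(st ou cn w (un v) cw eq
      (upd (uns ys) (size ys) (un v ++ get (uns ys) (size ys)))).
    rewrite get_uns nth_default // cats0 upd_uns; last by lia.
    exact: runs_push1.
  + by rewrite /get /= size_nseq; lia.
- have := IH (rcons ys v) v.+1; rewrite size_rcons addSn cat_rcons addSnnS => /(_ l_); exact.
- by rewrite mulSn; lia.
Qed.

Lemma runs_copynum1 y ys ou cn w nw cw eq V :
  nth 0 ys y <= V -> y < size ys -> size ys <= EN ->
  runs (copynum 1 y) (st ou cn w nw cw eq (uns ys)) (10 * V + 3)
    (Go (st (rev (tb (enc_nat (nth 0 ys y))) ++ ou) cn w nw cw eq (uns ys))).
Proof.
move=> yV ys_ l_.
have H := @runs_copy G 0 (18 + y) 1 (st ou cn w nw cw eq (uns ys)).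
have gE : get (st ou cn w nw cw eq (uns ys)) (18 + y) = un (nth 0 ys y) by exact: get_uns.
apply: runs_le; first apply: (runs_seqD (H _ _ _)) => //.
- by rewrite /= size_uns // -?[18 + _]/(_.+4.+4.+4.+4.+2) !ltnS andbT; lia.
- by rewrite gE rev_tb_enc; apply: runs_push1.
- by rewrite gE size_nseq; lia.
Qed.

Lemma runs_copynum6 y ys ou cn w nw cw eq V :
  nth 0 ys y <= V -> y < size ys -> size ys <= EN ->
  runs (copynum 6 y) (st ou cn w nw cw eq (uns ys)) (10 * V + 3)
    (Go (st ou cn w nw cw (rev (tb (enc_nat (nth 0 ys y))) ++ eq) (uns ys))).
Proof.
move=> yV ys_ l_.
have H := @runs_copy G 0 (18 + y) 6 (st ou cn w nw cw eq (uns ys)).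
have gE : get (st ou cn w nw cw eq (uns ys)) (18 + y) = un (nth 0 ys y) by exact: get_uns.
apply: runs_le; first apply: (runs_seqD (H _ _ _)) => //.
- by rewrite /= size_uns // -?[18 + _]/(_.+4.+4.+4.+4.+2) !ltnS andbT; lia.
- by rewrite gE rev_tb_enc; apply: runs_push1.
- by rewrite gE size_nseq; lia.
Qed.

Lemma runs_copynums1 zs ys ou cn w nw cw eq V :
  all (fun x => x <= V) ys -> all (fun y => y < size ys) zs -> size ys <= EN ->
  runs (copynums 1 zs) (st ou cn w nw cw eq (uns ys)) (size zs * (10 * V + 3) + 1)
    (Go (st (rev (tb (enc_nats (map (inst_var ys) zs))) ++ ou) cn w nw cw eq (uns ys))).
Proof.
move=> yV + l_; elim: zs ou => [|z zs IH] ou /=; first by move=> _; apply: runs_skip.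
case/andP=> zl /IH {}IH; rewrite enc_nats_cons map_cat rev_cat -catA mulSn -addnA.
apply: runs_seqD; first apply: runs_copynum1 => //; last exact: IH.
by apply: (allP yV); apply: mem_nth.
Qed.

Lemma runs_copynums6 zs ys ou cn w nw cw eq V :
  all (fun x => x <= V) ys -> all (fun y => y < size ys) zs -> size ys <= EN ->
  runs (copynums 6 zs) (st ou cn w nw cw eq (uns ys)) (size zs * (10 * V + 3) + 1)
    (Go (st ou cn w nw cw (rev (tb (enc_nats (map (inst_var ys) zs))) ++ eq) (uns ys))).
Proof.
move=> yV + l_; elim: zs eq => [|z zs IH] eq /=; first by move=> _; apply: runs_skip.
case/andP=> zl /IH {}IH; rewrite enc_nats_cons map_cat rev_cat -catA mulSn -addnA.
apply: runs_seqD; first apply: runs_copynum6 => //; last exact: IH.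
by apply: (allP yV); apply: mem_nth.
Qed.

Lemma runs_emit_ats l ys ou c w nw cw eq V K :
  all (fun x => x <= V) ys -> all (fun a => all (fun y => y < size ys) a.2) l ->
  all (fun a : constr => size a.2 <= K) l -> size ys <= EN ->
  runs (emit_ats l) (st ou (un c) w nw cw eq (uns ys))
    (size l * (K * (10 * V + 3) + 3) + 1)
    (Go (st (rev (ebody [seq (a.1, map (inst_var ys) a.2) | a <- l]) ++ ou)
       (un (size l + c)) w nw cw eq (uns ys))).
Proof.
move=> yV + + l_; elim: l ou c => [|a l IH] ou c /=; first by move=> _ _; apply: runs_skip.
case/andP=> al lw /andP[aK lK].
have := IH (rev (econ (a.1, map (inst_var ys) a.2)) ++ ou) c.+1 lw lK => {}IH.
apply: runs_le; first apply: (runs_seqD (T1 := K * (10 * V + 3) + 3) _ (runs_eq IH _)).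
- apply: runs_le; first apply: (runs_seqD (runs_push1 _ _ _)).
    apply: (runs_seqD (runs_push1 _ _ _)).
    apply: (runs_eq (runs_copynums1 _ _ _ _ _ _ yV al l_)).
    by rewrite /econ /= rev_cons cat_rcons.
  have : size a.2 * (10 * V + 3) <= K * (10 * V + 3) by apply: leq_mul.
  lia.
- by rewrite addnS ebody_cons rev_cat catA.
- by rewrite mulSn; lia.
Qed.

Lemma runs_clears n env ou cn w nw cw eq V :
  n <= size env -> (forall y, size (get env y) <= V) ->
  runs (clears n) (st ou cn w nw cw eq env) (n * (3 * V + 1) + 1)
    (Go (st ou cn w nw cw eq (nseq n [::] ++ drop n env))).
Proof.
move=> nl eV; elim: n nl => [|n IH] nl; first by rewrite drop0; apply: runs_skip.
apply: runs_le; first apply: (runs_seqD (IH (ltnW nl)) (runs_eq (runs_clear _) _)).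
- rewrite /= size_cat size_nseq size_drop -?[18 + _]/(_.+4.+4.+4.+4.+2) !ltnS.
  by rewrite subnKC // ltnW.
- set e := nseq n [::] ++ drop n env.
  rewrite -[upd _ _ _]/(st ou cn w nw cw eq (upd e n [::])); congr (Go (st _ _ _ _ _ _ _)).
  apply: (@eq_from_nth _ [::]) => [|y _].
    have se : size e = size env by rewrite size_cat size_nseq size_drop subnKC // ltnW.
    by rewrite size_upd se // size_cat size_nseq size_drop subnKC.
  rewrite -/(get (upd _ _ _) y) get_upd /get /e !nth_cat !size_nseq !nth_nseq !nth_drop.
  case: (ltngtP y n) => yn; first by rewrite ltnS ltnW.
    by rewrite ltnS leqNgt yn /= !subnKC // ltnW.
  by rewrite yn ltnSn.
- have := eV n; rewrite [get env n]/get => eVn.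
  rewrite -[get _ (18 + n)]/(get (nseq n [::] ++ drop n env) n).
  rewrite /get nth_cat size_nseq ltnn nth_drop subnn addn0.
  move: eVn; move: (size _) => k; rewrite mulSn; lia.
Qed.

Variable K : nat.
Hypothesis arK : forall i, i < NR -> ar AB i <= K.
Hypothesis DjP : forall i, i < nrel B -> defines A (ar B i) (Dj i) (rel B i).
Hypothesis DjK : forall i d, i < nrel B -> d \in Dj i ->
  [&& ne d <= K, size (eqs d) <= K, size (ats d) <= K
    & all (fun a : constr => size a.2 <= K) (ats d)].
Hypothesis ENK : K + K <= EN.

Lemma size_eflat es : size (eflat es) = 2 * size es.
Proof. by elim: es => //= e es; rewrite /eflat /= => ->; rewrite mulnS. Qed.

Lemma map_eflat env d : map (inst_var env) (eflat (eqs d)) = eflat (inst_eqs env d).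
Proof. by rewrite /inst_eqs; elim: (eqs d) => //= e es; rewrite /eflat /= => ->. Qed.

(** The five groups are the costs of the five stages of [elim_con]. The factors 2 arise because an
    equation has two sides and because at most [K] arguments and [K] fresh variables have to be
    cleared. *)
Definition telim V := K * (4 * V + 3) + 1 + (K * (10 * V + 3) + 1) +
  (2 * K * (10 * V + 3) + 1) + (K * (K * (10 * V + 3) + 3) + 1) + (2 * K * (3 * V + 1) + 1).

Lemma runs_elim_con c d nv V ou k l cw eq : cwf AB nv c -> alien A c ->
  Dj (c.1 - nrel A) <> [::] -> nv + K <= V ->
  let E := pick_disj Dj (c.1 - nrel A) d in
  let env := c.2 ++ iota nv (ne E) in
  runs (elim_con c.1 d) (st ou (un k) (tb (enc_nats c.2) ++ l) (un nv) cw eq (uns [::]))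
    (telim V) (Go (st (rev (ebody (inst_ats env E)) ++ ou) (un (size (inst_ats env E) + k)) l
      (un (nv + ne E)) cw (rev (tb (enc_nats (eflat (inst_eqs env E)))) ++ eq) (uns [::]))).
Proof.
move=> cw_ cA Dn nvV E env; have [cB sc cl] := cwf_alien cw_ cA.
have ED : E \in Dj (c.1 - nrel A) by apply: pick_disj_mem.
have /and4P[nK eK aK aaK] := DjK cB ED.
have /andP[ew aw] : dwf A (ar B (c.1 - nrel A)) E by have [/allP -> //] := DjP cB.
have arE : ar AB c.1 = size c.2 by case/and3P: cw_ => _ /eqP.
have sK : size c.2 <= K by rewrite -arE; apply: arK; case/and3P: cw_.
have se : size env = size c.2 + ne E by rewrite size_cat size_iota.
have envV : all (fun x => x <= V) env.
  by apply: sub_all (env_wf cl (leqnn (nv + ne E))) => x; lia.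
rewrite -sc -se in ew aw.
rewrite /elim_con -/E arE /telim.
have sEN : size env <= EN by lia.
have H1 : runs (rdenv 0 (size c.2)) (st ou (un k) (tb (enc_nats c.2) ++ l) (un nv) cw eq (uns [::]))
    (K * (4 * V + 3) + 1) (Go (st ou (un k) l (un nv) cw eq (uns c.2))).
  apply: (runs_le (@runs_rdenv c.2 [::] ou (un k) l (un nv) cw eq V _ _)).
  - by apply: sub_all cl => x; lia.
  - by rewrite /=; lia.
  - by rewrite leq_add2r leq_mul2r sK orbT.
have H2 : runs (fresh (size c.2) (ne E)) (st ou (un k) l (un nv) cw eq (uns c.2))
    (K * (10 * V + 3) + 1) (Go (st ou (un k) l (un (nv + ne E)) cw eq (uns env))).
  apply: (runs_le (@runs_fresh (ne E) c.2 ou (un k) l nv cw eq _)); first by lia.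
  by rewrite leq_add2r leq_mul //; lia.
have H3 : runs (copynums 6 (eflat (eqs E))) (st ou (un k) l (un (nv + ne E)) cw eq (uns env))
    (2 * K * (10 * V + 3) + 1) (Go (st ou (un k) l (un (nv + ne E)) cw
      (rev (tb (enc_nats (eflat (inst_eqs env E)))) ++ eq) (uns env))).
  rewrite -map_eflat; apply: runs_le; first apply: (runs_copynums6 _ _ _ _ _ _ envV _ sEN).
    by rewrite all_eflat.
  by rewrite leq_add2r size_eflat leq_mul // leq_mul.
have H4 := fun eq' : seq G => @runs_emit_ats (ats E) env ou k l (un (nv + ne E)) cw eq' V K
  envV _ aaK sEN.
have {}H4 : runs (emit_ats (ats E)) (st ou (un k) l (un (nv + ne E)) cw
      (rev (tb (enc_nats (eflat (inst_eqs env E)))) ++ eq) (uns env))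
    (K * (K * (10 * V + 3) + 3) + 1)
    (Go (st (rev (ebody (inst_ats env E)) ++ ou) (un (size (inst_ats env E) + k)) l
      (un (nv + ne E)) cw (rev (tb (enc_nats (eflat (inst_eqs env E)))) ++ eq) (uns env))).
  rewrite [size (inst_ats _ _)]size_map; apply: (runs_le (H4 _ _)).
    by apply: sub_all aw => a /and3P[].
  by rewrite leq_add2r leq_mul.
have H5 : runs (clears (size env)) (st (rev (ebody (inst_ats env E)) ++ ou)
      (un (size (inst_ats env E) + k)) l
      (un (nv + ne E)) cw (rev (tb (enc_nats (eflat (inst_eqs env E)))) ++ eq) (uns env))
    (2 * K * (3 * V + 1) + 1)
    (Go (st (rev (ebody (inst_ats env E)) ++ ou) (un (size (inst_ats env E) + k)) l
      (un (nv + ne E)) cw (rev (tb (enc_nats (eflat (inst_eqs env E)))) ++ eq) (uns [::]))).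
  apply: runs_le; first apply: (runs_eq (runs_clears (V := V) _ _ _ _ _ _ _ _)).
  - by rewrite size_uns.
  - move=> y; rewrite get_uns size_nseq; case: (ltnP y (size env)) => yl.
      by apply: (allP envV); apply: mem_nth.
    by rewrite nth_default.
  - congr (Go (st _ _ _ _ _ _ _)).
    rewrite /uns drop_size_cat ?size_map // -nseqD subn0; congr nseq; lia.
  - rewrite leq_add2r leq_mul //; lia.
rewrite se in H5.
apply: runs_le; first exact: (runs_seqD H1 (runs_seqD H2 (runs_seqD H3 (runs_seqD H4 H5)))).
lia.
Qed.

Lemma runs_elim_bits bs l ou cn nw cw eq env t o :
  runs elim_loop (st (rev (tb bs) ++ ou) cn l nw cw eq env) t o ->
  runs elim_loop (st ou cn (tb bs ++ l) nw cw eq env) (3 * size bs + t) o.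
Proof.
elim: bs ou => //= b bs IH ou; rewrite rev_cons cat_rcons => /IH {}IH.
rewrite mulnS; apply: runs_le; first apply: (runs_whileD _ _ IH) => //.
  by apply: runs_pop; apply: runs_push1.
by lia.
Qed.

Definition tstep V := telim V + 3 * (K * V.+1) + 6.

(** [V] bounds every variable number throughout the run, since each constraint introduces at most
    [K] fresh variables. The results appear reversed because they are pushed in order. *)
Lemma runs_elim_loop cs nv ch V ou k eq :
  all (cwf AB nv) cs -> all (fun d => d <= D) ch -> nv + size cs * K <= V ->
  runs elim_loop (st ou (un k) (ebody cs) (un nv) (digits ch) eq (uns [::]))
    (size cs * tstep V + 1)
    (if elim A Dj nv cs ch is Some (nv', (es, cs')) then
       Go (st (rev (ebody cs') ++ ou) (un (size cs' + k)) [::] (un nv')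
         (digits (drop (count (alien A) cs) ch)) (rev (tb (enc_nats (eflat es))) ++ eq) (uns [::]))
     else Stop false).
Proof.
elim: cs nv ch ou k eq => [|c cs IH] nv ch ou k eq.
  by rewrite /= drop0 => *; apply: runs_while_end.
move=> /= /andP[cw_ csw] chD; rewrite mulSn => lV.
have /and3P[cR /eqP arE cl] := cw_.
have cRN : nat_of_ord (inord c.1 : 'I_NR.+1) = c.1 by rewrite inordK // ltnW.
rewrite ebody_cons mulSn /alien; case: ltnP => cA /=.
  have encK : size (enc_nats c.2) <= K * V.+1.
    apply: leq_trans (size_enc_nats (V := V) _) _; first by apply: sub_all cl => x; lia.
    by rewrite leq_mul // arE; apply: arK.
  have := IH nv ch (rev (econ c) ++ ou) k.+1 eq csw chD.
  have -> : nv + size cs * K <= V by lia.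
  move=> /(_ isT) H.
  have {}H : runs elim_loop (st ou (un k) (econ c ++ ebody cs) (un nv) (digits ch) eq (uns [::]))
     (5 + (3 * size (enc_nats c.2) + (size cs * tstep V + 1)))
     (if elim A Dj nv cs ch is Some (nv', (es, cs')) then
       Go (st (rev (ebody cs') ++ (rev (econ c) ++ ou)) (un (size cs' + k.+1)) [::] (un nv')
         (digits (drop (count (alien A) cs) ch)) (rev (tb (enc_nats (eflat es))) ++ eq) (uns [::]))
     else Stop false).
    apply: runs_le; first apply: (runs_whileD (T1 := 3)); last exact: leqnn; first by [].
      apply: runs_pop; rewrite /= cRN cA.
      exact: (runs_seqD (runs_push1 _ _ _) (runs_push1 _ _ _)).
    apply: runs_le; first apply: (runs_elim_bits (bs := enc_nats c.2)).
      by move: H; rewrite /econ rev_cons cat_rcons; apply.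
    by lia.
  apply: runs_le; first apply: (runs_eq H).
    case: (elim _ _ _ _ _) => [[nv' [es cs']]|] //=.
    by rewrite ebody_cons rev_cat -catA addnS.
  by rewrite /tstep; lia.
have [cB sc _] := cwf_alien cw_ cA.
case: ch chD => [|d ch] /=.
  move=> _; apply: runs_le; first apply: runs_while_stop => //.
    by do 2! [apply: runs_pop; rewrite /= ?cRN ?ltnNge ?cA /=]; apply: (runs_halt _ _ 0).
  by rewrite /tstep; lia.
case/andP=> dD chD; case DE : (Dj _) => [|d0 ds].
  apply: runs_le; first apply: runs_while_stop => //.
    by do 2! [apply: runs_pop; rewrite /= ?cRN ?ltnNge ?cA /= ?DE]; apply: (runs_halt _ _ 0).
  by rewrite /tstep; lia.
have Dn : Dj (c.1 - nrel A) <> [::] by rewrite DE.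
have Hb := @runs_elim_con c d nv V ou k (ebody cs) (digits ch) eq cw_ cA Dn.
have nvK : nv + K <= V by lia.
have {Hb} := Hb nvK; set E := pick_disj _ _ _; set env := c.2 ++ _ => Hb.
have neK : ne E <= K.
  by have /and4P[] := DjK cB (pick_disj_mem d Dn).
have := IH (nv + ne E) ch (rev (ebody (inst_ats env E)) ++ ou) (size (inst_ats env E) + k)
  (rev (tb (enc_nats (eflat (inst_eqs env E)))) ++ eq).
have -> : all (cwf AB (nv + ne E)) cs.
  by apply: sub_all csw => x; apply: cwfW; apply: leq_addr.
have -> : nv + ne E + size cs * K <= V by lia.
move=> /(_ isT chD isT) H.
apply: runs_le; first apply: (runs_whileD (T1 := telim V + 2) _ _ (runs_eq H _)) => //; last first.
- by rewrite /tstep; lia.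
- case: (elim _ _ _ _ _) => [[nv' [es cs']]|] //=.
  rewrite size_cat [size cs' + (_ + _)]addnCA addnA /ebody map_cat flatten_cat rev_cat -catA.
  by rewrite eflat_cat enc_nats_cat map_cat rev_cat -catA.
rewrite addn2; do 2! [apply: runs_pop; rewrite /= ?cRN ?ltnNge ?cA /= ?DE].
by rewrite inordK.
Qed.

End Core.
End ElimProg.

(** * Substitution of variables *)

Section Subst.
Variables (D NR : nat) (M : TM).
Notation G := (tok D NR M).
Notation prog := (prog G).
Notation tb := (map (@TB D NR M)).

(** Subtracts in both directions at once: [x] is taken from a copy of [a] on stack 10, its excess
    goes to stack 11, and [x] itself is saved on the scratch stack. Equality holds iff both
    differences vanish. *)
Definition cmp_loop : prog := While 9 (@nonempty _) (Pop 9 (fun=> Seq (Push 0 (TB true))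
  (Pop 10 (fun y => if y is Some _ then Skip _ else Push 11 (TB true))))).

(* Sends [x] on stack 9 to [sub_var a b x] on stack 1, with [a], [b] on stacks 7, 8. *)
Definition sub_num : prog :=
  Seq (copy _ 0 7 10) (Seq cmp_loop (Seq (transfer _ 10 11) (Seq
    (Pop 11 (fun y => if y is Some _ then Seq (transfer _ 0 1) (clear _ 11)
                      else Seq (clear _ 0) (copy _ 0 8 1)))
    (Push 1 (TB false))))).

Definition sub_loop : prog := While 3 (@nonempty _) (Pop 3 (fun t => match t with
  | Some (TB true) => Push 9 (TB true)
  | Some (TB false) => sub_num
  | Some (TS i) => Push 1 (TS i)
  | _ => Skip _
  end)).

(** On stack 3 the equations precede the constraints, and a constraint begins with a symbol; a bit
    on top therefore means that an equation is left. *)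
Definition is_bit (x : option G) := if x is Some (TB _) then true else false.

(** One pass of [sub_loop] substitutes in the remaining equations and in the constraints alike,
    since both consist of the same unary numbers. *)
Definition eq_loop : prog := While 3 is_bit (Seq (rdnum _ _ _ 3 7) (Seq (rdnum _ _ _ 3 8)
  (Seq sub_loop (Seq (transfer _ 1 3) (Seq (clear _ 7) (clear _ 8)))))).

Section Core.
Variables (a2 a4 a5 a6 : seq G) (rest : store G).
Notation st t1 ou w ra rb rc rd fl :=
  [:: t1, ou, a2, w, a4, a5, a6, ra, rb, rc, rd, fl & rest].

Lemma un_cat x y : un x ++ un y = un (x + y) :> seq G.
Proof. by rewrite -nseqD. Qed.

Lemma runs_cmp_loop x a t f ou w ra rb :
  runs cmp_loop (st (un t) ou w ra rb (un x) (un a) (un f)) (5 * x + 1)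
    (Go (st (un (x + t)) ou w ra rb [::] (un (a - x)) (un (x - a + f)))).
Proof.
elim: x a t f => [|x IH] a t f; first by rewrite subn0 sub0n; apply: runs_while_end.
have Hb : runs (Pop 9 (fun=> Seq (Push 0 (TB true))
    (Pop 10 (fun y => if y is Some _ then Skip _ else Push 11 (TB true)))))
    (st (un t) ou w ra rb (un x.+1) (un a) (un f)) 4
    (Go (st (un t.+1) ou w ra rb (un x) (un a.-1) (un (f + (a == 0))))).
  apply: runs_pop; apply: (runs_seqD (runs_push1 _ _ _)); apply: runs_pop.
  case: a => [|a]; first by rewrite eqxx (addn1 f); apply: runs_push1.
  by rewrite (addn0 f); apply: runs_skip1.
apply: runs_le; first apply: (runs_eq (runs_whileD _ Hb (IH a.-1 t.+1 _))) => //; last by lia.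
by congr (Go (st (un _) _ _ _ _ _ (un _) (un _))); lia.
Qed.

Lemma tb_enc_cons x xs : tb (enc_nats (x :: xs)) = tb (enc_nat x) ++ tb (enc_nats xs).
Proof. exact: map_cat. Qed.

Lemma tb_enc_cat x xs (l : seq G) :
  tb (enc_nats (x :: xs)) ++ l = un x ++ TB false :: tb (enc_nats xs) ++ l.
Proof. by rewrite tb_enc_cons /enc_nat map_cat tb_nseq -!catA. Qed.

Definition tsub V := 40 * V + 30.

Lemma runs_sub_num V x a b ou w : x <= V -> a <= V -> b <= V ->
  runs sub_num (st [::] ou w (un a) (un b) (un x) [::] [::]) (tsub V)
    (Go (st [::] (rev (tb (enc_nat (sub_var a b x))) ++ ou) w (un a) (un b) [::] [::] [::])).
Proof.
move=> xV aV bV; rewrite rev_tb_enc /sub_num /tsub.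
have H1 : runs (copy _ 0 7 10) (st [::] ou w (un a) (un b) (un x) [::] [::]) (10 * V + 2)
    (Go (st [::] ou w (un a) (un b) (un x) (un a) [::])).
  apply: runs_le; first apply: runs_eq; first by apply: runs_copy.
    by rewrite /upd /get /= cats0.
  by rewrite /get /= size_nseq; lia.
have H2 := @runs_cmp_loop x a 0 0 ou w (un a) (un b); rewrite !addn0 in H2.
have H3 : runs (transfer _ 10 11)
    (st (un x) ou w (un a) (un b) [::] (un (a - x)) (un (x - a))) (5 * V + 1)
    (Go (st (un x) ou w (un a) (un b) [::] [::] (un ((a - x) + (x - a))))).
  apply: runs_le; first apply: runs_eq; first by apply: runs_transfer.
    by rewrite /upd /get [rev _]rev_un /= un_cat.
  by rewrite /get /= size_nseq; lia.
have H4 : runs (Pop 11 (fun y => if y is Some _ then Seq (transfer _ 0 1) (clear _ 11)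
                      else Seq (clear _ 0) (copy _ 0 8 1)))
    (st (un x) ou w (un a) (un b) [::] [::] (un ((a - x) + (x - a)))) (13 * V + 5)
    (Go (st [::] (un (sub_var a b x) ++ ou) w (un a) (un b) [::] [::] [::])).
  rewrite addnS; apply: runs_pop; rewrite /sub_var; case: eqP => [->|nxa].
    rewrite subnn /=; apply: runs_le; first apply: runs_seqD.
    - by apply: runs_clear.
    - by apply: runs_copy.
    by rewrite /get /= !size_nseq; lia.
  case E : (_ + _) => [|n]; first by lia.
  apply: runs_le; first apply: runs_seqD.
  - by apply: runs_transfer.
  - by rewrite /upd /get [rev _]rev_un /=; apply: runs_clear.
  by rewrite /get /= !size_nseq; lia.
apply: runs_le; first apply: (runs_seqD H1 (runs_seqD H2 (runs_seqD H3 (runs_seqD H4 _)))).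
  exact: runs_push1.
lia.
Qed.

Lemma runs_sub_nums V xs a b ou l t o : all (fun x => x <= V) xs -> a <= V -> b <= V ->
  runs sub_loop (st [::] (rev (tb (enc_nats (map (sub_var a b) xs))) ++ ou) l (un a) (un b)
    [::] [::] [::]) t o ->
  runs sub_loop (st [::] ou (tb (enc_nats xs) ++ l) (un a) (un b) [::] [::] [::])
    (size xs * (3 * V + tsub V + 2) + t) o.
Proof.
move=> + aV bV; elim: xs ou => //= x xs IH ou /andP[xV /IH {}IH].
rewrite !tb_enc_cons rev_cat -[in X in X -> _]catA => /IH {}IH; rewrite -catA.
have H y z : y + z = x -> runs sub_loop
    (st [::] ou (tb (enc_nat y) ++ tb (enc_nats xs) ++ l) (un a) (un b) (un z) [::] [::])
    (3 * y + (tsub V + 2) + (size xs * (3 * V + tsub V + 2) + t)) o.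
  elim: y z => [|y IHy] z yz.
    rewrite add0n in yz; rewrite {}yz.
    apply: runs_le; first apply: (runs_whileD (T1 := tsub V + 1) _ _ IH) => //; last by lia.
    by rewrite addn1; apply: runs_pop; apply: runs_sub_num.
  have {}yz : y + z.+1 = x by lia.
  have H := IHy _ yz.
  apply: runs_le; first apply: (runs_whileD (T1 := 2) _ _ H) => //; last by lia.
  by apply: runs_pop; apply: runs_push1.
apply: (runs_le (H x 0 (addn0 x))).
have : 3 * x <= 3 * V by lia.
rewrite mulSn; lia.
Qed.

(** Number of variable occurrences. Together with the number of constraints it bounds the length of
    the token list, and substitution changes neither, so that one bound serves all rounds. *)
Definition occs (cs : seq constr) := sumn (map (fun c => size c.2) cs).

Lemma runs_sub_body V cs a b ou t o : all (fun c => all (fun x => x <= V) c.2) cs ->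
  a <= V -> b <= V ->
  runs sub_loop (st [::] (rev (ebody (map (sub_constr a b) cs)) ++ ou) [::] (un a) (un b)
    [::] [::] [::]) t o ->
  runs sub_loop (st [::] ou (ebody cs) (un a) (un b) [::] [::] [::])
    (3 * size cs + occs cs * (3 * V + tsub V + 2) + t) o.
Proof.
move=> + aV bV; elim: cs ou => //= c cs IH ou /andP[cV /IH {}IH].
rewrite !ebody_cons rev_cat -catA => /IH {}IH.
have := runs_sub_nums (ou := TS (inord c.1) :: ou) (xs := c.2) (l := ebody cs) cV aV bV.
rewrite /econ /= rev_cons cat_rcons in IH * => /(_ _ _ IH) H.
apply: runs_le; first apply: (runs_whileD (T1 := 2) _ _ H) => //.
  by apply: runs_pop; apply: runs_push1.
rewrite /occs /= mulnDl; lia.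
Qed.

Definition tround V s m k :=
  s * (3 * V + tsub V + 2) + (3 * m + k * (3 * V + tsub V + 2)) + 1
  + (5 * (s * V.+1 + m + k * V.+1) + 1) + 2 * (3 * V + 1) + 2 * (4 * V + 3).

Lemma size_ebody V cs : all (fun c => all (fun x => x <= V) c.2) cs ->
  size (@ebody D NR M cs) <= size cs + occs cs * V.+1.
Proof.
elim: cs => // c cs IH /andP[cV /IH l]; rewrite ebody_cons size_cat /econ /= size_map.
have := size_enc_nats cV; rewrite /occs /= mulnDl -/(occs cs); lia.
Qed.

Lemma occs_sub a b cs : occs (map (sub_constr a b) cs) = occs cs.
Proof. by rewrite /occs -map_comp; congr sumn; apply: eq_map => c /=; rewrite size_map. Qed.

Lemma sub_var_le V a b x : b <= V -> x <= V -> sub_var a b x <= V.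
Proof. by rewrite /sub_var; case: eqP. Qed.

Lemma eflat_sub a b es : eflat (map (sub_eq a b) es) = map (sub_var a b) (eflat es).
Proof. by elim: es => //= e es; rewrite /eflat /= => ->. Qed.

Lemma runs_eq_loop V es cs : all (fun x => x <= V) (eflat es) ->
  all (fun c => all (fun x => x <= V) c.2) cs ->
  runs eq_loop (st [::] [::] (tb (enc_nats (eflat es)) ++ ebody cs) [::] [::] [::] [::] [::])
    (size es * (tround V (2 * size es) (size cs) (occs cs)).+1 + 1)
    (Go (st [::] [::] (ebody (solve (size es) es cs)) [::] [::] [::] [::] [::])).
Proof.
move sE : (size es) => n; elim: n es cs sE => [|n IH] [|e es] cs //.
  by move=> _ _ _; apply: runs_while_end => //; case: cs.
move=> [sE] /=; case/and3P=> aV bV esV csV.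
set cs' := map (sub_constr e.1 e.2) cs; set es' := map (sub_eq e.1 e.2) es.
have csV' : all (fun c => all (fun x => x <= V) c.2) cs'.
  rewrite all_map; apply: sub_all csV => c /= cV; rewrite all_map.
  by apply: sub_all cV => x; apply: sub_var_le.
have esV' : all (fun x => x <= V) (eflat es').
  by rewrite eflat_sub all_map; apply: sub_all esV => x; apply: sub_var_le.
have := IH es' cs'; rewrite size_map => /(_ sE esV' csV') H.
rewrite occs_sub size_map in H.
have Hb : runs (Seq (rdnum _ _ _ 3 7) (Seq (rdnum _ _ _ 3 8)
  (Seq sub_loop (Seq (transfer _ 1 3) (Seq (clear _ 7) (clear _ 8))))))
  (st [::] [::] (tb (enc_nats (eflat (e :: es))) ++ ebody cs) [::] [::] [::] [::] [::])
  (tround V (2 * size es) (size cs) (occs cs))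
  (Go (st [::] [::] (tb (enc_nats (eflat es')) ++ ebody cs') [::] [::] [::] [::] [::])).
  have H1 : runs (rdnum _ _ _ 3 7)
    (st [::] [::] (tb (enc_nats (eflat (e :: es))) ++ ebody cs) [::] [::] [::] [::] [::])
    (4 * V + 3) (Go (st [::] [::] (tb (enc_nats (e.2 :: eflat es)) ++ ebody cs)
      (un e.1) [::] [::] [::] [::])).
    apply: runs_le; first apply: runs_eq; first apply: (@runs_rdnum _ _ _ 3 7 e.1
      (tb (enc_nats (e.2 :: eflat es)) ++ ebody cs)) => //.
    - exact: tb_enc_cat.
    - by rewrite /upd /get /= cats0.
    - lia.
  have H2 : runs (rdnum _ _ _ 3 8)
    (st [::] [::] (tb (enc_nats (e.2 :: eflat es)) ++ ebody cs) (un e.1) [::] [::] [::] [::])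
    (4 * V + 3) (Go (st [::] [::] (tb (enc_nats (eflat es)) ++ ebody cs)
      (un e.1) (un e.2) [::] [::] [::])).
    apply: runs_le; first apply: runs_eq; first apply: (@runs_rdnum _ _ _ 3 8 e.2
      (tb (enc_nats (eflat es)) ++ ebody cs)) => //.
    - exact: tb_enc_cat.
    - by rewrite /upd /get /= cats0.
    - lia.
  have H3 : runs sub_loop (st [::] [::] (tb (enc_nats (eflat es)) ++ ebody cs)
      (un e.1) (un e.2) [::] [::] [::])
      (2 * size es * (3 * V + tsub V + 2) + (3 * size cs + occs cs * (3 * V + tsub V + 2) + 1))
      (Go (st [::] (rev (tb (enc_nats (eflat es')) ++ ebody cs')) [::]
      (un e.1) (un e.2) [::] [::] [::])).
    rewrite -size_eflat; apply: runs_sub_nums => //; apply: runs_sub_body => //.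
    by rewrite -eflat_sub cats0 -rev_cat; apply: runs_while_end.
  have H4 : runs (transfer _ 1 3) (st [::] (rev (tb (enc_nats (eflat es')) ++ ebody cs')) [::]
      (un e.1) (un e.2) [::] [::] [::])
      (5 * (2 * size es * V.+1 + size cs + occs cs * V.+1) + 1)
      (Go (st [::] [::] (tb (enc_nats (eflat es')) ++ ebody cs')
      (un e.1) (un e.2) [::] [::] [::])).
    apply: runs_le; first apply: runs_eq; first by apply: runs_transfer.
      by rewrite /upd /get /= revK cats0.
    rewrite /get /= size_rev size_cat size_map.
    have := size_enc_nats esV'; rewrite size_eflat size_map.
    have := size_ebody csV'; rewrite occs_sub size_map; lia.
  have H5 : runs (clear _ 7) (st [::] [::] (tb (enc_nats (eflat es')) ++ ebody cs')
      (un e.1) (un e.2) [::] [::] [::]) (3 * V + 1)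
      (Go (st [::] [::] (tb (enc_nats (eflat es')) ++ ebody cs') [::] (un e.2) [::] [::] [::])).
    by apply: runs_le; [apply: runs_clear | rewrite /get /= size_nseq; lia].
  have H6 : runs (clear _ 8) (st [::] [::] (tb (enc_nats (eflat es')) ++ ebody cs')
      [::] (un e.2) [::] [::] [::]) (3 * V + 1)
      (Go (st [::] [::] (tb (enc_nats (eflat es')) ++ ebody cs') [::] [::] [::] [::] [::])).
    by apply: runs_le; [apply: runs_clear | rewrite /get /= size_nseq; lia].
  apply: runs_le.
    exact: (runs_seqD H1 (runs_seqD H2 (runs_seqD H3 (runs_seqD H4 (runs_seqD H5 H6))))).
  rewrite /tround; lia.
apply: runs_le; first apply: (runs_whileD _ Hb H).
  by rewrite /get /= enc_nats_cons map_cat /enc_nat; case: (e.1).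
rewrite -sE [X in _ <= X + _]mulSn.
(* Later rounds have fewer equations left to rewrite; every round is charged the cost of the
   first. *)
have mono s : tround V (2 * s) (size cs) (occs cs) <= tround V (2 * s.+1) (size cs) (occs cs).
  by rewrite /tround; lia.
have le := mono (size es).
have : size es * (tround V (2 * size es) (size cs) (occs cs)).+1 <=
   size es * (tround V (2 * (size es).+1) (size cs) (occs cs)).+1 by rewrite leq_mul2l ltnS le orbT.
lia.
Qed.

End Core.
End Subst.

(** * Simulating the machine for CSP(A) *)

Section Run.
Variables (D NR : nat) (M : TM) (arity : nat -> nat).
Notation G := (tok D NR M).
Notation prog := (prog G).
Notation tb := (map (@TB D NR M)).
Definition ti (b : bool) : G := TA (@inj M b).

(** Restores the arity that [econ] drops. Tokens are taken from last to first, and pushing puts the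
    final letter on top, so the code of a symbol is listed backwards. *)
Definition untok (t : G) : seq G :=
  match t with
  | TB b => [:: ti b]
  | TS i => rev (map ti (enc_nat i ++ enc_nat (arity i)))
  | _ => [::]
  end.

(** The tape of the simulated machine is built from its right end: the constraints, then their
    number, then the number of variables, each of these two after its terminating [false]. *)
Definition unparse : prog := Seq (transfer _ 3 1) (Seq (map_move 1 untok 13)
  (Seq (Push 13 (ti false)) (Seq (map_move 2 (fun=> [:: ti true]) 13)
  (Seq (Push 13 (ti false)) (map_move 4 (fun=> [:: ti true]) 13))))).

Definition max_untok := \max_(a : G) size (untok a).

Section Unparse.
Variables (a5 a6 a7 a8 a9 a10 a11 a12 : seq G) (rest : store G).
Notation st ou cn w nw r :=
  [:: [::], ou, cn, w, nw, a5, a6, a7, a8, a9, a10, a11, a12, r & rest].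

Lemma rev_flatten_rev (g : G -> seq G) l :
  rev (flatten (map g (rev l))) = flatten (map (fun a => rev (g a)) l).
Proof.
elim: l => //= a l IH.
by rewrite rev_cons map_rcons -cats1 flatten_cat rev_cat IH /= cats0.
Qed.

Lemma flatten_ti x : flatten (map (fun=> [:: ti true]) (@un D NR M x)) = map ti (nseq x true).
Proof. by elim: x => //= x ->. Qed.

Lemma untok_ebody cs : all (fun c => (c.1 < NR) && (size c.2 == arity c.1)) cs ->
  rev (flatten (map untok (rev (ebody cs)))) = map ti (flatten (map enc_con cs)).
Proof.
rewrite rev_flatten_rev; elim: cs => // c cs IH /andP[/andP[cN /eqP sc] /IH {}IH].
rewrite ebody_cons map_cat flatten_cat IH.
have -> : flatten (map enc_con (c :: cs)) = enc_con c ++ flatten (map enc_con cs) by [].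
rewrite [RHS]map_cat; congr cat; rewrite /econ /= revK inordK; last exact: ltnW.
rewrite /enc_con -sc !enc_nats_cons (catA (enc_nat c.1)) [RHS]map_cat.
congr cat.
by elim: (enc_nats c.2) => //= b bs ->.
Qed.

Lemma ti_enc x l : map ti (enc_nat x) ++ l = map ti (nseq x true) ++ ti false :: l.
Proof. by rewrite /enc_nat map_cat -catA. Qed.

Definition tunp z m n := 5 * z + 1 + ((max_untok + 4) * z + 1) + 1 + (5 * m + 1) + 1 + (5 * n + 1).

Lemma runs_unparse n cs : all (fun c => (c.1 < NR) && (size c.2 == arity c.1)) cs ->
  runs unparse (st [::] (un (size cs)) (ebody cs) (un n) [::])
    (tunp (size (@ebody D NR M cs)) (size cs) n)
    (Go (st [::] [::] [::] [::] (map ti (enc_inst (Inst n cs))))).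
Proof.
move=> csw.
have H1 : runs (transfer _ 3 1) (st [::] (un (size cs)) (ebody cs) (un n) [::])
    (5 * size (@ebody D NR M cs) + 1)
    (Go (st (rev (ebody cs)) (un (size cs)) [::] (un n) [::])).
  apply: runs_eq; first by apply: runs_transfer.
  by rewrite /upd /get /= cats0.
set X := map ti (flatten (map enc_con cs)).
have H2 : runs (map_move 1 untok 13) (st (rev (ebody cs)) (un (size cs)) [::] (un n) [::])
    ((max_untok + 4) * size (@ebody D NR M cs) + 1)
    (Go (st [::] (un (size cs)) [::] (un n) X)).
  apply: runs_le; first apply: runs_eq; first apply: (runs_map_move (K := max_untok)) => //.
  - by move=> a; apply: (leq_bigmax a).
  - by rewrite /upd /get /= cats0 untok_ebody.
  - by rewrite /get /= size_rev.
have H3 : runs (Push 13 (ti false)) (st [::] (un (size cs)) [::] (un n) X) 1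
    (Go (st [::] (un (size cs)) [::] (un n) (ti false :: X))) by exact: runs_push1.
have H4 : runs (map_move 2 (fun=> [:: ti true]) 13)
    (st [::] (un (size cs)) [::] (un n) (ti false :: X)) (5 * size cs + 1)
    (Go (st [::] [::] [::] (un n) (map ti (enc_nat (size cs)) ++ X))).
  apply: runs_le; first apply: runs_eq; first apply: (runs_map_move (K := 1)) => //.
  - by rewrite /upd /get /= flatten_ti -map_rev rev_nseq ti_enc.
  - by rewrite /get /= size_nseq.
have H5 : runs (Push 13 (ti false)) (st [::] [::] [::] (un n) (map ti (enc_nat (size cs)) ++ X)) 1
    (Go (st [::] [::] [::] (un n) (ti false :: map ti (enc_nat (size cs)) ++ X))).
  exact: runs_push1.
have H6 : runs (map_move 4 (fun=> [:: ti true]) 13)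
    (st [::] [::] [::] (un n) (ti false :: map ti (enc_nat (size cs)) ++ X)) (5 * n + 1)
    (Go (st [::] [::] [::] [::] (map ti (enc_inst (Inst n cs))))).
  apply: runs_le; first apply: runs_eq; first apply: (runs_map_move (K := 1)) => //.
  - have -> : map ti (enc_inst (Inst n cs)) =
        map ti (enc_nat n) ++ (map ti (enc_nat (size cs)) ++ X).
      by rewrite enc_inst_con /= (map_cat _ (enc_nat n)) (map_cat _ (enc_nat (size cs))).
    by rewrite (ti_enc n) /upd /get /= flatten_ti -map_rev rev_nseq.
  - by rewrite /get /= size_nseq.
apply: runs_le.
  exact: (runs_seqD H1 (runs_seqD H2 (runs_seqD H3 (runs_seqD H4 (runs_seqD H5 H6))))).
rewrite /tunp; lia.
Qed.

End Unparse.

Definition running (x : option G) := if x is Some (TQ q) then ~~ halting q else false.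

Definition sim_move (m : move) (b : G) : prog :=
  match m with
  | Stay => Push 13 b
  | MoveL => Pop 12 (fun x => if x is Some a then Seq (Push 13 b) (Push 13 a) else Push 13 b)
  | MoveR => Seq (Push 12 b)
      (Pop 13 (fun x => Push 13 (if x is Some a then a else TA (@blank M))))
  end.

Definition sim_step : prog := Pop 14 (fun x => if x is Some (TQ q) then
    Pop 13 (fun y =>
      let: (q', b, m) := delta q (if y is Some (TA a) then a else @blank M) in
      Seq (Push 14 (TQ q')) (sim_move m (TA b)))
  else Skip _).

(** No clock is kept, as the simulated machine halts on every input. Acceptance ends the whole
    program; rejection falls through to the next choice and leaves stacks 12 and 13 to be
    cleared. *)
Definition simulate : prog := Seq (Push 14 (TQ (@q0 M))) (Seq (While 14 running sim_step)
  (Pop 14 (fun x => if x is Some (TQ q) then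
     if accepting q then Halt _ true else Skip _ else Skip _))).

Section Simulate.
Variables (a0 a1 a2 a3 a4 a5 a6 a7 a8 a9 a10 a11 : seq G) (rest : store G).
Notation st l r q := [:: a0, a1, a2, a3, a4, a5, a6, a7, a8, a9, a10, a11, l, r, q & rest].

Definition sst (c : config M) : store G :=
  let: (q, l, a, r) := c in st (map TA l) (map TA (a :: r)) [:: TQ q].

Definition csize (c : config M) := let: (q, l, a, r) := c in size l + size r.

Lemma runs_sim_step c : ~~ halting (cstate c) -> runs sim_step (sst c) 7 (Go (sst (step c))).
Proof.
case: c => [[[q l] a] r]; rewrite /cstate /= => /negPf nh; rewrite nh.
do 2 apply: runs_pop; rewrite /=; case: (delta q a) => [[q' b] m].
apply: runs_le; first apply: (runs_seqD (runs_push1 _ _ _) (T2 := 4)); last by [].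
case: m => /=.
- apply: runs_pop; case: l => [|x l] /=; first exact: runs_push.
  by apply: (runs_seqD (runs_push1 _ _ _) (T2 := 2)); apply: runs_push.
- apply: (runs_seqD (runs_push1 _ _ _) (T2 := 3)); apply: runs_pop.
  by case: r => [|x r]; apply: runs_push.
- exact: runs_push.
Qed.

Lemma csize_step c : csize (step c) <= (csize c).+1.
Proof.
case: c => [[[q l] a] r] /=; case: halting => //; case: (delta q a) => [[q' b] []] /=.
- by case: l => [|x l] /=; lia.
- by case: r => [|x r] /=; lia.
- lia.
Qed.

Lemma csize_reach t c : csize (reach t c) <= csize c + t.
Proof.
elim: t c => [|t IH] c; first by rewrite addn0.
rewrite reachS; apply: leq_trans (IH _) _; have := csize_step c; lia.
Qed.

(** The loop may stop before time [t]; a halted configuration is frozen, so it is still the one at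
    time [t]. *)
Lemma runs_sim_loop t c : halting (cstate (reach t c)) ->
  runs (While 14 running sim_step) (sst c) (8 * t + 1) (Go (sst (reach t c))).
Proof.
have E c' : running (ohead (get (sst c') 14)) = ~~ halting (cstate c').
  by case: c' => [[[q l] a] r].
elim: t c => [|t IH] c; first by move=> h; apply: runs_while_end; rewrite ?E ?h.
case: (boolP (halting (cstate c))) => h.
  by rewrite reach_halt // => _; apply: runs_while_end; [rewrite E h | lia].
rewrite reachS => /IH H; apply: runs_le; first apply: (runs_whileD _ (runs_sim_step h) H).
  by rewrite E.
lia.
Qed.

(** An empty input would need a blank under the head, which stack 13 does not provide; encodings are
    never empty. The remainders [l] and [r] are only bounded, as they are erased next. *)
Lemma runs_simulate t w : 0 < size w ->
  halting (cstate (reach t (@init M w))) ->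
  exists l r, size l + size r <= size w + t /\
  runs simulate (st [::] (map ti w) [::]) (8 * t + 4)
    (if accepting (cstate (reach t (@init M w))) then Stop true else Go (st l r [::])).
Proof.
move=> w0 h.
have [l [r [lr Hl]]] : exists l r, size l + size r <= size w + t /\
    forall o q0 T, q0 = cstate (reach t (@init M w)) ->
    runs (if accepting q0 then Halt G true else Skip G) (st l r [::]) T o ->
    runs (Pop 14 (fun x => if x is Some (TQ q) then
     if accepting q then Halt _ true else Skip _ else Skip _)) (sst (reach t (@init M w))) T.+1 o.
  have := csize_reach t (@init M w).
  case: (reach t _) => [[[q l] a] r] /= cl; exists (map TA l), (map TA (a :: r)).
  split; first rewrite /= !size_map.
    apply: leq_trans (_ : (size w).-1 + t < _); last by lia.
    rewrite addnS ltnS; apply: leq_trans cl _; rewrite leq_add2r /init.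
    by case: w w0 {h} => //= b w _; rewrite size_map.
  by move=> o q1 T -> H; apply: runs_pop.
exists l, r; split=> //.
have H1 : runs (Push 14 (TQ (@q0 M))) (st [::] (map ti w) [::]) 1 (Go (sst (@init M w))).
  case: w w0 {h l r lr Hl} => // b w _; rewrite /init /=.
  by apply: runs_eq; [apply: runs_push1 | rewrite /upd /get /= -map_comp].
have H2 := runs_sim_loop h.
apply: runs_le; first apply: (runs_seqD H1 (runs_seqD H2 (Hl _ _ 1 erefl _))); last by lia.
by case: ifP => _; [apply: runs_halt | apply: runs_skip].
Qed.

End Simulate.
End Run.

(** * Enumerating the choices of disjuncts *)

Section Odometer.
Variable D : nat.

(** Counter in base [D + 1] with the least significant digit first, that is, on top of its stack;
    [None] signals overflow. *)
Fixpoint inc (ch : seq nat) : option (seq nat) :=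
  if ch is d :: l then if d == D then omap (cons 0) (inc l) else Some (d.+1 :: l) else None.

Fixpoint value (ch : seq nat) : nat := if ch is d :: l then d + D.+1 * value l else 0.

Definition choice_ok (k : nat) ch := (size ch == k) && all (fun d => d <= D) ch.

Lemma value_lt ch : all (fun d => d <= D) ch -> value ch < D.+1 ^ size ch.
Proof. by elim: ch => //= d l IH /andP[dD /IH]; rewrite expnS; nia. Qed.

Lemma value_inj k ch ch' : choice_ok k ch -> choice_ok k ch' -> value ch = value ch' -> ch = ch'.
Proof.
move=> /andP[/eqP <- +] /andP[/eqP + +].
elim: ch ch' => [|d l IH] [|d' l'] //= /andP[dD lD] [sl] /andP[dD' lD'] E.
have [ed el] : d = d' /\ value l = value l'.
  have := congr1 (fun x => x %% D.+1) E; have := congr1 (fun x => x %/ D.+1) E.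
  rewrite !(addnC _ (_ * _)) !(mulnC D.+1) !divnMDl // !modnMDl.
  by rewrite !divn_small // !modn_small // !addn0.
by rewrite ed (IH l').
Qed.

Lemma inc_some k ch ch' : choice_ok k ch -> inc ch = Some ch' ->
  choice_ok k ch' /\ value ch' = (value ch).+1.
Proof.
move=> /andP[/eqP <-] {k}; elim: ch ch' => //= d l IH ch' /andP[dD lD].
case: eqP => [->|/eqP nd].
  case E : (inc l) => [l'|] //= [<-]; have [/andP[/eqP sl lD'] v] := IH _ lD E.
  by rewrite /choice_ok /= sl eqxx lD' /= v; split=> //; lia.
by case=> <-; rewrite /choice_ok /= eqxx lD andbT ltn_neqAle nd dD.
Qed.

Lemma inc_none ch : all (fun d => d <= D) ch -> inc ch = None -> (value ch).+1 = D.+1 ^ size ch.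
Proof.
elim: ch => //= d l IH /andP[dD lD]; case: eqP => // ->.
by case E : (inc l) => [//|] _; rewrite expnS -IH //; lia.
Qed.

Lemma choice_decomp ch : all (fun d => d <= D) ch -> exists j l, ch = nseq j D ++ l /\
  (l = [::] \/ exists d l', l = d :: l' /\ d < D).
Proof.
elim: ch => [|d l IH] /=; first by exists 0, [::]; split=> //; left.
case/andP; rewrite leq_eqVlt => /orP[/eqP ->|dD] /IH [j [l' [-> H]]].
  by exists j.+1, l'.
by exists 0, (d :: nseq j D ++ l'); split=> //; right; exists d, (nseq j D ++ l').
Qed.

Lemma inc_max j d l : d < D -> inc (nseq j D ++ d :: l) = Some (nseq j 0 ++ d.+1 :: l).
Proof. by move=> dD; elim: j => [|j IH] /=; [rewrite ltn_eqF | rewrite eqxx IH]. Qed.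

Lemma inc_all_max j : inc (nseq j D) = None.
Proof. by elim: j => //= j ->; rewrite eqxx. Qed.

Variables (NR : nat) (M : TM).
Notation G := (tok D NR M).
Notation prog := (prog G).

Definition is_max (x : option G) := if x is Some (TD d) then d == D :> nat else false.

(** The leading digits equal to [D] are popped and counted in unary on the scratch stack, the next
    digit is incremented, and as many zeros are pushed back. If no digit remains, all choices have
    failed and the program rejects. *)
Definition odometer : prog := Seq (While 15 is_max (Pop 15 (fun=> Push 0 (TB true))))
  (Seq (Pop 15 (fun x => if x is Some (TD d) then Push 15 (TD (inord d.+1)) else Halt _ false))
       (map_move 0 (fun=> [:: TD ord0]) 15)).

Lemma flatten_const (X Y : Type) (x : X) (y : Y) n :
  flatten (map (fun=> [:: x]) (nseq n y)) = nseq n x.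
Proof. by elim: n => //= n ->. Qed.

Section Core.
Variables a1 a2 a3 a4 a5 a6 a7 a8 a9 a10 a11 a12 a13 a14 : seq G.
Variable rest : store G.
Notation st t1 ch :=
  [:: t1, a1, a2, a3, a4, a5, a6, a7, a8, a9, a10, a11, a12, a13, a14, ch & rest].

Lemma runs_max_loop j l t : is_max (ohead l) = false ->
  runs (While 15 is_max (Pop 15 (fun=> Push 0 (TB true))))
    (st (un t) (nseq j (TD (inord D)) ++ l)) (3 * j + 1) (Go (st (un (j + t)) l)).
Proof.
move=> hl; elim: j t => [|j IH] t; first exact: runs_while_end.
have H := IH t.+1; rewrite (addnS j) in H.
apply: runs_le; first apply: (runs_whileD (T1 := 2) _ _ H) => //.
- by rewrite /get /= inordK.
- by apply: runs_pop; apply: runs_push1.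
- lia.
Qed.

Lemma runs_odometer ch : all (fun d => d <= D) ch ->
  runs odometer (st [::] (digits ch)) (9 * size ch + 5)
    (if inc ch is Some ch' then Go (st [::] (digits ch')) else Stop false).
Proof.
case/choice_decomp=> j [l [-> H]].
have hl : is_max (ohead (digits l)) = false.
  case: H => [->|[d [l' [-> dD]]]] //=; rewrite inordK ?ltn_eqF //; lia.
have H1 := runs_max_loop j 0 hl; rewrite addn0 in H1.
rewrite /digits map_cat map_nseq size_cat size_nseq.
case: H hl H1 => [->|[d [l' [-> dD]]]] _ H1.
  rewrite cats0 inc_all_max; apply: runs_le; first apply: (runs_seqD H1 (T2 := 1)); last by lia.
  by apply: runs_seq_stop; apply: runs_pop; apply: (runs_halt _ _ 0).
rewrite inc_max //; apply: runs_le; first apply: (runs_seqD H1).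
  apply: runs_seqD; first by apply: runs_pop; apply: runs_push1.
  apply: runs_eq; first by apply: (runs_map_move (K := 1)).
  rewrite /upd /get /= inordK; last by lia.
  rewrite map_cat map_nseq /=.
  have -> : inord 0 = ord0 :> 'I_D.+1 by apply: val_inj; rewrite /= inordK.
  rewrite flatten_const rev_nseq.
  by [].
by rewrite /get /= size_nseq; lia.
Qed.

End Core.
End Odometer.

(** * The main loop *)

Section Main.
Variables (T : Type) (A B : structure T) (Dj : nat -> seq disj) (D : nat) (M : TM).
Variables (K c0 : nat).
Notation AB := (sunion A B).
Notation NR := (nrel A + nrel B).
Notation G := (tok D NR M).
Notation prog := (prog G).
Notation tb := (map (@TB D NR M)).
Hypothesis arK : forall i, i < NR -> ar AB i <= K.
Hypothesis DjP : forall i, i < nrel B -> defines A (ar B i) (Dj i) (rel B i).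
Hypothesis DjK : forall i d, i < nrel B -> d \in Dj i ->
  [&& ne d <= K, size (eqs d) <= K, size (ats d) <= K
    & all (fun a : constr => size a.2 <= K) (ats d)].
Hypothesis DjD : forall i, i < nrel B -> size (Dj i) <= D.
Hypothesis MP : forall w, decides_within M w ((size w).+1 ^ c0) (CSP A w).

(** One choice is tried on copies of stacks 15, 16 and 17. If the round does not stop, all working
    stacks are empty again at its end, and the store has changed only in the digits. *)
Definition body : prog :=
  Seq (copy _ 0 17 3) (Seq (copy _ 0 15 5) (Seq (copy _ 0 16 4)
  (Seq (elim_loop A B Dj D M) (Seq (transfer _ 1 3) (Seq (transfer _ 6 3)
  (Seq (eq_loop _ _ _) (Seq (unparse _ _ _ (ar AB)) (Seq (simulate _ _ _)
  (Seq (clear _ 12) (Seq (clear _ 13) (Seq (clear _ 5) (odometer _ _ _)))))))))))).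

Lemma elim_size nv cs ch nv' es cs' : all (cwf AB nv) cs ->
  elim A Dj nv cs ch = Some (nv', (es, cs')) ->
  [/\ nv' <= nv + size cs * K, size es <= K * size cs & size cs' <= K.+1 * size cs].
Proof.
elim: cs nv ch nv' es cs' => [|c cs IH] nv ch nv' es cs' /=.
  by move=> _ [<- <- <-]; rewrite !addn0.
case/andP=> cw csw; case: ltnP => cA.
  case E : (elim _ _ _ _) => [[n [e k]]|] //= [<- <- <-].
  by have [l1 l2 l3] := IH _ _ _ _ _ csw E; rewrite !mulnS mulSn; split=> /=; lia.
case: ch => // d ch; case DE : (Dj _) => [//|d0 ds].
set E := pick_disj _ _ _; case Ee : (elim _ _ _ _) => [[n [e k]]|] //= [<- <- <-].
have [|l1 l2 l3] := IH _ _ _ _ _ _ Ee.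
  by apply: sub_all csw => x; apply: cwfW; apply: leq_addr.
have [cB _ _] := cwf_alien cw cA.
have Dn : Dj (c.1 - nrel A) <> [::] by rewrite DE.
have /and4P[nK eK aK _] := DjK cB (pick_disj_mem d Dn).
rewrite -/E in nK eK aK.
by rewrite !size_cat !size_map !mulnS mulSn; split; lia.
Qed.

Lemma cwf_K n c : cwf A n c -> size c.2 <= K.
Proof.
case/and3P=> cA /eqP -> _; have /arK : c.1 < NR by apply: ltn_addr.
by rewrite /= cA.
Qed.

Lemma cwf_le n c : cwf A n c -> all (fun x => x <= n) c.2.
Proof. by case/and3P=> _ _; apply: sub_all => x; apply: ltnW. Qed.

Lemma occs_le cs : all (fun c : constr => size c.2 <= K) cs -> occs cs <= K * size cs.
Proof. by elim: cs => //= c cs IH /andP[cK /IH]; rewrite /occs /= mulnS; lia. Qed.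

Lemma occs_wf n cs : all (cwf A n) cs -> occs cs <= K * size cs.
Proof. by move=> H; apply: occs_le; apply: sub_all H => c; apply: cwf_K. Qed.

Lemma size_enc_inst n cs V : all (cwf A n) cs -> n <= V ->
  size (enc_inst (Inst n cs)) <= V + 2 + size cs * (NR + K + 3) + occs cs * V.+1.
Proof.
move=> H nV; rewrite enc_inst_con !size_cat /enc_nat ?size_cat ?size_nseq /=.
suff : size (flatten (map enc_con cs)) <= size cs * (NR + K + 2) + occs cs * V.+1 by lia.
elim: cs H => // c cs IH /andP[cw /IH l].
have -> : flatten (map enc_con (c :: cs)) = enc_con c ++ flatten (map enc_con cs) by [].
rewrite size_cat.
have cK := cwf_K cw; have cN : c.1 <= NR by case/and3P: cw; lia.
have cV : all (fun x => x <= V) c.2.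
  by apply: sub_all (cwf_le cw) => x /leq_trans; apply.
have := size_enc_nats cV; rewrite {1}/enc_con !enc_nats_cons !size_cat.
rewrite /enc_nat ?size_cat ?size_nseq /=.
rewrite /occs /= -/(occs cs) mulnDl mulSn; lia.
Qed.

Definition reduct (r : nat * (seq (nat * nat) * seq constr)) : instance :=
  Inst r.1 (solve (size r.2.1) r.2.1 r.2.2).
Definition tA z := z.+1 ^ c0.
Definition accepts r :=
  let w := enc_inst (reduct r) in accepting (cstate (reach (tA (size w)) (@init M w))).

(* For an input of size [N], these bound the numbers of variables, constraints and
   variable occurrences, the number of tokens and the length of the encoding of an
   instance of CSP(A) produced for one choice. *)
Definition bV N := N + N * K.
Definition bM N := K.+1 * N.
Definition bO N := K * bM N.
Definition bB N := bM N + bO N * (bV N).+1.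
Definition bI N := bV N + 2 + bM N * (NR + K + 3) + bO N * (bV N).+1.

Definition tbody N := 3 * (10 * N + 2) + (N * tstep K (bV N) + 1) + (5 * bB N + 1) +
  (5 * (2 * (K * N) * (bV N).+1) + 1) +
  (K * N * (tround (bV N) (2 * (K * N)) (bM N) (bO N)).+1 + 1) +
  tunp D NR M (ar AB) (bB N) (bM N) (bV N) + (8 * tA (bI N) + 4) +
  2 * (3 * (bI N + tA (bI N)) + 1) + (3 * N + 1) + (9 * N + 5).

Lemma tA_le m n : m <= n -> tA m <= tA n.
Proof. by rewrite /tA; case: c0 => // c l; rewrite leq_exp2r. Qed.

Lemma tround_le V s m k s' m' k' : s <= s' -> m <= m' -> k <= k' ->
  tround V s m k <= tround V s' m' k'.
Proof.
move=> ls lm lk; rewrite /tround.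
have H1 X : s * X <= s' * X by rewrite leq_mul2r ls orbT.
have H2 X : k * X <= k' * X by rewrite leq_mul2r lk orbT.
have := H1 (3 * V + tsub V + 2); have := H2 (3 * V + tsub V + 2).
have := H1 V.+1; have := H2 V.+1; lia.
Qed.

Lemma tunp_le z m n z' m' n' : z <= z' -> m <= m' -> n <= n' ->
  tunp D NR M (ar AB) z m n <= tunp D NR M (ar AB) z' m' n'.
Proof.
move=> lz lm ln; rewrite /tunp.
have : (max_untok D NR M (ar AB) + 4) * z <= (max_untok D NR M (ar AB) + 4) * z'.
  by rewrite leq_mul2l lz orbT.
lia.
Qed.

Variables (nv : nat) (cs : seq constr).
Hypothesis csw : all (cwf AB nv) cs.

Definition mst ch : store G := [:: [::], [::], [::], [::], [::], [::], [::], [::], [::], [::],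
  [::], [::], [::], [::], [::], digits ch, un nv, ebody cs & uns A B D M (K + K) [::]].

Lemma runs_body (k N : nat) ch : choice_ok D k ch -> nv <= N -> size cs <= N -> k <= N ->
  size (@ebody D NR M cs) <= N ->
  runs body (mst ch) (tbody N)
    (if elim A Dj nv cs ch is Some r then
       if accepts r then Stop true
       else if inc D ch is Some ch' then Go (mst ch') else Stop false
     else Stop false).
Proof.
move=> /andP[/eqP sk chD] nvN mN kN bN.
rewrite /body /mst; set env := uns _ _ _ _ _ _; set cd := digits ch.
have sd : size cd = k by rewrite size_map.
have H1 : runs (copy _ 0 17 3) [:: [::], [::], [::], [::], [::], [::], [::], [::], [::], [::],
     [::], [::], [::], [::], [::], cd, un nv, ebody cs & env] (10 * N + 2)
  (Go [:: [::], [::], [::], ebody cs, [::], [::], [::], [::], [::], [::],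
     [::], [::], [::], [::], [::], cd, un nv, ebody cs & env]).
  apply: runs_le; first apply: runs_eq; first by apply: runs_copy.
    by rewrite /upd /get /= cats0.
  by rewrite /get /=; lia.
have H2 : runs (copy _ 0 15 5) [:: [::], [::], [::], ebody cs, [::], [::], [::], [::], [::], [::],
     [::], [::], [::], [::], [::], cd, un nv, ebody cs & env] (10 * N + 2)
  (Go [:: [::], [::], [::], ebody cs, [::], cd, [::], [::], [::], [::],
     [::], [::], [::], [::], [::], cd, un nv, ebody cs & env]).
  apply: runs_le; first apply: runs_eq; first by apply: runs_copy.
    by rewrite /upd /get /= cats0.
  by rewrite /get /=; lia.
have H3 : runs (copy _ 0 16 4) [:: [::], [::], [::], ebody cs, [::], cd, [::], [::], [::], [::],
     [::], [::], [::], [::], [::], cd, un nv, ebody cs & env] (10 * N + 2)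
  (Go [:: [::], [::], [::], ebody cs, un nv, cd, [::], [::], [::], [::],
     [::], [::], [::], [::], [::], cd, un nv, ebody cs & env]).
  apply: runs_le; first apply: runs_eq; first by apply: runs_copy.
    by rewrite /upd /get /= cats0.
  by rewrite /get /= size_nseq; lia.
have lV : nv + size cs * K <= bV N by rewrite /bV leq_add // leq_mul.
have := runs_elim_loop [::] [::] [::] [::] [::] [::] [::] [::] cd (un nv) (ebody cs)
  arK DjP DjK (leqnn _) [::] 0 [::] csw chD lV.
have lT : size cs * tstep K (bV N) + 1 <= N * tstep K (bV N) + 1 by rewrite leq_add2r leq_mul.
case E : (elim _ _ _ _ _) => [[nv' [es cs']]|] H4; last first.
  apply: runs_le; first apply: (runs_seqD H1); first apply: (runs_seqD H2);
    first apply: (runs_seqD H3); first by apply: runs_seq_stop H4.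
  rewrite /tbody; lia.
have [n_l e_l c_l] := elim_size csw E.
have [nv_l esw csw'] := elim_wf DjP csw E.
set cd' := digits (drop _ _) in H4.
rewrite !cats0 addn0 in H4.
have nvV : nv' <= bV N by lia.
have csM : size cs' <= bM N.
  by rewrite /bM; apply: leq_trans c_l _; rewrite leq_mul.
have esN : size es <= K * N by apply: leq_trans e_l _; rewrite leq_mul.
have csO : occs cs' <= bO N.
  by rewrite /bO; apply: leq_trans (occs_wf csw') _; rewrite leq_mul.
have cleV n (l : seq constr) : n <= bV N -> all (cwf A n) l ->
    all (fun c => all (fun x => x <= bV N) c.2) l.
  move=> nV H; apply: sub_all H => c /cwf_le; apply: sub_all => x /leq_trans; exact.
have ebN (l : seq constr) : all (cwf A nv') l -> size l <= bM N -> occs l <= bO N ->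
    size (@ebody D NR M l) <= bB N.
  move=> lw ll lo; apply: leq_trans (size_ebody _ _ _ (cleV _ _ nvV lw)) _.
  by rewrite /bB leq_add // leq_mul.
have esV : all (fun x => x <= bV N) (eflat es).
  have : all (fun x => x < nv') (eflat es) by rewrite all_eflat.
  by apply: sub_all => x; lia.
have H5 : runs (transfer _ 1 3) [:: [::], rev (ebody cs'), un (size cs'), [::], un nv', cd',
     rev (tb (enc_nats (eflat es))), [::], [::], [::],
     [::], [::], [::], [::], [::], cd, un nv, ebody cs & env] (5 * bB N + 1)
  (Go [:: [::], [::], un (size cs'), ebody cs', un nv', cd',
     rev (tb (enc_nats (eflat es))), [::], [::], [::],
     [::], [::], [::], [::], [::], cd, un nv, ebody cs & env]).
  apply: runs_le; first apply: runs_eq; first by apply: runs_transfer.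
    by rewrite /upd /get /= revK cats0.
  by rewrite /get /= size_rev leq_add2r leq_mul // ebN.
have H6 : runs (transfer _ 6 3) [:: [::], [::], un (size cs'), ebody cs', un nv', cd',
     rev (tb (enc_nats (eflat es))), [::], [::], [::],
     [::], [::], [::], [::], [::], cd, un nv, ebody cs & env]
     (5 * (2 * (K * N) * (bV N).+1) + 1)
  (Go [:: [::], [::], un (size cs'), tb (enc_nats (eflat es)) ++ ebody cs', un nv', cd',
     [::], [::], [::], [::],
     [::], [::], [::], [::], [::], cd, un nv, ebody cs & env]).
  apply: runs_le; first apply: runs_eq; first by apply: runs_transfer.
    by rewrite /upd /get /= revK.
  rewrite /get /= size_rev leq_add2r leq_mul // size_map.
  apply: leq_trans (size_enc_nats esV) _; rewrite size_eflat leq_mul // leq_mul //.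
have H7 := @runs_eq_loop D NR M (un (size cs')) (un nv') cd' [::]
  [:: [::], [::], [::], cd, un nv, ebody cs & env] (bV N) es cs' esV (cleV _ _ nvV csw').
set sol := solve (size es) es cs' in H7.
have solw : all (cwf A nv') sol by apply: solve_wf.
have solM : size sol = size cs' by apply: size_solve.
have solO : occs sol <= bO N.
  by apply: leq_trans (occs_wf solw) _; rewrite solM /bO leq_mul.
have solB : size (@ebody D NR M sol) <= bB N by apply: ebN; rewrite ?solM.
have H8 := @runs_unparse D NR M (ar AB) cd' [::] [::] [::] [::] [::] [::] [::]
  [:: [::], cd, un nv, ebody cs & env] nv' sol.
rewrite solM in H8.
have {}H8 := H8 _; have H8' : all (fun c : constr => (c.1 < NR) && (size c.2 == ar AB c.1)) sol.
  apply: sub_all solw => c /and3P[c1 c2 _]; rewrite (ltn_addr _ c1) /= c1 c2 //.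
have {}H8 := H8 H8'.
have [h _] := MP (enc_inst (Inst nv' sol)); rewrite -/(tA _) -/(reach _ _) in h.
have w0 : 0 < size (enc_inst (Inst nv' sol)).
  by rewrite enc_inst_con !size_cat /enc_nat ?size_cat /=; lia.
have wI : size (enc_inst (Inst nv' sol)) <= bI N.
  apply: leq_trans (size_enc_inst solw nvV) _; rewrite /bI.
  by rewrite leq_add // ?leq_mul // leq_add2l leq_mul // solM.
have tI : tA (size (enc_inst (Inst nv' sol))) <= tA (bI N) by apply: tA_le.
have [l [r [lr H9]]] := @runs_simulate D NR M [::] [::] [::] [::] [::] cd' [::] [::]
  [::] [::] [::] [::] [:: cd, un nv, ebody cs & env] _ _ w0 h.
have lT7 : size es * (tround (bV N) (2 * size es) (size cs') (occs cs')).+1 + 1 <=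
    K * N * (tround (bV N) (2 * (K * N)) (bM N) (bO N)).+1 + 1.
  by rewrite leq_add2r leq_mul // ltnS tround_le // leq_mul.
have lT8 : tunp D NR M (ar AB) (size (@ebody D NR M sol)) (size cs') nv' <=
    tunp D NR M (ar AB) (bB N) (bM N) (bV N) by apply: tunp_le.
(* The remaining outcomes share all stages before the simulation; [pre] prepends these to the rest
   of the run. *)
have pre o t : runs (Seq (simulate D NR M)
  (Seq (clear _ 12) (Seq (clear _ 13) (Seq (clear _ 5) (odometer D NR M)))))
  [:: [::], [::], [::], [::], [::], cd', [::], [::], [::], [::], [::], [::], [::],
     map (@ti D NR M) (enc_inst (Inst nv' sol)), [::], cd, un nv, ebody cs & env] t o ->
  t <= 8 * tA (bI N) + 4 + 2 * (3 * (bI N + tA (bI N)) + 1) + (3 * N + 1) + (9 * N + 5) ->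
  runs body [:: [::], [::], [::], [::], [::], [::], [::], [::], [::], [::], [::], [::], [::],
     [::], [::], cd, un nv, ebody cs & env] (tbody N) o.
  move=> H lt; apply: runs_le.
    exact: (runs_seqD H1 (runs_seqD H2 (runs_seqD H3 (runs_seqD H4 (runs_seqD H5
      (runs_seqD H6 (runs_seqD H7 (runs_seqD H8 H)))))))).
  rewrite /tbody; lia.
rewrite /accepts /= -/sol; case: ifP H9 => _ H9.
  by apply: pre; first apply: runs_seq_stop H9; lia.
apply: pre; first apply: (runs_seqD H9).
  apply: runs_seqD; first by apply: runs_clear.
  apply: runs_seqD; first by apply: runs_clear.
  apply: runs_seqD; first by apply: runs_clear.
  exact: runs_odometer.
rewrite /get /= [size cd']size_map size_drop sk.
move: lr tI wI kN.
move: (size l) (size r) (count _ _) (bI N) (size (enc_inst _)) (tA (size _)) (tA (bI N)).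
by clear => *; lia.
Qed.

Definition good ch := exists r, elim A Dj nv cs ch = Some r /\ sat_inst A (reduct r).

Lemma reduct_wf ch r : elim A Dj nv cs ch = Some r -> wf_inst A (reduct r).
Proof.
by case: r => [n [e k]] /(elim_wf DjP csw) [_ ew kw]; apply: solve_wf.
Qed.

(** The language speaks of some instance with the given encoding; parsing shows that it can only be
    [J]. *)
Lemma CSP_enc (J : instance) : wf_inst A J -> CSP A (enc_inst J) <-> sat_inst A J.
Proof.
move=> Jw; split=> [[J' [E [Jw' Js]]]|Js]; last by exists J.
have := @parse_enc (nrel A) (ar A) _ Jw; rewrite E (parse_enc Jw') => -[<-].
by [].
Qed.

Lemma accepts_good ch r : elim A Dj nv cs ch = Some r -> accepts r <-> good ch.
Proof.
move=> E; have [_ acc] := MP (enc_inst (reduct r)); rewrite /accepts /tA acc.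
rewrite CSP_enc; last exact: reduct_wf E.
by split=> [H|[r' [E' H]]]; [exists r | move: E'; rewrite E => -[->]].
Qed.

(** A solution of the reduct extends to the eliminated equations and is then cut down to the
    original variables, which come first. *)
Lemma good_sat ch : good ch -> count (alien A) cs <= size ch /\ sat_inst AB (Inst nv cs).
Proof.
case=> -[n [e k]] [E S]; have [l ew kw] := elim_wf DjP csw E; split; first exact: elim_count E.
have [s ss Ssat] : exists2 s, size s = n & sys_sat A s e k.
  by apply/(solve_sat (erefl _) ew kw); case: S => s [ss Hs]; exists s.
exists (take nv s); split; first by rewrite size_takel // ss.
move=> c ccs; have := elim_sound DjP csw E ss Ssat ccs.
rewrite -{1}(cat_take_drop nv s) /csat pmap_onth_catl //.
by have /and3P[_ _] := allP csw _ ccs; rewrite size_takel // ss.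
Qed.

Lemma sat_good k : count (alien A) cs <= k -> sat_inst AB (Inst nv cs) ->
  exists2 ch, choice_ok D k ch & good ch.
Proof.
move=> ck [s [ss Ssat]].
have [ch [n [e [c' [u [sch chD E su Su]]]]]] := elim_complete DjP DjD csw ss Ssat ck.
exists ch; first by rewrite /choice_ok sch eqxx.
exists (n, (e, c')); split=> //; have [l ew kw] := elim_wf DjP csw E.
have [s' ss' Hs'] : exists2 s, size s = n & forall c, c \in solve (size e) e c' -> csat A s c.
  by apply/(solve_sat (erefl _) ew kw); exists (s ++ u).
by exists s'.
Qed.

Definition main_loop : prog := While 0 (fun=> true) body.

(** [n] bounds the number of rounds still to come. The invariant says that all choices of smaller
    [value] have failed and that [n] reaches from the current value to [D.+1 ^ k]. *)
Lemma runs_main_loop (k N n : nat) ch : choice_ok D k ch ->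
  nv <= N -> size cs <= N -> k <= N -> size (@ebody D NR M cs) <= N ->
  D.+1 ^ k <= value D ch + n ->
  (forall ch', choice_ok D k ch' -> value D ch' < value D ch -> ~ good ch') ->
  exists b, runs main_loop (mst ch) (n * (tbody N).+1) (Stop b) /\
    (b <-> exists2 ch', choice_ok D k ch' & good ch').
Proof.
move=> + nvN mN kN bN; elim: n ch => [|n IH] ch chk ln before.
  (* [n = 0] is impossible: a choice of length [k] has value below [D.+1 ^ k]. *)
  move: ln; rewrite addn0 leqNgt; case/andP: (chk) => /eqP <- chD.
  by rewrite value_lt.
have := runs_body chk nvN mN kN bN; case E : (elim _ _ _ _ _) => [r|] Hb; last first.
  (* Elimination has failed for a reason independent of the digits, so no choice of length [k] is
     good. *)
  exists false; split.
    by apply: runs_le; [apply: runs_while_stop Hb | rewrite mulSn; lia].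
  split=> // -[ch' /andP[/eqP sch' _] /good_sat [l [s [ss Ssat]]]].
  case/andP: chk => /eqP sch _.
  by case: (elim_none_unsat DjP csw E _ ss Ssat); rewrite sch -sch'.
case: ifP Hb => acc Hb.
  exists true; split.
    by apply: runs_le; [apply: runs_while_stop Hb | rewrite mulSn; lia].
  by split=> // _; exists ch => //; apply/(accepts_good E).
have ngood : ~ good ch by move/(accepts_good E); rewrite acc.
case Ei : (inc D ch) Hb => [ch'|] Hb; last first.
  (* The counter overflows, so the current choice has the largest value, [D.+1 ^ k - 1], and every
     other one has been tried before. *)
  exists false; split.
    by apply: runs_le; [apply: runs_while_stop Hb | rewrite mulSn; lia].
  split=> // -[ch' chk' g]; case/andP: (chk) => /eqP sch chD.
  have := inc_none chD Ei; have /andP[/eqP sch' chD'] := chk'.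
  have := value_lt chD'; rewrite sch sch' => l e; rewrite -e ltnS leq_eqVlt in l.
  case/orP: l => [/eqP l|l]; last by case: (before _ chk' l g).
  by case: ngood; rewrite -(value_inj chk' chk l).
have [chk' v] := inc_some chk Ei.
have [||b [Hr bP]] := IH ch' chk'; first by rewrite v; lia.
  move=> ch2 chk2; rewrite v ltnS leq_eqVlt => /orP[/eqP l|]; last exact: before.
  by rewrite (value_inj chk2 chk l).
exists b; split=> //; apply: runs_le; first apply: (runs_whileD _ Hb Hr) => //.
by rewrite mulSn; lia.
Qed.

End Main.

(** * Polynomial bounds and the theorem *)

Definition poly (f : nat -> nat) := exists C e, forall n, f n <= C * n.+1 ^ e.

Lemma poly_const c : poly (fun=> c).
Proof. by exists c, 0 => n; rewrite muln1. Qed.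

Lemma poly_id : poly id.
Proof. by exists 1, 1 => n; rewrite mul1n expn1. Qed.

Lemma poly_add f g : poly f -> poly g -> poly (fun n => f n + g n).
Proof.
move=> [C [e Hf]] [C' [e' Hg]]; exists (C + C'), (e + e') => n; rewrite mulnDl.
by apply: leq_add; [apply: leq_trans (Hf n) _ | apply: leq_trans (Hg n) _];
  rewrite leq_mul2l leq_pexp2l ?orbT // ?leq_addr ?leq_addl.
Qed.

Lemma poly_mul f g : poly f -> poly g -> poly (fun n => f n * g n).
Proof.
move=> [C [e Hf]] [C' [e' Hg]]; exists (C * C'), (e + e') => n.
by rewrite expnD mulnACA leq_mul.
Qed.

Lemma poly_succ f : poly f -> poly (fun n => (f n).+1).
Proof.
move=> /poly_add /(_ (poly_const 1)) [C [e H]]; exists C, e => n.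
by rewrite -addn1; apply: H.
Qed.

Lemma poly_exp f c : poly f -> poly (fun n => f n ^ c).
Proof.
move=> pf; elim: c => [|c [C [e H]]]; first exact: poly_const.
have [C' [e' H']] : poly (fun n => f n * f n ^ c) by apply: poly_mul => //; exists C, e.
by exists C', e' => n; rewrite expnS; apply: H'.
Qed.

Ltac solve_poly := repeat first [exact: poly_const | exact: poly_id | apply: poly_add
  | apply: poly_mul | apply: poly_succ | apply: poly_exp].

(** * The complete program and its running time *)

Section Program.
Variables (T : Type) (A B : structure T) (Dj : nat -> seq disj) (D : nat) (M : TM).
Variables (K c0 : nat).
Notation AB := (sunion A B).
Notation NR := (nrel A + nrel B).
Notation G := (tok D NR M).
Notation prog := (prog G).
Notation tb := (map (@TB D NR M)).
Hypothesis arK : forall i, i < NR -> ar AB i <= K.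
Hypothesis DjP : forall i, i < nrel B -> defines A (ar B i) (Dj i) (rel B i).
Hypothesis DjK : forall i d, i < nrel B -> d \in Dj i ->
  [&& ne d <= K, size (eqs d) <= K, size (ats d) <= K
    & all (fun a : constr => size a.2 <= K) (ats d)].
Hypothesis DjD : forall i, i < nrel B -> size (Dj i) <= D.
Hypothesis MP : forall w, decides_within M w ((size w).+1 ^ c0) (CSP A w).

(** Reading [k] in unary leaves [k] zero digits on stack 15, the first choice. The input is moved
    twice because one transfer reverses it. After parsing, the instance is stored on stacks 16 and
    17 for all rounds. *)
Definition program : prog :=
  Seq (While 0 (@is_true_bit _ _ _) (Pop 0 (fun=> Push 15 (TD ord0))))
  (Seq (Pop 0 (fun=> Skip _)) (Seq (transfer _ 0 1) (Seq (transfer _ 1 3)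
  (Seq (parse_prog D NR M (ar AB)) (Seq (transfer _ 1 17) (Seq (transfer _ 4 16)
  (main_loop A B Dj D M))))))).

Definition tprogram N := 30 * N + 20 + tparse NR K N + (tbody A B D M K c0 N).+1.

Lemma tparse_le m n : m <= n -> tparse NR K m <= tparse NR K n.
Proof.
move=> l; rewrite /tparse.
have : m * (tcon NR K m + 2) <= n * (tcon NR K n + 2).
  by apply: leq_mul => //; rewrite leq_add2r; apply: tcon_le.
lia.
Qed.

Lemma runs_digits k l rest :
  runs (While 0 (@is_true_bit D NR M) (Pop 0 (fun=> Push 15 (TD ord0))))
    [:: un k ++ TB false :: l, [::], [::], [::], [::], [::], [::], [::], [::], [::], [::], [::],
      [::], [::], [::], [::] & rest] (3 * k + 1)
    (Go [:: TB false :: l, [::], [::], [::], [::], [::], [::], [::], [::], [::], [::], [::],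
      [::], [::], [::], digits (nseq k 0) & rest]).
Proof.
have H j c : runs (While 0 (@is_true_bit D NR M) (Pop 0 (fun=> Push 15 (TD ord0))))
    [:: un j ++ TB false :: l, [::], [::], [::], [::], [::], [::], [::], [::], [::], [::], [::],
      [::], [::], [::], nseq c (TD ord0) & rest] (3 * j + 1)
    (Go [:: TB false :: l, [::], [::], [::], [::], [::], [::], [::], [::], [::], [::], [::],
      [::], [::], [::], nseq (j + c) (TD ord0) & rest]).
  elim: j c => [|j IH] c; first exact: runs_while_end.
  have H := IH c.+1; rewrite (addnS j) in H.
  apply: runs_le; first apply: (runs_whileD (T1 := 2) _ _ H) => //; last by lia.
  by apply: runs_pop; apply: runs_push1.
have := H k 0; rewrite addn0 /digits map_nseq.
by have -> : inord 0 = ord0 :> 'I_D.+1 by apply: val_inj; rewrite /= inordK.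
Qed.

Lemma size_ebody_enc cs : size (@ebody D NR M cs) <= size (flatten (map enc_con cs)).
Proof.
elim: cs => // c cs IH; rewrite ebody_cons size_cat.
have -> : flatten (map enc_con (c :: cs)) = enc_con c ++ flatten (map enc_con cs) by [].
rewrite size_cat leq_add // /econ /= size_map {1}/enc_con !enc_nats_cons !size_cat.
by rewrite /enc_nat ?size_cat /=; lia.
Qed.

Lemma CSP_alien_parse k w : CSP_alien A B k w <-> exists J, [/\ parse NR (ar AB) w = Some J,
  count (alien A) (constrs J) <= k & sat_inst AB J].
Proof.
split=> [[J [-> [Jw [Jk Js]]]]|[J [/parse_some [E Jw] Jk Js]]]; exists J; split=> //.
exact: parse_enc.
Qed.

(** Besides the input stack there are 17 fixed stacks and [K + K] for the variables of one alien
    constraint: at most [K] arguments and [K] fresh ones. *)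
Lemma runs_program k w : exists b,
  runs program (start TB (enc_nat k ++ w) (17 + (K + K)))
    (D.+1 ^ k * tprogram (size w + k)) (Stop b) /\ (b <-> CSP_alien A B k w).
Proof.
set N := size w + k; set n := size w.
have NE : N = n + k by [].
have nE : size w = n by [].
have B0 : 0 < D.+1 ^ k by rewrite expn_gt0.
have lT t : t <= D.+1 ^ k * (tbody A B D M K c0 N).+1 ->
    30 * N + 20 + tparse NR K N + t <= D.+1 ^ k * tprogram N.
  by move=> Ht; rewrite /tprogram mulnDr leq_add // leq_pmull.
have pN : tparse NR K n <= tparse NR K N by apply: tparse_le; rewrite /N leq_addr.
have Ekw : start (@TB D NR M) (enc_nat k ++ w) (17 + (K + K)) =
    [:: un k ++ TB false :: tb w, [::], [::], [::], [::], [::], [::], [::], [::], [::], [::],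
      [::], [::], [::], [::], [::], [::], [::] & nseq (K + K) [::]].
  by rewrite /start /enc_nat -catA map_cat tb_nseq.
have H1 := runs_digits k (tb w) [:: [::], [::] & nseq (K + K) [::]].
set cd := digits _ in H1.
have H2 : runs (Pop 0 (fun=> Skip G))
  [:: TB false :: tb w, [::], [::], [::], [::], [::], [::], [::], [::], [::], [::], [::],
      [::], [::], [::], cd, [::], [::] & nseq (K + K) [::]] 2
  (Go [:: tb w, [::], [::], [::], [::], [::], [::], [::], [::], [::], [::], [::],
      [::], [::], [::], cd, [::], [::] & nseq (K + K) [::]]).
  by apply: runs_pop; apply: runs_skip1.
have H3 : runs (transfer _ 0 1)
  [:: tb w, [::], [::], [::], [::], [::], [::], [::], [::], [::], [::], [::],
      [::], [::], [::], cd, [::], [::] & nseq (K + K) [::]] (5 * n + 1)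
  (Go [:: [::], rev (tb w), [::], [::], [::], [::], [::], [::], [::], [::], [::], [::],
      [::], [::], [::], cd, [::], [::] & nseq (K + K) [::]]).
  apply: runs_le; first apply: runs_eq; first by apply: runs_transfer.
    by rewrite /upd /get /= cats0.
  by rewrite /get /= size_map.
have H4 : runs (transfer _ 1 3)
  [:: [::], rev (tb w), [::], [::], [::], [::], [::], [::], [::], [::], [::], [::],
      [::], [::], [::], cd, [::], [::] & nseq (K + K) [::]] (5 * n + 1)
  (Go [:: [::], [::], [::], tb w, [::], [::], [::], [::], [::], [::], [::], [::],
      [::], [::], [::], cd, [::], [::] & nseq (K + K) [::]]).
  apply: runs_le; first apply: runs_eq; first by apply: runs_transfer.
    by rewrite /upd /get /= revK cats0.
  by rewrite /get /= size_rev size_map.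
have H5 := @runs_parse D NR M (ar AB) [:: [::], [::], [::], [::], [::], [::], [::],
      [::], [::], [::], cd, [::], [::] & nseq (K + K) [::]] K arK w [::].
case E : (parse _ _ _) H5 => [J|] H5; last first.
  exists false; split; last by split=> // /CSP_alien_parse [J []]; rewrite E.
  rewrite Ekw; apply: runs_le; first apply: (runs_seqD H1); first apply: (runs_seqD H2);
    first apply: (runs_seqD H3); first apply: (runs_seqD H4); first by apply: runs_seq_stop H5.
  by apply: leq_trans (lT 0 _) => //; rewrite -/n; lia.
have [Ew Jw] := parse_some E.
have eN := size_ebody_enc (constrs J).
have sw : size w = (nv J).+1 + (size (constrs J)).+1 + size (flatten (map enc_con (constrs J))).
  rewrite Ew enc_inst_con !size_cat /enc_nat ?size_cat ?size_nseq /=; lia.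
have H6 : runs (transfer _ 1 17)
  [:: [::], rev (ebody (constrs J)) ++ [::], [::], [::], un (nv J), [::], [::], [::], [::], [::],
      [::], [::], [::], [::], [::], cd, [::], [::] & nseq (K + K) [::]] (5 * n + 1)
  (Go [:: [::], [::], [::], [::], un (nv J), [::], [::], [::], [::], [::],
      [::], [::], [::], [::], [::], cd, [::], ebody (constrs J) & nseq (K + K) [::]]).
  apply: runs_le; first apply: runs_eq; first by apply: runs_transfer.
    by rewrite /upd /get /= !cats0 revK.
  by rewrite /get /= cats0 size_rev leq_add2r leq_mul2l; lia.
have H7 : runs (transfer _ 4 16)
  [:: [::], [::], [::], [::], un (nv J), [::], [::], [::], [::], [::],
      [::], [::], [::], [::], [::], cd, [::], ebody (constrs J) & nseq (K + K) [::]] (5 * n + 1)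
  (Go (mst A B D M K (nv J) (constrs J) (nseq k 0))).
  apply: runs_le; first apply: runs_eq; first by apply: runs_transfer.
    by rewrite /upd /get [rev _]rev_un /= cats0 /mst /uns subn0.
  by rewrite /get /= size_nseq; lia.
have v0 : value D (nseq k 0) = 0 by elim: (k) => //= j ->; rewrite muln0.
have [|||||||b [H8 bP]] := @runs_main_loop _ A B Dj D M K c0 arK DjP DjK MP (nv J) (constrs J) Jw
    k N (D.+1 ^ k) (nseq k 0).
- by rewrite /choice_ok size_nseq eqxx; apply/allP => x /nseqP[->].
- lia.
- lia.
- lia.
- lia.
- by rewrite v0.
- by move=> ch' _; rewrite v0.
exists b; split.
  rewrite Ekw; apply: runs_le.
    exact: (runs_seqD H1 (runs_seqD H2 (runs_seqD H3 (runs_seqD H4 (runs_seqD H5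
      (runs_seqD H6 (runs_seqD H7 H8))))))).
  by apply: leq_trans (lT _ (leqnn _)) => //; rewrite -/n; lia.
rewrite bP CSP_alien_parse; split=> [[ch chk /(good_sat DjP Jw) [ck Js]]|[J' [E' ck Js]]].
  by exists J; split=> //; case/andP: chk => /eqP <-.
by move: E' ck Js; rewrite E => -[<-] ck Js; apply: sat_good Js => //; case: (J) Jw.
Qed.

Lemma poly_tprogram : poly tprogram.
Proof.
rewrite /tprogram /tbody /tparse /tcon /tstep /telim /tround /tsub /tunp /tA /bI /bB /bO /bM /bV.
solve_poly.
Qed.

Lemma in_FPT_program : in_FPT (CSP_alien A B).
Proof.
have [N NP] := runs_TM TB program.
have [C [e HP]] : poly (fun n => (tprogram n).+1 * (2 * (n + 1 + tprogram n) + 3) + 1).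
  by have p := poly_tprogram; solve_poly.
exists N, (fun k => (D.+1 ^ k) ^ 2 * (C * k.+1 ^ e)), e => k w.
have [b [R bP]] := runs_program k w.
set P := tprogram (size w + k) in R; set Bk := D.+1 ^ k in R *.
have [|h a] := NP _ _ _ _ R (Bk ^ 2 * (C * k.+1 ^ e) * (size w).+1 ^ e).
  have B0 : 0 < Bk by rewrite expn_gt0.
  have le1 : C * (size w + k).+1 ^ e <= C * k.+1 ^ e * (size w).+1 ^ e.
    rewrite -mulnA leq_mul2l -expnMn; apply/orP; right.
    case: (e) => [|e']; first by rewrite !expn0.
    by rewrite leq_exp2r //; nia.
  have := HP (size w + k); rewrite -/P => le2.
  rewrite -(mulnA (Bk ^ 2)).
  (* The compilation squares the time, hence the square of [Bk]; as [Bk] is at least 1, the terms of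
     lower degree in it are absorbed as well. *)
  apply: leq_trans (_ : Bk ^ 2 * ((P.+1) * (2 * (size w + k + 1 + P) + 3) + 1) <= _); last first.
    by rewrite leq_mul2l (leq_trans le2 le1) orbT.
  have -> : size (enc_nat k ++ w) = size w + k + 1.
    by rewrite size_cat /enc_nat size_cat size_nseq /=; lia.
  rewrite [X in _ <= X]mulnDr leq_add //; last by rewrite muln_gt0 expn_gt0 B0.
  rewrite -mulnn mulnACA leq_mul //; first by nia.
  nia.
by rewrite /decides_within; split=> //; rewrite a.
Qed.

End Program.

(** The disjunctions are only known to exist; since the signature is finite, a family of them is
    selected by induction, without an axiom of choice. *)
Lemma finite_choice (X : Type) (x0 : X) n (P : nat -> X -> Prop) :
  (forall i, i < n -> exists x, P i x) -> exists f, forall i, i < n -> P i (f i).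
Proof.
elim: n => [|n IH] H; first by exists (fun=> x0).
have [f fP] := IH (fun i l => H i (ltnW l)); have [x xP] := H n (ltnSn n).
exists (fun i => if i == n then x else f i) => i; rewrite ltnS leq_eqVlt.
by case: eqP => [-> _|_ /fP].
Qed.

Theorem theorem15 (T : countType) (A B : structure T) :
  omega_categorical A -> omega_categorical B ->
  (forall t : seq T, 0 < size t -> ep_definable A (size t) (aut_orbit B t)) ->
  in_P (CSP A) ->
  in_FPT (CSP_alien A B).
Proof.
move=> _ catB H [M [c0 MP]].
have [Dj DjP] := finite_choice [::] (fun i l => rel_defines l catB H).
(* A single constant [K] is to bound all arities and every dimension of every disjunct: fresh
   variables, equations, atoms and the lengths of their tuples. *)
pose wt d := ne d + size (eqs d) + size (ats d) + \max_(a <- ats d) size a.2.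
pose K := \max_(i < nrel A + nrel B) ar (sunion A B) i
  + \max_(i < nrel B) \max_(d <- Dj i) wt d.
apply: (@in_FPT_program T A B Dj (\max_(i < nrel B) size (Dj i)) M K c0) => //.
- move=> i l; apply: leq_trans (leq_addr _ _).
  exact: (leq_bigmax (F := fun i : 'I__ => ar (sunion A B) i) (Ordinal l)).
- move=> i d l dD.
  have wK : wt d <= K.
    apply: leq_trans (leq_addl _ _).
    apply: leq_trans (leq_bigmax (F := fun i : 'I__ => \max_(d <- Dj i) wt d) (Ordinal l)).
    exact: leq_bigmax_seq.
  rewrite /wt in wK; apply/and4P; split; try lia.
  apply/allP => a aD; apply: leq_trans wK; apply: leq_trans (leq_addl _ _).
  exact: (leq_bigmax_seq (F := fun a : constr => size a.2)).
- move=> i l; exact: (leq_bigmax (F := fun i : 'I__ => size (Dj i)) (Ordinal l)).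
Qed.
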